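(* Let $p_1, p_2, \alpha_1, \alpha_2$ be non-zero complex constants with $\alpha_1\neq\alpha_2$, and let $L(z,f)$ be a linear difference polynomial in $f$ with constant coefficients. If $f$ is a transcendental entire function with $\rho_2(f)<1$ which is a solution of the difference equation $$f^2(z)+L(z,f)=p_1e^{\alpha_1 z}+p_2e^{\alpha_2 z},$$ then $\rho(f)=1$ and one of the following holds: (i) $T(r,f)\leq 2N\left(r,\frac{1}{f}\right)+S(r,f)$; (ii) $f(z)=c_1e^{\alpha_1 z/2}$, $\; c_1^2=p_1$; (iii) $f(z)=c_2e^{\alpha_2 z/2}$, $\; c_2^2=p_2$; where $c_1, c_2$ are constants.
   Context: A linear difference polynomial in $f$ with constant coefficients is a finite sum $L(z,f)=\sum_{j=1}^{m} b_j f(z+\beta_j)$ with constants $b_j,\beta_j\in\mathbb{C}$. Standard Nevanlinna theory notation: for a meromorphic function $f$ on $\mathbb{C}$, $T(r,f)$ is the characteristic function and $N(r,f)$ the counting function of poles (with multiplicity); so $N(r,1/f)$ counts the zeros of $f$ with multiplicity. $S(r,f)$ denotes any quantity that is $o(T(r,f))$ as $r\to\infty$ outside a set of finite linear measure. The order is $\rho(f)=\limsup_{r\to\infty}\frac{\log^+ T(r,f)}{\log r}$ and the hyper-order is $\rho_2(f)=\limsup_{r\to\infty}\frac{\log^+\log^+ T(r,f)}{\log r}$. $f^2(z)=(f(z))^2$. *)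

(* Defs.v *)
From HB Require Import structures.
From mathcomp Require Import all_boot all_order all_algebra.
From mathcomp Require Import all_classical all_reals all_analysis.
From mathcomp Require Export complex.

Set Implicit Arguments.
Unset Strict Implicit.
Unset Printing Implicit Defensive.

Import Order.TTheory GRing.Theory Num.Theory.
Import numFieldNormedType.Exports.

Local Open Scope classical_set_scope.
Local Open Scope ring_scope.
Local Open Scope complex_scope.

Definition cmod (R : realType) (z : R[i]) : R := ComplexField.Normc.normc z.

Definition cexp (R : realType) (z : R[i]) : R[i] :=
  (expR (complex.Re z) * cos (complex.Im z)) +i*
  (expR (complex.Re z) * sin (complex.Im z)).

(* Complex differentiability at [z].  The topology and the normed module
   structure over the field [R[i]] itself are carried by [R[i]^o]. *)
Definition cderivable (R : realType) (f : R[i] -> R[i]) (z : R[i]) : Prop :=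
  derivable (f : R[i]^o -> R[i]^o) (z : R[i]^o) 1.

Definition entire (R : realType) (f : R[i] -> R[i]) : Prop :=
  forall z : R[i], cderivable f z.

Definition transcendental_entire (R : realType) (f : R[i] -> R[i]) : Prop :=
  entire f /\ ~ exists p : {poly R[i]}, forall z : R[i], f z = p.[z].

Definition linear_difference (R : realType) (m : nat) (b beta : 'I_m -> R[i])
    (f : R[i] -> R[i]) (z : R[i]) : R[i] :=
  \sum_(j < m) b j * f (z + beta j).

(* [f = (z - a)^-n * g] near [a] except at [a], with [g] holomorphic near [a]
   and [g a != 0].  Meromorphic functions are represented by total functions
   whose values at the poles are arbitrary, hence the punctured neighbourhood. *)
Definition has_pole_order (R : realType) (f : R[i] -> R[i]) (a : R[i])
    (n : nat) : Prop :=
  exists g : R[i] -> R[i],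
    [/\ \forall z \near (a : R[i]^o), cderivable g z,
        g a != 0 &
        \forall z \near (a : R[i]^o)^', f z = g z / (z - a) ^+ n].

(* The multiplicity of [a] as a pole of [f]; it is 0 when [a] is not a pole.
   The order [n] in [has_pole_order] is unique when it exists. *)
Definition pole_mult (R : realType) (f : R[i] -> R[i]) (a : R[i]) : nat :=
  xget 0%N [set n | has_pole_order f a n].

(* A meromorphic function has finitely many poles in a closed disc, so
   the sum has finite support (a sum with infinite support would be 0). *)
Definition pole_count (R : realType) (f : R[i] -> R[i]) (t : R) : R :=
  \sum_(a \in [set a : R[i] | cmod a <= t]) ((pole_mult f a)%:R : R).

Definition counting_function (R : realType) (f : R[i] -> R[i]) (r : R) : R :=
  \int[lebesgue_measure]_(t in `]0, r]) ((pole_count f t - pole_count f 0) / t)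
  + pole_count f 0 * ln r.

(* [ln] vanishes on nonpositive reals, so [logp 0 = 0]. *)
Definition logp (R : realType) (x : R) : R := Num.max (ln x) 0.

Definition proximity_function (R : realType) (f : R[i] -> R[i]) (r : R) : R :=
  (2 * pi)^-1 *
  \int[lebesgue_measure]_(t in `[0, 2 * pi])
     logp (cmod (f ((r * cos t) +i* (r * sin t)))).

Definition characteristic (R : realType) (f : R[i] -> R[i]) (r : R) : R :=
  proximity_function f r + counting_function f r.

Definition growth_order (R : realType) (f : R[i] -> R[i]) : \bar R :=
  limf_esup (fun r : R => (logp (characteristic f r) / ln r)%:E) +oo%R.

Definition hyper_order (R : realType) (f : R[i] -> R[i]) : \bar R :=
  limf_esup (fun r : R => (logp (logp (characteristic f r)) / ln r)%:E) +oo%R.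

(* [phi] is an S(r, f): it is o(T(r, f)) as r -> +oo outside [E]. *)
Definition small_quantity (R : realType) (f : R[i] -> R[i]) (phi : R -> R) :
    Prop :=
  exists E : set R,
    [/\ measurable E, (lebesgue_measure E < +oo)%E &
        forall eps : R, 0 < eps ->
          \forall r \near +oo, ~ E r ->
            `|phi r| <= eps * `|characteristic f r|].

(* Main.v *)
(* Iterating f^2 = P - L(f), where P = p1 e^(alpha1 z) + p2 e^(alpha2 z), shows
   that log|f| would double along steps of bounded length if f grew faster than
   exponential type; this contradicts rho_2(f) < 1, so T(r, f) is comparable
   with r and rho(f) = 1.

   Instead of differentiating, apply to the equation the difference operator
   (E_h - e^(alpha1 h)) (E_k - e^(alpha2 k)), which kills P.  It maps f^2 to an
   entire function Phi with |Phi| <= C M and |Phi| <= C M^2, where M(z) is the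
   maximum of |f| on a fixed disc around z.  If Phi vanishes for all h and k,
   then f^2 is a combination of the two exponentials; its zeros are double, so
   one coefficient is zero and (ii) or (iii) holds.

   Otherwise let U be the harmonic majorant (1 + e) H(log+|f|) - (1 - e) H(log-|f|)
   of log M, where H is the Poisson integral of a circle of radius r + O(1)
   (Harnack's inequality).  Then log+|f| + log|f| + log|Phi| <= 3 U + C on the
   circle of radius r.  By Jensen's formula the mean of log|f| is N(r, 1/f) + O(1),
   its increment on r + O(1) is bounded because it is convex in log r and O(r),
   and the mean of log|Phi| is bounded below; hence T <= 2 N + 18 e L r + O(1),
   with L a bound for T(r, f) / (r + 1). *)
Require Import Defs.
From HB Require Import structures.
From mathcomp Require Import all_boot all_order all_algebra.
From mathcomp Require Import all_classical all_reals all_analysis.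
From mathcomp Require Import ring lra.
Set Implicit Arguments.
Unset Strict Implicit.
Unset Printing Implicit Defensive.
Import Order.TTheory GRing.Theory Num.Theory.
Import numFieldNormedType.Exports.
Local Open Scope classical_set_scope.
Local Open Scope ring_scope.
Local Open Scope complex_scope.

(** * The complex modulus and exponential *)

(** The factor 2 is 3 - 1. The mean of 3 U carries three copies of N(r, 1/f) up to small terms, and
    the mean of log|f| on the left takes one back. Bounding Phi by M^2 alone would cost a fourth
    copy where |f| >= 1; the bound by M saves it.

    Working with shifts instead of derivatives avoids any estimate of f'/f or f(z + c)/f(z), but the
    values of f on a whole disc must then be compared. The maximum M has no mean that Jensen's
    formula could compute. The majorant U has one: its mean over the inner circle is the mean of its
    boundary data over the outer circle, and the passage to a bounded neighbourhood costs only e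
    times the mean of |log|f||. This cost is proportional to r, so the lower bound T >= c r is what
    turns it into a small multiple of T.

    On a circle through a zero log|f| is not continuous. Statements about its mean are therefore
    restricted to circles free of zeros; the radii left out are countable and become the exceptional
    set of S(r, f). *)

Section ComplexBasics.
Variable R : realType.
Notation C := R[i].
Implicit Types (z w : C) (r : R).

Lemma normc_cmod z : `|z| = (cmod z)%:C.
Proof. by []. Qed.

Lemma cmod_ge0 z : 0 <= cmod z.
Proof. by case: z => a b; exact: sqrtr_ge0. Qed.

Lemma cmod0 : cmod (0 : C) = 0.
Proof. exact: ComplexField.Normc.normc0. Qed.

Lemma cmod1 : cmod (1 : C) = 1.
Proof. exact: ComplexField.Normc.normc1. Qed.

Lemma cmod_eq0 z : (cmod z == 0) = (z == 0).
Proof.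
apply/eqP/eqP => [/ComplexField.Normc.eq0_normc //|->]; exact: cmod0.
Qed.

Lemma cmod_gt0 z : (0 < cmod z) = (z != 0).
Proof. by rewrite lt_def cmod_eq0 cmod_ge0 andbT. Qed.

Lemma cmodM z w : cmod (z * w) = cmod z * cmod w.
Proof. exact: ComplexField.Normc.normcM. Qed.

Lemma cmodV z : cmod z^-1 = (cmod z)^-1.
Proof. exact: ComplexField.Normc.normcV. Qed.

Lemma cmodX z n : cmod (z ^+ n) = cmod z ^+ n.
Proof. by elim: n => [|n IH]; rewrite ?expr0 ?cmod1// !exprS cmodM IH. Qed.

Lemma cmodD z w : cmod (z + w) <= cmod z + cmod w.
Proof. by rewrite -lecR rmorphD -!normc_cmod ler_normD. Qed.

Lemma cmodN z : cmod (- z) = cmod z.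
Proof. by apply: complexI; rewrite -!normc_cmod normrN. Qed.

Lemma cmodBC z w : cmod (z - w) = cmod (w - z).
Proof. by rewrite -cmodN opprB. Qed.

Lemma cmodB_ge z w : cmod z - cmod w <= cmod (z - w).
Proof. by rewrite lerBlDr; apply: le_trans (cmodD _ _); rewrite subrK. Qed.

Lemma cmod_real r : cmod (r%:C) = `|r|.
Proof. by rewrite /cmod /= expr0n addr0 sqrtr_sqr. Qed.

Lemma sqr_cmod z : cmod z ^+ 2 = complex.Re z ^+ 2 + complex.Im z ^+ 2.
Proof. by case: z => a b; rewrite /cmod /= sqr_sqrtr// addr_ge0// sqr_ge0. Qed.

Lemma sqr_cmodC z : (cmod z ^+ 2)%:C = z * z^*.
Proof.
rewrite sqr_cmod; case: z => a b; apply/eqP; rewrite eq_complex /=.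
by apply/andP; split; apply/eqP; ring.
Qed.

Lemma cmodJ z : cmod z^* = cmod z.
Proof. by case: z => a b; rewrite /cmod /= sqrrN. Qed.

Lemma cmod_ge_Re z : `|complex.Re z| <= cmod z.
Proof.
rewrite -(@ler_pXn2r _ 2) ?nnegrE ?cmod_ge0// sqr_cmod real_normK ?num_real//.
by rewrite lerDl sqr_ge0.
Qed.

Lemma cmod_ge_Im z : `|complex.Im z| <= cmod z.
Proof.
rewrite -(@ler_pXn2r _ 2) ?nnegrE ?cmod_ge0// sqr_cmod real_normK ?num_real//.
by rewrite lerDr sqr_ge0.
Qed.

Lemma ReIm z : z = complex.Re z +i* complex.Im z.
Proof. by case: z. Qed.

Lemma cmod_le_ReIm z : cmod z <= `|complex.Re z| + `|complex.Im z|.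
Proof.
rewrite -(@ler_pXn2r _ 2) ?nnegrE ?cmod_ge0 ?addr_ge0// sqr_cmod.
rewrite sqrrD !real_normK ?num_real//.
have := mulr_ge0 (normr_ge0 (complex.Re z)) (normr_ge0 (complex.Im z)); lra.
Qed.

Lemma cReD z w : complex.Re (z + w) = complex.Re z + complex.Re w.
Proof. by case: z w => a b []. Qed.
Lemma cImD z w : complex.Im (z + w) = complex.Im z + complex.Im w.
Proof. by case: z w => a b []. Qed.
Lemma cReN z : complex.Re (- z) = - complex.Re z.
Proof. by case: z. Qed.
Lemma cImN z : complex.Im (- z) = - complex.Im z.
Proof. by case: z. Qed.
Lemma cReM z w : complex.Re (z * w)
  = complex.Re z * complex.Re w - complex.Im z * complex.Im w.
Proof. by case: z w => a b []. Qed.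
Lemma cImM z w : complex.Im (z * w)
  = complex.Re z * complex.Im w + complex.Im z * complex.Re w.
Proof. by case: z w => a b []. Qed.
Lemma cReMr r z : complex.Re (r%:C * z) = r * complex.Re z.
Proof. by rewrite cReM /= mul0r subr0. Qed.

Lemma cmod_cexp z : cmod (cexp z) = expR (complex.Re z).
Proof.
apply/eqP; rewrite -(@eqrXn2 _ 2) ?cmod_ge0 ?expR_ge0// sqr_cmod /=.
by rewrite !exprMn -mulrDr cos2Dsin2 mulr1.
Qed.

Lemma cexpD z w : cexp (z + w) = cexp z * cexp w.
Proof.
case: z w => a b [c d]; rewrite /cexp /= expRD cosD sinD.
by apply/eqP; rewrite eq_complex /=; apply/andP; split; apply/eqP; ring.
Qed.

Lemma cexp0 : cexp (0 : C) = 1.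
Proof. by rewrite /cexp /= expR0 cos0 sin0 mulr1 mulr0. Qed.

Lemma cexp_neq0 z : cexp z != 0.
Proof. by rewrite -cmod_gt0 cmod_cexp expR_gt0. Qed.

Lemma cexpMn z n : cexp (z *+ n) = cexp z ^+ n.
Proof. by elim: n => [|n IH]; rewrite ?cexp0// mulrS cexpD IH exprS. Qed.

Lemma cexp_surj z : z != 0 -> exists w, cexp w = z.
Proof.
move=> z0; have rz : 0 < cmod z by rewrite cmod_gt0.
pose c := complex.Re z / cmod z; pose s := complex.Im z / cmod z.
have cs : c ^+ 2 + s ^+ 2 = 1.
  by rewrite !exprMn -mulrDl -sqr_cmod -exprMn divff ?expr1n// gt_eqF.
have c1 : -1 <= c <= 1.
  by rewrite -ler_norml normrM (gtr0_norm (x := _^-1)) ?invr_gt0// ler_pdivrMr//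
    mul1r cmod_ge_Re.
have sE : `|s| = sin (acos c).
  rewrite sin_acos//; have -> : 1 - c ^+ 2 = s ^+ 2 by rewrite -cs; ring.
  by rewrite sqrtr_sqr.
exists (ln (cmod z) +i* (if 0 <= s then acos c else - acos c)).
rewrite /cexp /= lnK//.
have -> : cos (if 0 <= s then acos c else - acos c) = c.
  by case: ifP; rewrite ?cosN acosK// itv_boundlr.
have -> : sin (if 0 <= s then acos c else - acos c) = s.
  case: ifP => s0; rewrite ?sinN -sE; first by rewrite ger0_norm.
  by rewrite ler0_norm ?opprK// ltW// ltNge s0.
by rewrite [RHS]ReIm /c /s ![cmod z * _]mulrC !divfK// gt_eqF.
Qed.

End ComplexBasics.

(** * Continuity in the complex plane *)

Section ComplexTopology.
Variable R : realType.
Notation C := R[i].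
Implicit Types (z w : C) (r : R).

Lemma nbhs_cmod z (A : set C) :
  nbhs (z : C^o) A <-> exists2 d : R, 0 < d & forall w, cmod (w - z) < d -> A w.
Proof.
split.
  move=> /nbhs_ballP [e /= e0 eA].
  have [er ei] : 0 < complex.Re e /\ complex.Im e = 0.
    by move: e0; rewrite ltcE /= => /andP[/eqP].
  exists (complex.Re e) => // w wz; apply: eA.
  rewrite -ball_normE /= distrC normc_cmod (_ : e = (complex.Re e)%:C) ?ltcR//.
  by rewrite [LHS]ReIm ei.
move=> [d d0 dA]; apply/nbhs_ballP; exists (d%:C) => /=; first by rewrite ltcR.
move=> w; rewrite -ball_normE /= distrC normc_cmod ltcR; exact: dA.
Qed.

Lemma cvg_cmod (T : Type) (F : set_system T) (FF : Filter F) (f : T -> C) (l : C) :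
  (f : T -> C^o) @ F --> (l : C^o) <->
  (forall e : R, 0 < e -> \forall x \near F, cmod (f x - l) < e).
Proof.
split.
  move=> H e e0; apply: (H [set w | cmod (w - l) < e]).
  by apply/nbhs_cmod; exists e.
move=> H A /nbhs_cmod[e e0 eA]; apply: filterS (H e e0) => x; exact: eA.
Qed.

Lemma nbhs_cfilter z : Filter (nbhs (z : C^o)).
Proof. exact: (nbhs_filter (z : C^o)). Qed.

(** Wrapping the limits in one-constructor types keeps the topology of [C^o] out of later
    statements; [ccontP] and [rcontP] recover the metric form. *)
Variant ccont (f : C -> C) z : Prop := Ccont of
  (f : C^o -> C^o) @ (nbhs (z : C^o)) --> (f z : C^o).

Variant rcont (u : C -> R) z : Prop := Rcont of u @ (nbhs (z : C^o)) --> u z.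

Variant pcont (p : R -> C) (t : R) : Prop := Pcont of
  (p : R -> C^o) @ (nbhs t) --> (p t : C^o).

Lemma ccontP (f : C -> C) z : ccont f z <->
  (forall e : R, 0 < e -> exists2 d : R, 0 < d &
     forall w, cmod (w - z) < d -> cmod (f w - f z) < e).
Proof.
split.
  by move=> [H] e e0; exact: (nbhs_cmod _ _).1 ((cvg_cmod (nbhs_cfilter _) _ _).1 H e e0).
move=> H; constructor; apply: (cvg_cmod (nbhs_cfilter _) _ _).2 => e /H ?; exact:
  (nbhs_cmod _ _).2.
Qed.

Lemma rcontP (u : C -> R) z : rcont u z <->
  (forall e : R, 0 < e -> exists2 d : R, 0 < d &
     forall w, cmod (w - z) < d -> `|u w - u z| < e).
Proof.
split.
  move=> [H] e e0.
  have [d d0 h] := (nbhs_cmod _ _).1 ((@cvgrPdist_lt _ _ _ _ (nbhs_cfilter _) _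
    _).1 H e e0).
  by exists d => // w /h; rewrite distrC.
move=> H; constructor; apply: (@cvgrPdist_lt _ _ _ _ (nbhs_cfilter _) _ _).2 => e
  /H [d d0 h].
by apply: (nbhs_cmod _ _).2; exists d => // w /h; rewrite distrC.
Qed.

Lemma rcont_cmod z : rcont (@cmod R) z.
Proof.
apply/rcontP => e e0; exists e => // w; apply: le_lt_trans.
rewrite ler_norml cmodB_ge andbT lerNl opprB cmodBC; exact: cmodB_ge.
Qed.

Lemma rcont_Re z : rcont (@complex.Re R) z.
Proof.
apply/rcontP => e e0; exists e => // w; apply: le_lt_trans.
rewrite -cReN -cReD; exact: cmod_ge_Re.
Qed.

Lemma rcont_Im z : rcont (@complex.Im R) z.
Proof.
apply/rcontP => e e0; exists e => // w; apply: le_lt_trans.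
rewrite -cImN -cImD; exact: cmod_ge_Im.
Qed.

Lemma cvg_complex (T : Type) (F : set_system T) (FF : Filter F) (f g : T -> R) (a b : R) :
  f @ F --> a -> g @ F --> b ->
  ((fun x => f x +i* g x) : T -> C^o) @ F --> ((a +i* b) : C^o).
Proof.
move=> /cvgrPdist_lt fa /cvgrPdist_lt gb; apply/cvg_cmod => e e0.
have e2 : 0 < e / 2 by rewrite divr_gt0.
near=> x; apply: le_lt_trans (cmod_le_ReIm _) _; rewrite /= [ltRHS]splitr.
by apply: ltrD; rewrite distrC; near: x; [exact: fa | exact: gb].
Unshelve. all: by end_near. Qed.

Lemma ccont_complex (u v : C -> R) z : rcont u z -> rcont v z ->
  ccont (fun w => u w +i* v w) z.
Proof. by move=> [hf] [hg]; constructor; exact: (@cvg_complex C (nbhs (z : C^o))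
  (nbhs_cfilter _) _ _ _ _ hf hg). Qed.

Lemma pcont_complex (u v : R -> R) (t : R) :
  {for t, continuous u} -> {for t, continuous v} ->
  pcont (fun s => u s +i* v s) t.
Proof. by move=> hf hg; constructor; exact: (@cvg_complex R (nbhs t) (nbhs_filter
  _) _ _ _ _ hf hg). Qed.

Lemma ccont_cst (c : C) z : ccont (fun=> c) z.
Proof. constructor; exact: (@cvg_cst C^o c C (nbhs (z:C^o)) (nbhs_cfilter _)). Qed.

Lemma ccont_id z : ccont id z.
Proof. by constructor. Qed.

Lemma ccontD (f g : C -> C) z : ccont f z -> ccont g z ->
  ccont (fun w => f w + g w) z.
Proof. by move=> [hf] [hg]; constructor; exact: (@cvgD C C^o C (nbhs (z:C^o))
  (nbhs_cfilter _) f g (f z) (g z) hf hg). Qed.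

Lemma ccontN (f : C -> C) z : ccont f z -> ccont (fun w => - f w) z.
Proof. by move=> [hf]; constructor; exact: (@cvgN C C^o C (nbhs (z:C^o))
  (nbhs_cfilter _) f (f z) hf). Qed.

Lemma ccontB (f g : C -> C) z : ccont f z -> ccont g z ->
  ccont (fun w => f w - g w) z.
Proof. by move=> hf hg; exact: ccontD hf (ccontN hg). Qed.

Lemma ccont_comp (f g : C -> C) z : ccont f (g z) -> ccont g z ->
  ccont (fun w => f (g w)) z.
Proof. move=> [hf] [hg]; constructor=> A /hf; exact: hg. Qed.

Lemma rcont_comp (u : C -> R) (g : C -> C) z : rcont u (g z) -> ccont g z ->
  rcont (fun w => u (g w)) z.
Proof. move=> [hf] [hg]; constructor=> A /hf; exact: hg. Qed.

Lemma rcont_compR (h : R -> R) (u : C -> R) z : {for u z, continuous h} ->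
  rcont u z -> rcont (fun w => h (u w)) z.
Proof. move=> hf [hg]; constructor=> A /hf; exact: hg. Qed.

Lemma pcont_comp (f : C -> C) (p : R -> C) t : ccont f (p t) -> pcont p t ->
  pcont (fun s => f (p s)) t.
Proof. move=> [hf] [hg]; constructor=> A /hf; exact: hg. Qed.

Lemma cont_comp (u : C -> R) (p : R -> C) t : rcont u (p t) -> pcont p t ->
  {for t, continuous (fun s => u (p s))}.
Proof. move=> [hf] [hg] A /hf; exact: hg. Qed.

Lemma rcontD (f g : C -> R) z : rcont f z -> rcont g z ->
  rcont (fun w => f w + g w) z.
Proof. by move=> [hf] [hg]; constructor; exact: (@cvgD R R^o C (nbhs (z:C^o))
  (nbhs_cfilter _) f g (f z) (g z) hf hg). Qed.

Lemma rcontN (f : C -> R) z : rcont f z -> rcont (fun w => - f w) z.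
Proof. by move=> [hf]; constructor; exact: (@cvgN R R^o C (nbhs (z:C^o))
  (nbhs_cfilter _) f (f z) hf). Qed.

Lemma rcontM (f g : C -> R) z : rcont f z -> rcont g z ->
  rcont (fun w => f w * g w) z.
Proof. by move=> [hf] [hg]; constructor; exact: (@cvgM R C (nbhs (z:C^o))
  (nbhs_cfilter _) f g (f z) (g z) hf hg). Qed.

Lemma rcont_cst (c : R) z : rcont (fun=> c) z.
Proof. constructor; exact: (@cvg_cst R c C (nbhs (z:C^o)) (nbhs_cfilter _)). Qed.

Lemma rcont_max (f g : C -> R) z : rcont f z -> rcont g z ->
  rcont (fun w => Num.max (f w) (g w)) z.
Proof.
move=> /rcontP hf /rcontP hg; apply/rcontP => e e0.
have [d d0 hd] := hf e e0; have [k k0 hk] := hg e e0.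
exists (Num.min d k); first by rewrite lt_min d0.
move=> w; rewrite lt_min => /andP[/hd + /hk].
rewrite !ltr_norml !maxEle => /andP[a1 a2] /andP[b1 b2].
by case: (leP (f w) (g w)) => h1; case: (leP (f z) (g z)) => h2;
  apply/andP; split; lra.
Qed.

Lemma ccont_ReIm (f : C -> C) z : ccont f z ->
  rcont (fun w => complex.Re (f w)) z /\ rcont (fun w => complex.Im (f w)) z.
Proof.
by move=> hf; split; [exact: rcont_comp (rcont_Re _) hf | exact: rcont_comp
  (rcont_Im _) hf].
Qed.

Lemma ccontM (f g : C -> C) z : ccont f z -> ccont g z ->
  ccont (fun w => f w * g w) z.
Proof.
move=> hf hg; under eq_fun do rewrite [_ * _]ReIm cReM cImM.
have [h1 h2] := ccont_ReIm hf; have [h3 h4] := ccont_ReIm hg.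
apply: ccont_complex; last exact: rcontD (rcontM h1 h4) (rcontM h2 h3).
exact: rcontD (rcontM h1 h3) (rcontN (rcontM h2 h4)).
Qed.

Lemma ccontV (f : C -> C) z : f z != 0 -> ccont f z ->
  ccont (fun w => (f w)^-1) z.
Proof.
move=> f0 hf; have [h1 h2] := ccont_ReIm hf.
have VE w : (f w)^-1 = (complex.Re (f w) / cmod (f w) ^+ 2)
    +i* (- complex.Im (f w) / cmod (f w) ^+ 2).
  by rewrite sqr_cmod; case: (f w) => a b; rewrite /= mulNr.
under eq_fun do rewrite VE.
have hV : rcont (fun w => (cmod (f w) ^+ 2)^-1) z.
  apply: (@rcont_compR (fun x => (x ^+ 2)^-1) (fun w => cmod (f w))).
    apply: continuousV; first by rewrite expf_eq0 /= cmod_eq0.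
    exact: exprn_continuous.
  exact: (rcont_comp (rcont_cmod (f z)) hf).
by apply: ccont_complex; [exact: rcontM h1 hV | exact: rcontM (rcontN h2) hV].
Qed.

Lemma ccontX (f : C -> C) n z : ccont f z -> ccont (fun w => f w ^+ n) z.
Proof.
move=> hf; elim: n => [|n IH]; first exact: ccont_cst.
under eq_fun do rewrite exprS; exact: ccontM.
Qed.

Lemma ccont_cexp z : ccont (@cexp R) z.
Proof.
have h1 : rcont (fun z => expR (complex.Re z)) z.
  by apply: (rcont_compR _ (rcont_Re z)); exact: continuous_expR.
have h2 : rcont (fun z => cos (complex.Im z)) z.
  by apply: (rcont_compR _ (rcont_Im z)); exact: continuous_cos.
have h3 : rcont (fun z => sin (complex.Im z)) z.
  by apply: (rcont_compR _ (rcont_Im z)); exact: continuous_sin.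
exact: ccont_complex (rcontM h1 h2) (rcontM h1 h3).
Qed.

End ComplexTopology.

(** * Complex differentiability *)

Section Holomorphic.
Variable R : realType.
Notation C := R[i].
Implicit Types (z w : C) (f g : C -> C).

(** Caratheodory's form of differentiability: [phi] is the difference quotient, completed
    continuously at [z], so [phi z] is the derivative. The rules for sums, products and composites
    become identities between quotients. *)
Definition holo f z := exists2 phi : C -> C,
  ccont phi z & forall w, f w = f z + phi w * (w - z).

Lemma ccont_near f g z (d : R) : 0 < d ->
  (forall w, cmod (w - z) < d -> f w = g w) -> ccont f z -> ccont g z.
Proof.
move=> d0 fg /ccontP hf; apply/ccontP => e /hf[k k0 hk].
exists (Num.min d k); first by rewrite lt_min d0.
move=> w; rewrite lt_min => /andP[wd wk]; rewrite -!fg ?hk//.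
by rewrite subrr cmod0.
Qed.

(** Away from [z] the factor is forced to be the difference quotient, so a local [phi] extends to a
    global one. *)
Lemma holo_nearI f z (phi : C -> C) (d : R) : 0 < d -> ccont phi z ->
  (forall w, cmod (w - z) < d -> f w = f z + phi w * (w - z)) -> holo f z.
Proof.
move=> d0 hphi hf.
exists (fun w => if w == z then phi z else (f w - f z) / (w - z)).
  apply: (ccont_near d0 _ hphi) => w wd; case: eqP => [->//|/eqP wz].
  by rewrite (hf w wd) addrC addKr mulfK// subr_eq0.
move=> w; case: eqP => [->|/eqP wz]; first by rewrite subrr mulr0 addr0.
by rewrite divfK ?subr_eq0// addrC subrK.
Qed.

Lemma holo_cont f z : holo f z -> ccont f z.
Proof.
move=> [phi hphi hf].
apply: (@ccont_near (fun w => f z + phi w * (w - z)) f z 1) => //.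
apply: ccontD; first exact: ccont_cst.
by apply: ccontM => //; apply: ccontB; [exact: ccont_id|exact: ccont_cst].
Qed.

Lemma holo_near f g z (d : R) : 0 < d ->
  (forall w, cmod (w - z) < d -> f w = g w) -> holo f z -> holo g z.
Proof.
move=> d0 fg [phi hphi hf]; apply: (holo_nearI d0 hphi) => w wd.
by rewrite -!fg ?subrr ?cmod0// hf.
Qed.

Lemma holo_cst (c : C) z : holo (fun=> c) z.
Proof. by exists (fun=> 0); [exact: ccont_cst | move=> w; rewrite mul0r addr0]. Qed.

Lemma holo_id z : holo id z.
Proof.
exists (fun=> 1); [exact: ccont_cst | move=> w /=; ring].
Qed.

Lemma holoD f g z : holo f z -> holo g z -> holo (fun w => f w + g w) z.
Proof.
move=> [p hp hf] [q hq hg]; exists (fun w => p w + q w); first exact: ccontD.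
by move=> w; rewrite hf hg; ring.
Qed.

Lemma holoM f g z : holo f z -> holo g z -> holo (fun w => f w * g w) z.
Proof.
move=> [p hp hf] gz; have cg := holo_cont gz; case: gz => q hq hg.
exists (fun w => f z * q w + p w * g w).
  by apply: ccontD; apply: ccontM => //; exact: ccont_cst.
by move=> w; rewrite (hf w) mulrDl {1}(hg w); ring.
Qed.

Lemma holoN f z : holo f z -> holo (fun w => - f w) z.
Proof.
move=> [p hp hf]; exists (fun w => - p w); first exact: ccontN.
by move=> w; rewrite hf; ring.
Qed.

Lemma holoB f g z : holo f z -> holo g z -> holo (fun w => f w - g w) z.
Proof. by move=> hf hg; apply: holoD => //; exact: holoN. Qed.

Lemma holo_comp f g z : holo f (g z) -> holo g z -> holo (fun w => f (g w)) z.
Proof.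
move=> [p hp hf] gz; have cg := holo_cont gz; case: gz => q hq hg.
exists (fun w => p (g w) * q w); first by apply: ccontM => //; exact: ccont_comp.
by move=> w; rewrite (hf (g w)) {2}(hg w); ring.
Qed.

Lemma holo_inv z : z != 0 -> holo (fun w => w^-1) z.
Proof.
move=> z0; have d0 : 0 < cmod z by rewrite cmod_gt0.
apply: (@holo_nearI _ _ (fun w => - (w * z)^-1) _ d0).
  apply: ccontN; apply: ccontV; first by rewrite mulf_neq0.
  by apply: ccontM; [exact: ccont_id | exact: ccont_cst].
move=> w wd; have w0 : w != 0.
  by apply: contraTneq wd => ->; rewrite sub0r cmodN ltxx.
by field; rewrite w0 z0.
Qed.

Lemma holoV f z : f z != 0 -> holo f z -> holo (fun w => (f w)^-1) z.
Proof. by move=> f0 hf; apply: (@holo_comp (fun w => w^-1)) => //; exact: holo_inv. Qed.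

Lemma holoX f n z : holo f z -> holo (fun w => f w ^+ n) z.
Proof.
move=> hf; elim: n => [|n IH]; first exact: holo_cst.
under eq_fun do rewrite exprS; exact: holoM.
Qed.

Lemma holo_prod (I : Type) (s : seq I) (f : I -> C -> C) z :
  (forall i, holo (f i) z) -> holo (fun w => \prod_(i <- s) f i w) z.
Proof.
move=> hf; elim: s => [|a s IH].
  under eq_fun do rewrite big_nil; exact: holo_cst.
under eq_fun do rewrite big_cons; exact: holoM.
Qed.

Lemma cderivable_holo f z : cderivable f z <-> holo f z.
Proof.
split.
  move=> /cvg_ex[/= l hl].
  exists (fun w => if w == z then l else (f w - f z) / (w - z)); last first.
    move=> w; case: eqP => [->|/eqP wz]; first by rewrite subrr mulr0 addr0.
    by rewrite divfK ?subr_eq0// addrC subrK.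
  apply/ccontP => e e0.
  have : nbhs (l : C^o) [set w | cmod (w - l) < e] by apply/nbhs_cmod; exists e.
  move=> /hl; rewrite /nbhs /= /dnbhs /within /= => /nbhs_cmod[d d0 hd].
  exists d => // w wd; rewrite eqxx; case: eqP => [_|/eqP wz].
    by rewrite subrr cmod0.
  have := hd (w - z); rewrite subr0 => /(_ wd); rewrite subr_eq0 => /(_ wz).
  by rewrite /= /shift /= -[_ *: 1]/(_ * 1) mulr1 subrK mulrC.
move=> [phi /ccontP hphi hf]; apply/cvg_ex; exists (phi z) => A /nbhs_cmod[e e0 eA].
have [d d0 hd] := hphi e e0.
rewrite /nbhs /= /dnbhs /within /=; apply/nbhs_cmod; exists d => // h.
rewrite subr0 => hlt h0; apply: eA.
rewrite /= /shift /= -[_ *: 1]/(_ * 1) mulr1 (hf (h + z)) addrK.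
rewrite [f z + _]addrC addrK -[_ *: _]/(_ * _) mulrCA mulVf// mulr1.
by apply: hd; rewrite addrK.
Qed.

Lemma cexp_caratheodory0 : exists phi : C -> C,
  [/\ ccont phi 0, phi 0 = 1 & forall h, cexp h = 1 + phi h * h].
Proof.
have [p [pE pc p0]] := (is_derive1_caratheodory (@expR R) 0 (expR 0)).1
  (is_derive_expR 0).
have [q [qE qc q0]] := (is_derive1_caratheodory (@cos R) 0 (- sin 0)).1 (is_derive_cos 0).
have [s [sE sc s0]] := (is_derive1_caratheodory (@sin R) 0 (cos 0)).1 (is_derive_sin 0).
rewrite expR0 in p0 pE; rewrite sin0 oppr0 cos0 in q0 qE; rewrite sin0 cos0 in s0 sE.
exists (fun h => if h == 0 then 1 else (cexp h - 1) / h).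
split; last first.
- move=> h; case: eqP => [->|/eqP h0]; first by rewrite mulr0 addr0 cexp0.
  by rewrite divfK// addrC subrK.
- by rewrite eqxx.
have hp : rcont (fun h : C => p (complex.Re h) - 1) 0.
  apply: rcontD; last exact: rcont_cst.
  by apply: rcont_compR (rcont_Re _).
have hq : ccont (fun h : C => (expR (complex.Re h))%:C *
    (q (complex.Im h) +i* s (complex.Im h)) - 'i) 0.
  apply: ccontB; last exact: ccont_cst.
  apply: ccontM; apply: ccont_complex.
  - by apply: rcont_compR (rcont_Re _); exact: continuous_expR.
  - exact: rcont_cst.
  - by apply: rcont_compR (rcont_Im _).
  - by apply: rcont_compR (rcont_Im _).
move/rcontP in hp; move/ccontP in hq.
apply/ccontP => e e0; have e2 : 0 < e / 2 by rewrite divr_gt0.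
have [d d0 hd] := hp _ e2; have [k k0 hk] := hq _ e2.
exists (Num.min d k); first by rewrite lt_min d0.
move=> h; rewrite eqxx lt_min => /andP[/hd + /hk]; rewrite p0 q0 s0 expR0.
set B := (expR _)%:C * _ - 'i => + hB.
rewrite [1 - 1]subrr subr0 mul1r subrr subr0 in hB * => hA.
case: eqP => [_|/eqP h0]; first by rewrite subrr cmod0.
(* With h = a + ib, the error e^h - 1 - h is (p a - 1) a + B b; both coefficients tend to 0, while
   |a| and |b| are at most |h|. *)
have -> : (cexp h - 1) / h - 1
    = ((p (complex.Re h) - 1) * complex.Re h)%:C / h + B * (complex.Im h)%:C / h.
  have -> : (cexp h - 1) / h - 1 = (cexp h - 1 - h) / h.
    by rewrite [in RHS]mulrBl divff.
  rewrite -mulrDl; congr (_ / _).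
  have := pE (complex.Re h); have := qE (complex.Im h); have := sE (complex.Im h).
  rewrite !subr0 !addr0 /B /cexp; case: (h) => a b /= sb qb pa.
  have -> : sin b = s b * b by []. 
  have -> : cos b = 1 + q b * b by rewrite -qb addrC subrK.
  apply/eqP; rewrite eq_complex /=; apply/andP; split; apply/eqP; last by ring.
  rewrite [(p a - 1) * a]mulrBl -pa; ring.
apply: le_lt_trans (cmodD _ _) _; rewrite [ltRHS]splitr.
have ch : 0 < cmod h by rewrite cmod_gt0.
apply: ltrD; rewrite !cmodM cmodV ltr_pdivrMr//.
  rewrite cmod_real normrM; apply: le_lt_trans (_ : `|p (complex.Re h) - 1| * cmod h < _).
    by rewrite ler_wpM2l// cmod_ge_Re.
  by rewrite ltr_pM2r.
rewrite cmod_real; apply: le_lt_trans (_ : cmod B * cmod h < _).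
  by rewrite ler_wpM2l ?cmod_ge0// cmod_ge_Im.
by rewrite ltr_pM2r.
Qed.

Lemma holo_cexp z : holo (@cexp R) z.
Proof.
have [phi [hphi _ hE]] := cexp_caratheodory0.
exists (fun w => cexp z * phi (w - z)).
  apply: ccontM; first exact: ccont_cst.
  apply: ccont_comp; first by rewrite subrr.
  by apply: ccontB; [exact: ccont_id | exact: ccont_cst].
move=> w; have -> : cexp w = cexp z * cexp (w - z) by rewrite -cexpD addrC subrK.
by rewrite (hE (w - z)); ring.
Qed.

End Holomorphic.

(** * Integrals on segments and the Goursat lemma *)

Section Integrals.
Variable R : realType.
Notation C := R[i].
Implicit Types (a b c : R) (u v : R -> R) (F G : R -> C).

Definition cont_on a b u := forall x, a <= x <= b -> {for x, continuous u}.
Definition pcont_on a b F := forall x, a <= x <= b -> pcont F x.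

Definition rint a b u := \int[lebesgue_measure]_(x in `[a, b]) u x.

Lemma rint_integrable a b u : cont_on a b u ->
  lebesgue_measure.-integrable `[a, b] (EFin \o u).
Proof.
move=> hu; apply: continuous_compact_integrable; first exact: segment_compact.
by apply/subspace_continuousP => x xab; apply: cvg_within_filter; apply: hu;
  rewrite /= in_itv in xab.
Qed.

Lemma eq_rint a b u v : (forall x, a <= x <= b -> u x = v x) ->
  rint a b u = rint a b v.
Proof.
by move=> uv; apply: eq_Rintegral => x; rewrite inE /= in_itv /=; exact: uv.
Qed.

Lemma rintD a b u v : cont_on a b u -> cont_on a b v ->
  rint a b (fun x => u x + v x) = rint a b u + rint a b v.
Proof. by move=> hu hv; apply: RintegralD => //; exact: rint_integrable. Qed.

Lemma rintZ a b k u : cont_on a b u ->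
  rint a b (fun x => k * u x) = k * rint a b u.
Proof. by move=> hu; apply: RintegralZl => //; exact: rint_integrable. Qed.

Lemma rint_cst a b k : a <= b -> rint a b (fun=> k) = k * (b - a).
Proof.
move=> ab; rewrite /rint Rintegral_cst//; congr (_ * _).
apply: etrans (congr1 fine (@lebesgue_measure_itv R `[a, b]%R)) _.
by rewrite /= lte_fin; case: ltP => //= ba;
  rewrite (@le_anti _ _ a b) ?ab// subrr.
Qed.

Lemma rint_le a b u v : cont_on a b u -> cont_on a b v ->
  (forall x, a <= x <= b -> u x <= v x) -> rint a b u <= rint a b v.
Proof.
move=> hu hv uv; apply: le_Rintegral ; [exact: measurable_itv|exact:
  rint_integrable|exact: rint_integrable|].
by move=> x; rewrite /= in_itv /=; exact: uv.
Qed.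

Lemma rint_chasles a b c u : a <= c <= b -> cont_on a b u ->
  rint a b u = rint a c u + rint c b u.
Proof.
move=> /andP[ac cb] hu; have := @Rintegral_itvB R u (BLeft a) (BRight b) c.
rewrite !bnd_simp => /(_ (rint_integrable hu) ac cb) => /eqP.
rewrite subr_eq addrC => /eqP; rewrite Rintegral_itv_obnd_cbnd//.
have h := rint_integrable hu.
by apply: integrableS h => //; apply: subset_itv; rewrite bnd_simp.
Qed.

Lemma rint_id a b : a <= b -> rint a b id = (b ^+ 2 - a ^+ 2) / 2.
Proof.
rewrite le_eqVlt => /predU1P[->|ab].
  by rewrite /rint set_itv1 Rintegral_set1 subrr mul0r.
rewrite /rint /Rintegral (@continuous_FTC2 _ _ (fun x => x ^+ 2 / 2))//=.
- by rewrite mulrBl.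
- by apply: continuous_subspaceT => x; exact: cvg_id.
- split=> [x _|//|//].
  + exact: ex_derive.
  + by apply: cvg_at_right_filter; apply: cvgMl; exact: exprn_continuous.
  + by apply: cvg_at_left_filter; apply: cvgMl; exact: exprn_continuous.
- move=> x _; rewrite derive1E derive_val !scaler0 add0r.
  rewrite -[_ *: (_ + _)]/(_ * _) -[x%:A]/(x * 1); field.
Unshelve. all: by []. Qed.

Lemma pcont_ReIm F x : pcont F x ->
  {for x, continuous (fun t => complex.Re (F t))} /\
  {for x, continuous (fun t => complex.Im (F t))}.
Proof.
by move=> hF; split; [exact: cont_comp (rcont_Re _) hF|exact: cont_comp (rcont_Im _) hF].
Qed.

Lemma pcont_cst (k : C) x : pcont (fun=> k) x.
Proof. by constructor; exact: cvg_cst. Qed.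

Lemma pcontD F G x : pcont F x -> pcont G x -> pcont (fun t => F t + G t) x.
Proof.
move=> /pcont_ReIm[h1 h2] /pcont_ReIm[h3 h4].
under eq_fun do rewrite [_ + _]ReIm cReD cImD.
by apply: pcont_complex; apply: continuousD.
Qed.

Lemma pcontM F G x : pcont F x -> pcont G x -> pcont (fun t => F t * G t) x.
Proof.
move=> /pcont_ReIm[h1 h2] /pcont_ReIm[h3 h4].
under eq_fun do rewrite [_ * _]ReIm cReM cImM.
apply: pcont_complex; last by apply: continuousD; exact: continuousM.
by apply: continuousB; exact: continuousM.
Qed.

Definition cint a b F :=
  rint a b (fun x => complex.Re (F x)) +i* rint a b (fun x => complex.Im (F x)).

Lemma eq_cint a b F G : (forall x, a <= x <= b -> F x = G x) ->
  cint a b F = cint a b G.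
Proof. by move=> FG; congr (_ +i* _); apply: eq_rint => x /FG ->. Qed.

Lemma cintD a b F G : pcont_on a b F -> pcont_on a b G ->
  cint a b (fun x => F x + G x) = cint a b F + cint a b G.
Proof.
move=> hF hG; apply/eqP; rewrite eq_complex /= -!rintD; first last.
all: try by move=> x xab; have [] := pcont_ReIm (hF x xab); have [] := pcont_ReIm
  (hG x xab).
by apply/andP; split; apply/eqP; apply: eq_rint => x _; rewrite ?cReD ?cImD.
Qed.

Lemma cintM a b (k : C) F : pcont_on a b F ->
  cint a b (fun x => k * F x) = k * cint a b F.
Proof.
move=> hF; case: k => k l.
have hr s : cont_on a b (fun x => s * complex.Re (F x)).
  move=> x xab; apply: continuousM; first exact: cvg_cst.
  by have [] := pcont_ReIm (hF x xab).
have hi s : cont_on a b (fun x => s * complex.Im (F x)).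
  move=> x xab; apply: continuousM; first exact: cvg_cst.
  by have [] := pcont_ReIm (hF x xab).
have h1 : cont_on a b (fun x => complex.Re (F x)) by move=> x xab; have [] :=
  pcont_ReIm (hF x xab).
have h2 : cont_on a b (fun x => complex.Im (F x)) by move=> x xab; have [] :=
  pcont_ReIm (hF x xab).
apply/eqP; rewrite eq_complex /= -mulNr -!rintZ// -!rintD//.
apply/andP; split; apply/eqP; apply: eq_rint => x _; rewrite ?cReM ?cImM /=; ring.
Qed.

Lemma cintB a b F G : pcont_on a b F -> pcont_on a b G ->
  cint a b (fun x => F x - G x) = cint a b F - cint a b G.
Proof.
move=> hF hG; rewrite -[in RHS]mulN1r -cintM// -cintD//.
  by apply: eq_cint => x _; rewrite mulN1r.
by move=> x /hG h; apply: pcontM => //; exact: pcont_cst.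
Qed.

Lemma cint_cst a b (k : C) : a <= b -> cint a b (fun=> k) = k * (b - a)%:C.
Proof.
move=> ab; rewrite /cint !rint_cst//; case: k => k l.
by apply/eqP; rewrite eq_complex /=; apply/andP; split; apply/eqP; ring.
Qed.

Lemma cint_chasles a b c F : a <= c <= b -> pcont_on a b F ->
  cint a b F = cint a c F + cint c b F.
Proof.
move=> acb hF; rewrite /cint (rint_chasles acb); last first.
  by move=> x xab; have [] := pcont_ReIm (hF x xab).
rewrite [in X in _ +i* X](rint_chasles acb)//.
by move=> x xab; have [] := pcont_ReIm (hF x xab).
Qed.

Lemma rint_norm_le a b u M : a <= b -> cont_on a b u ->
  (forall x, a <= x <= b -> `|u x| <= M) -> `|rint a b u| <= M * (b - a).
Proof.
move=> ab hu uM; rewrite ler_norml -mulNr -!rint_cst//.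
apply/andP; split; apply: rint_le => //; try by move=> x _; exact: cvg_cst.
  by move=> x /uM; rewrite ler_norml => /andP[].
by move=> x /uM; rewrite ler_norml => /andP[].
Qed.

(* The factor [2] comes from bounding both components separately. *)
Lemma cmod_cint_le a b F M : a <= b -> pcont_on a b F ->
  (forall x, a <= x <= b -> cmod (F x) <= M) ->
  cmod (cint a b F) <= 2 * M * (b - a).
Proof.
move=> ab hF FM; apply: le_trans (cmod_le_ReIm _) _ => /=.
rewrite -mulrA mulr_natl mulr2n; apply: lerD; apply: rint_norm_le => //.
- by move=> x /hF /pcont_ReIm[].
- by move=> x /FM; apply: le_trans; exact: cmod_ge_Re.
- by move=> x /hF /pcont_ReIm[].
- by move=> x /FM; apply: le_trans; exact: cmod_ge_Im.
Qed.

End Integrals.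

Ltac cring := apply/eqP; rewrite eq_complex /=; apply/andP; split; apply/eqP; ring.

(** * The Goursat lemma by bisection *)

Section Goursat.
Variable R : realType.
Notation C := R[i].
Implicit Types (a b c d x y : R) (F : C -> C).

(** The contour integral of [F] taken counterclockwise, with dz = dx on the horizontal and dz = i dy
    on the vertical sides. *)
Definition bdry F a b c d : C :=
  cint a b (fun x => F (x +i* c)) + 'i * cint c d (fun y => F (b +i* y))
  - cint a b (fun x => F (x +i* d)) - 'i * cint c d (fun y => F (a +i* y)).

Definition rect a b c d (w : C) :=
  a <= complex.Re w <= b /\ c <= complex.Im w <= d.

Lemma pcont_hor y x : pcont (fun s : R => s +i* y) x.
Proof. by apply: pcont_complex; [exact: cvg_id | exact: cvg_cst]. Qed.

Lemma pcont_ver y x : pcont (fun s : R => x +i* s) y.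
Proof. by apply: pcont_complex; [exact: cvg_cst | exact: cvg_id]. Qed.

Lemma pcont_on_hor F a b c d a' b' y : (forall w, rect a b c d w -> ccont F w) ->
  a <= a' -> b' <= b -> c <= y <= d -> pcont_on a' b' (fun x => F (x +i* y)).
Proof.
move=> hF aa bb cyd x /andP[ax xb]; apply: pcont_comp (pcont_hor _ _).
by apply: hF; split => //=; rewrite (le_trans aa ax) (le_trans xb bb).
Qed.

Lemma pcont_on_ver F a b c d c' d' x : (forall w, rect a b c d w -> ccont F w) ->
  c <= c' -> d' <= d -> a <= x <= b -> pcont_on c' d' (fun y => F (x +i* y)).
Proof.
move=> hF cc dd axb y /andP[cy yd]; apply: pcont_comp (pcont_ver _ _).
by apply: hF; split => //=; rewrite (le_trans cc cy) (le_trans yd dd).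
Qed.

Lemma bdry_splitx F a m b c d : a <= m <= b -> c <= d ->
  (forall w, rect a b c d w -> ccont F w) ->
  bdry F a b c d = bdry F a m c d + bdry F m b c d.
Proof.
move=> amb cd hF; have [am mb] := andP amb; have ab := le_trans am mb.
rewrite /bdry (cint_chasles amb); last first.
  by apply: pcont_on_hor hF _ _ _ => //; rewrite lexx.
rewrite (@cint_chasles _ a b m (fun x => F (x +i* d)))//; last first.
  by apply: pcont_on_hor hF _ _ _ => //; rewrite lexx andbT.
ring.
Qed.

Lemma bdry_splity F a b c m d : c <= m <= d -> a <= b ->
  (forall w, rect a b c d w -> ccont F w) ->
  bdry F a b c d = bdry F a b c m + bdry F a b m d.
Proof.
move=> cmd ab hF; have [cm md] := andP cmd; have cd := le_trans cm md.
rewrite /bdry (cint_chasles cmd); last first.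
  by apply: pcont_on_ver hF _ _ _ => //; rewrite lexx andbT.
rewrite (@cint_chasles _ c d m (fun x => F (a +i* x)))//; last first.
  by apply: pcont_on_ver hF _ _ _ => //; rewrite lexx.
ring.
Qed.

(** One form for all four sides: [u + v * x%:C] with [v = 1] runs along a horizontal side and with
    [v = 'i] along a vertical one. *)
Lemma cint_affine a b (p q : C) (u v : C) : a <= b ->
  cint a b (fun x => p + q * (u + v * x%:C)) =
  (p + q * u) * (b - a)%:C + q * v * ((b ^+ 2 - a ^+ 2) / 2)%:C.
Proof.
move=> ab; have hid : pcont_on a b (fun x => x%:C).
  by move=> x _; exact: pcont_hor.
have hc k : pcont_on a b (fun=> k : C) by move=> x _; exact: pcont_cst.
rewrite (@eq_cint _ _ _ _ (fun x => (p + q * u) + q * v * x%:C)); last first.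
  by move=> x _; ring.
rewrite cintD ?cint_cst// ?cintM//; last first.
  by move=> x xab; apply: pcontM; [exact: pcont_cst | exact: hid].
congr (_ + _ * _); rewrite /cint /= rint_id//.
by rewrite rint_cst// mul0r.
Qed.

Lemma bdry_affine a b c d (p q : C) : a <= b -> c <= d ->
  bdry (fun w => p + q * w) a b c d = 0.
Proof.
move=> ab cd; rewrite /bdry.
have hE x y : x +i* y = y *i + 1 * x%:C :> C.
  by cring.
have vE x y : x +i* y = x%:C + 'i * y%:C :> C.
  by cring.
rewrite (@eq_cint _ _ _ _ (fun x => p + q * (c *i + 1 * x%:C))); last by move=> x
  _; rewrite hE.
rewrite (@eq_cint _ _ _ (fun x => p + q * (x +i* d)) (fun x => p + q * (d *i + 1 *
  x%:C))); last by move=> x _; rewrite hE.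
rewrite (@eq_cint _ _ _ (fun x => p + q * (b +i* x)) (fun x => p + q * (b%:C + 'i *
  x%:C))); last by move=> x _; rewrite vE.
rewrite (@eq_cint _ _ _ (fun x => p + q * (a +i* x)) (fun x => p + q * (a%:C + 'i *
  x%:C))); last by move=> x _; rewrite vE.
rewrite !cint_affine//.
have ii (t : R) : t *i = 'i * t%:C :> C.
  by cring.
rewrite !ii !rmorphB /= !rmorphM /= !rmorphB /= fmorphV !rmorphXn /=.
field.
by [].
Qed.

Lemma bdryB F G a b c d : a <= b -> c <= d ->
  (forall w, rect a b c d w -> ccont F w) ->
  (forall w, rect a b c d w -> ccont G w) ->
  bdry (fun w => F w - G w) a b c d = bdry F a b c d - bdry G a b c d.
Proof.
move=> ab cd hF hG; rewrite /bdry !cintB; first ring.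
all: by (apply: pcont_on_hor + apply: pcont_on_ver); eauto; rewrite ?lexx ?ab ?cd.
Qed.

Lemma cmod_bdry_le F a b c d M : a <= b -> c <= d ->
  (forall w, rect a b c d w -> ccont F w) ->
  (forall w, rect a b c d w -> cmod (F w) <= M) ->
  cmod (bdry F a b c d) <= 4 * M * ((b - a) + (d - c)).
Proof.
move=> ab cd hF FM.
have H y : c <= y <= d -> cmod (cint a b (fun x => F (x +i* y))) <= 2 * M * (b - a).
  move=> cyd; apply: cmod_cint_le => //; first exact: (pcont_on_hor hF).
  by move=> x axb; exact: FM.
have V x : a <= x <= b -> cmod ('i * cint c d (fun y => F (x +i* y))) <= 2 * M * (d - c).
  move=> axb; rewrite cmodM (_ : cmod 'i = 1) ?mul1r; last first.
    by rewrite /cmod /= expr0n expr1n add0r sqrtr1.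
  apply: cmod_cint_le => //; first exact: (pcont_on_ver hF).
  by move=> y cyd; exact: FM.
have /H h1 : c <= c <= d by rewrite lexx.
have /H h2 : c <= d <= d by rewrite lexx cd.
have /V v1 : a <= a <= b by rewrite lexx.
have /V v2 : a <= b <= b by rewrite lexx ab.
rewrite /bdry; apply: le_trans (cmodD _ _) _.
have := cmodD (cint a b (fun x => F (x +i* c))) ('i * cint c d (fun y => F (b +i* y))).
have := cmodD (cint a b (fun x => F (x +i* c)) + 'i * cint c d (fun y => F (b +i*
  y))) (- cint a b (fun x => F (x +i* d))).
rewrite ?cmodN; lra.
Qed.

Section Bisection.
Variables (F : C -> C) (a c W H M : R).
Hypotheses (W0 : 0 <= W) (H0 : 0 <= H) (M0 : 0 < M).
Hypothesis hF : forall w, rect a (a + W) c (c + H) w -> holo F w.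

Let sq n : R := (2 ^+ n)^-1.
(** [sq n] is the ratio of the sides after [n] halvings; a bad rectangle keeps a share of at least
    4^-n of the lower bound [M]. *)
Let bad n (s : R * R) :=
  [/\ a <= s.1 /\ s.1 + W * sq n <= a + W, c <= s.2 /\ s.2 + H * sq n <= c + H &
   M * sq n ^+ 2 <= cmod (bdry F s.1 (s.1 + W * sq n) s.2 (s.2 + H * sq n))].
Let next n (s t : R * R) :=
  [/\ s.1 <= t.1 /\ t.1 + W * sq n.+1 <= s.1 + W * sq n,
      s.2 <= t.2 /\ t.2 + H * sq n.+1 <= s.2 + H * sq n & bad n.+1 t].

Let sqS n : sq n = 2 * sq n.+1.
Proof. by rewrite /sq exprS; field; rewrite expf_neq0. Qed.

Let sq_ge0 n : 0 <= sq n.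
Proof. by rewrite invr_ge0 exprn_ge0. Qed.

(** The integrals over the four quarters add up to the whole, so they cannot all fall below a
    quarter of the bound. *)
Lemma bad_next n s : bad n s -> exists t, next n s t.
Proof.
case: s => x y [[ax xa] [cy yc] hM0]; rewrite /= in ax xa cy yc.
have {}hM0 : M * sq n ^+ 2 <= cmod (bdry F x (x + W * sq n) y (y + H * sq n)) := hM0.
set w := W * sq n.+1; set h := H * sq n.+1.
have wE : W * sq n = w + w by rewrite sqS /w; ring.
have hE : H * sq n = h + h by rewrite sqS /h; ring.
have w0 : 0 <= w by rewrite mulr_ge0.
have h0 : 0 <= h by rewrite mulr_ge0.
have cF w' : rect x (x + (w + w)) y (y + (h + h)) w' -> ccont F w'.
  move=> [/andP[h1 h2] /andP[h3 h4]]; apply: holo_cont; apply: hF.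
  rewrite wE in xa; rewrite hE in yc; split; apply/andP; split; lra.
move: hM0; rewrite wE hE (@bdry_splitx F x (x + w)); [|apply/andP; split;
  lra|lra|exact: cF].
rewrite (@bdry_splity F _ _ y (y + h) (y + (h + h))); [|apply/andP; split;
  lra|lra|]; last first.
  by move=> w' [/andP[h1 h2] h3]; apply: cF; split=> //; apply/andP; split; lra.
rewrite (@bdry_splity F _ _ y (y + h) (y + (h + h))); [|apply/andP; split;
  lra|lra|]; last first.
  by move=> w' [/andP[h1 h2] h3]; apply: cF; split=> //; apply/andP; split; lra.
have sE : M * sq n ^+ 2 = 4 * (M * sq n.+1 ^+ 2) by rewrite sqS; ring.
rewrite sE (addrA x w w) (addrA y h h).
move=> hM.
have pick x' y' : (x' = x \/ x' = x + w) -> (y' = y \/ y' = y + h) ->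
   M * sq n.+1 ^+ 2 <= cmod (bdry F x' (x' + w) y' (y' + h)) ->
   exists t, next n (x, y) t.
  move=> hx hy hb; exists (x', y'); rewrite /next /bad wE hE -/w -/h; cbn [fst snd].
  rewrite wE in xa; rewrite hE in yc.
  split; [by case: hx => ->; lra | by case: hy => ->; lra | split => //].
    by case: hx => ->; lra.
  by case: hy => ->; lra.
case: (leP (M * sq n.+1 ^+ 2) (cmod (bdry F x (x + w) y (y + h)))) => [h1|h1].
  by apply: pick h1; left.
case: (leP (M * sq n.+1 ^+ 2) (cmod (bdry F x (x + w) (y + h) (y + h + h)))) => [h2|h2].
  by apply: pick h2; [left|right].
case: (leP (M * sq n.+1 ^+ 2) (cmod (bdry F (x + w) (x + w + w) y (y + h)))) => [h3|h3].
  by apply: pick h3; [right|left].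
case: (leP (M * sq n.+1 ^+ 2) (cmod (bdry F (x + w) (x + w + w) (y + h) (y + h +
  h)))) => [h4|h4].
  by apply: pick h4; right.
exfalso; move: hM; rewrite leNgt => /negP; apply.
set b1 := bdry F x (x + w) y (y + h) in h1 *.
set b2 := bdry F x (x + w) (y + h) _ in h2 *.
set b3 := bdry F (x + w) _ y _ in h3 *.
set b4 := bdry F (x + w) _ (y + h) _ in h4 *.
apply: le_lt_trans (cmodD _ _) _; have := cmodD b3 b4; have := cmodD b1 b2.
by clear -h1 h2 h3 h4; clearbody b1 b2 b3 b4; lra.
Qed.

Lemma bisection_contra : M <= cmod (bdry F a (a + W) c (c + H)) -> False.
Proof.
move=> hM.
(* [bad_next] gives a successor to bad corners only; guarding it by the implication makes the choice
   total. *)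
have ex p : exists t, bad p.1 p.2 -> next p.1 p.2 t.
  have [/bad_next[t ht]|nb] := pselect (bad p.1 p.2); first by exists t.
  by exists p.2.
have [g gP] := choice ex.
pose s := fix s n := if n is m.+1 then g (m, s m) else (a, c).
have sb n : bad n (s n).
  elim: n => [|n IH]; last by have [] := gP (n, s n) IH.
  by rewrite /bad /sq expr0 invr1 !mulr1 expr1n mulr1 /= !lexx.
have sn n : next n (s n) (s n.+1) by exact: gP (n, s n) (sb n).
have mono n k : [/\ (s n).1 <= (s (n + k)%N).1, (s (n + k)%N).1 + W * sq (n + k) <=
  (s n).1 + W * sq n,
   (s n).2 <= (s (n + k)%N).2 & (s (n + k)%N).2 + H * sq (n + k) <= (s n).2 + H * sq n].
  elim: k => [|k [h1 h2 h3 h4]]; first by rewrite addn0.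
  by rewrite addnS; have [[? ?] [? ?] _] := sn (n + k)%N; split; lra.
have W1 n : 0 <= W * sq n by rewrite mulr_ge0.
have H1 n : 0 <= H * sq n by rewrite mulr_ge0.
have up n k : (s k).1 <= (s n).1 + W * sq n /\ (s k).2 <= (s n).2 + H * sq n.
  have [/subnKC <-|/ltnW /subnKC <-] := leqP n k.
    by have [? ? ? ?] := mono n (k - n)%N; have := W1 (n + (k - n))%N; have := H1
      (n + (k - n))%N; lra.
  by have [? ? ? ?] := mono k (n - k)%N; have := W1 (k + (n - k))%N; have := H1 (k
    + (n - k))%N; lra.
pose X := [set (s n).1 | n in [set: nat]]; pose Y := [set (s n).2 | n in [set: nat]].
have Xn k : (s k).1 <= sup X <= (s k).1 + W * sq k.
  apply/andP; split.
    apply: sup_upper_bound; last by exists k.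
    split; first by exists (s k).1, k.
    by exists ((s 0%N).1 + W * sq 0) => _ [n _ <-]; have [] := up 0%N n.
  apply: ge_sup => [|_ [n _ <-]]; first by exists (s k).1, k.
  by have [] := up k n.
have Yn k : (s k).2 <= sup Y <= (s k).2 + H * sq k.
  apply/andP; split.
    apply: sup_upper_bound; last by exists k.
    split; first by exists (s k).2, k.
    by exists ((s 0%N).2 + H * sq 0) => _ [n _ <-]; have [] := up 0%N n.
  apply: ge_sup => [|_ [n _ <-]]; first by exists (s k).2, k.
  by have [] := up k n.
(* The suprema of the left and lower edges give a point common to all rectangles of the nest. *)
pose p : C := sup X +i* sup Y.
have rp : rect a (a + W) c (c + H) p.
  by have := Xn 0%N; have := Yn 0%N; rewrite /= /sq expr0 invr1 !mulr1.
have [phi /ccontP cphi Fp] := hF rp.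
pose D := W + H + 1; have D0 : 0 < D by rewrite ltr_wpDl// addr_ge0.
(* The linearization of [F] at [p] errs by at most [e * (w + h)] on the small rectangle, so the
   contour integral is at most [4 * e * (w + h) ^+ 2], which this [e] keeps below M/2 times
   [sq n ^+ 2]. The 1 in [D] keeps it positive for a degenerate rectangle. *)
pose e := M / (8 * D ^+ 2).
have e0 : 0 < e by rewrite divr_gt0// mulr_gt0// exprn_gt0.
have [d d0 hd] := cphi e e0.
have [n nd] : exists n, D * sq n < d.
  have [n hn] : exists n : nat, D / d < n%:R.
    by exists (Num.bound (D / d)); apply: archi_boundP; rewrite divr_ge0 ?ltW.
  exists n; rewrite /sq ltr_pdivrMr ?exprn_gt0//.
  rewrite mulrC -ltr_pdivrMr//; apply: lt_le_trans hn _.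
  by rewrite -natrX ler_nat ltnW// ltn_expl.
set x := (s n).1; set y := (s n).2; set w := W * sq n; set h := H * sq n.
have w0 : 0 <= w by exact: W1.
have h0 : 0 <= h by exact: H1.
have [[ax xa] [cy yc] big] := sb n; rewrite -/x -/y -/w -/h in ax xa cy yc big.
have sub w' : rect x (x + w) y (y + h) w' -> rect a (a + W) c (c + H) w'.
  move=> [/andP[u1 u2] /andP[u3 u4]]; clear -ax xa cy yc u1 u2 u3 u4.
  by clearbody x y w h; split; apply/andP; split; lra.
(* The affine part of [F] at [p] has contour integral 0, so only the remainder counts. *)
pose A w' := (F p - phi p * p) + phi p * w'.
have hA w' : ccont A w'.
  apply: ccontD; first exact: ccont_cst.
  by apply: ccontM; [exact: ccont_cst|exact: ccont_id].
have xw : x <= x + w by lra.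
have yh : y <= y + h by lra.
have wh : w + h = (W + H) * sq n by rewrite /w /h; ring.
have near_p w' : rect x (x + w) y (y + h) w' -> cmod (w' - p) <= w + h.
  move=> [/andP[u1 u2] /andP[u3 u4]]; apply: le_trans (cmod_le_ReIm _) _.
  rewrite cReD cImD cReN cImN -[complex.Re p]/(sup X) -[complex.Im p]/(sup Y).
  have /andP[v1 v2] : x <= sup X <= x + w := Xn n.
  have /andP[v3 v4] : y <= sup Y <= y + h := Yn n.
  clear -u1 u2 u3 u4 v1 v2 v3 v4; clearbody x y w h.
  by apply: lerD; rewrite ler_norml; apply/andP; split; lra.
have small w' : rect x (x + w) y (y + h) w' -> cmod (F w' - A w') <= e * (w + h).
  move=> hw; have -> : F w' - A w' = (phi w' - phi p) * (w' - p) by rewrite /A (Fp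
    w'); ring.
  have wp := near_p _ hw; rewrite cmodM; apply: ler_pM; rewrite ?cmod_ge0//.
  apply: ltW; apply: hd; apply: le_lt_trans wp _; apply: le_lt_trans nd.
  by rewrite wh ler_wpM2r// /D; lra.
have : cmod (bdry (fun z => F z - A z) x (x + w) y (y + h)) <= 4 * (e * (w + h)) *
  (w + h).
  have := @cmod_bdry_le (fun z => F z - A z) x (x + w) y (y + h) (e * (w + h)) xw yh.
  rewrite ![_ + _ - _]addrAC !subrr !add0r; apply=> //.
  by move=> w' hw; apply: ccontB => //; apply: holo_cont; apply: hF; exact: sub.
rewrite bdryB//; last by move=> w' hw; apply: holo_cont; apply: hF; exact: sub.
rewrite /A bdry_affine// subr0 leNgt => /negP; apply; apply: lt_le_trans big.
have sq0 : 0 < sq n by rewrite invr_gt0 exprn_gt0.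
have -> : 4 * (e * (w + h)) * (w + h) = 4 * e * (W + H) ^+ 2 * sq n ^+ 2 by rewrite
  wh; ring.
rewrite ltr_pM2r ?exprn_gt0//.
apply: le_lt_trans (_ : 4 * e * D ^+ 2 < _).
  apply: ler_wpM2l; first by rewrite mulr_ge0// ltW.
  rewrite ler_pXn2r ?nnegrE ?addr_ge0//; first by rewrite /D lerDl.
have -> : 4 * e * D ^+ 2 = M / 2 by rewrite /e; field; rewrite gt_eqF.
by have := M0; lra.
Qed.

End Bisection.

Lemma goursat F a b c d : a <= b -> c <= d ->
  (forall w, rect a b c d w -> holo F w) -> bdry F a b c d = 0.
Proof.
move=> ab cd hF; apply/eqP; apply: contraT; rewrite -cmod_gt0 => h0; exfalso.
apply: (@bisection_contra F a c (b - a) (d - c) _ _ _ h0); rewrite ?subr_ge0//.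
  by rewrite ![_ + (_ - _)]addrC !subrK.
by rewrite ![_ + (_ - _)]addrC !subrK.
Qed.

End Goursat.

(** * Circular means and the Cauchy formula *)

Section CircleMeans.
Variable R : realType.
Notation C := R[i].
Implicit Types (r s t : R) (z w : C) (h g : C -> C) (u v : C -> R).

Definition circ r t : C := (r * cos t) +i* (r * sin t).

Definition cmean r h : C :=
  ((2 * pi)^-1)%:C * cint 0 (2 * pi) (fun t => h (circ r t)).

Definition rmean r u : R :=
  (2 * pi)^-1 * rint 0 (2 * pi) (fun t => u (circ r t)).

Let twopi_gt0 : 0 < 2 * pi :> R.
Proof. by rewrite mulr_gt0 ?pi_gt0. Qed.

Let twopi_ge0 : 0 <= 2 * pi :> R.
Proof. exact: ltW. Qed.

Lemma cmod_circ r t : 0 <= r -> cmod (circ r t) = r.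
Proof.
move=> r0; apply/eqP; rewrite -(@eqrXn2 _ 2) ?cmod_ge0// sqr_cmod /=.
by rewrite !exprMn -mulrDr cos2Dsin2 mulr1.
Qed.

Lemma cexp_circ r t : 0 < r -> cexp (ln r +i* t) = circ r t.
Proof. by move=> r0; rewrite /cexp /= lnK. Qed.

Lemma pcont_circ r t : pcont (circ r) t.
Proof.
apply: pcont_complex; apply: continuousM; try exact: cvg_cst.
  exact: continuous_cos.
exact: continuous_sin.
Qed.

Lemma pcont_on_circ r h : 0 <= r -> (forall z, cmod z = r -> ccont h z) ->
  forall a b, pcont_on a b (fun t => h (circ r t)).
Proof.
move=> r0 hh a b t _; apply: pcont_comp (pcont_circ _ _).
by apply: hh; rewrite cmod_circ.
Qed.

Lemma cont_on_circ r u : 0 <= r -> (forall z, cmod z = r -> rcont u z) ->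
  forall a b, cont_on a b (fun t => u (circ r t)).
Proof.
move=> r0 hh a b t _; apply: cont_comp (pcont_circ _ _).
by apply: hh; rewrite cmod_circ.
Qed.

Lemma Re_cmean r h :
  complex.Re (cmean r h) = rmean r (fun z => complex.Re (h z)).
Proof. by rewrite /cmean cReM mul0r subr0. Qed.

Lemma eq_cmean r h g : 0 <= r -> (forall z, cmod z = r -> h z = g z) ->
  cmean r h = cmean r g.
Proof.
by move=> r0 hg; congr (_ * _); apply: eq_cint => t _; rewrite hg ?cmod_circ.
Qed.

Lemma eq_rmean r u v : 0 <= r -> (forall z, cmod z = r -> u z = v z) ->
  rmean r u = rmean r v.
Proof.
by move=> r0 hg; congr (_ * _); apply: eq_rint => t _; rewrite hg ?cmod_circ.
Qed.

Lemma cmeanD r h g : 0 <= r -> (forall z, cmod z = r -> ccont h z) ->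
  (forall z, cmod z = r -> ccont g z) ->
  cmean r (fun z => h z + g z) = cmean r h + cmean r g.
Proof.
by move=> r0 hh hg; rewrite /cmean cintD ?mulrDr//; exact: pcont_on_circ.
Qed.

Lemma cmeanB r h g : 0 <= r -> (forall z, cmod z = r -> ccont h z) ->
  (forall z, cmod z = r -> ccont g z) ->
  cmean r (fun z => h z - g z) = cmean r h - cmean r g.
Proof.
by move=> r0 hh hg; rewrite /cmean cintB ?mulrBr//; exact: pcont_on_circ.
Qed.

Lemma cmeanZ r k h : 0 <= r -> (forall z, cmod z = r -> ccont h z) ->
  cmean r (fun z => k * h z) = k * cmean r h.
Proof.
by move=> r0 hh; rewrite /cmean cintM ?mulrA ?[k * _]mulrC//; exact: pcont_on_circ.
Qed.

Lemma cmean_cst r k : cmean r (fun=> k) = k.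
Proof.
rewrite /cmean cint_cst// subr0 mulrCA -rmorphM /= mulVf ?mulr1//.
by rewrite gt_eqF.
Qed.

Lemma cmod_cmean_le r h M : 0 <= r -> (forall z, cmod z = r -> ccont h z) ->
  (forall z, cmod z = r -> cmod (h z) <= M) -> cmod (cmean r h) <= 2 * M.
Proof.
move=> r0 hh hM; rewrite cmodM cmod_real gtr0_norm ?invr_gt0//.
rewrite mulrC ler_pdivrMr//; have := @cmod_cint_le R 0 (2 * pi) _ M twopi_ge0.
rewrite subr0; apply; first exact: pcont_on_circ.
by move=> t _; apply: hM; rewrite cmod_circ.
Qed.

Lemma cmeanJ r h : 0 <= r -> (forall z, cmod z = r -> ccont h z) ->
  cmean r (fun z => (h z)^*) = (cmean r h)^*.
Proof.
move=> r0 hh; rewrite /cmean.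
have -> : cint 0 (2 * pi) (fun t => (h (circ r t))^*)
    = (cint 0 (2 * pi) (fun t => h (circ r t)))^*.
  rewrite /cint /=; congr (_ +i* _).
    by apply: eq_rint => t _; case: (h _).
  rewrite -mulN1r -rintZ; last first.
    by move=> t tI; have [] := pcont_ReIm (pcont_on_circ r0 hh tI).
  by apply: eq_rint => t _; case: (h _) => a b; rewrite mulN1r.
by case: (cint _ _ _) => a b; cring.
Qed.

Lemma rmeanD r u v : 0 <= r -> (forall z, cmod z = r -> rcont u z) ->
  (forall z, cmod z = r -> rcont v z) ->
  rmean r (fun z => u z + v z) = rmean r u + rmean r v.
Proof.
move=> r0 hh hg; rewrite /rmean rintD.
- by rewrite mulrDr.
- exact: cont_on_circ.
- exact: cont_on_circ.
Qed.

Lemma rmeanZ r k u : 0 <= r -> (forall z, cmod z = r -> rcont u z) ->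
  rmean r (fun z => k * u z) = k * rmean r u.
Proof.
move=> r0 hh; rewrite /rmean rintZ.
- by rewrite mulrCA.
- exact: cont_on_circ.
Qed.

Lemma rmeanB r u v : 0 <= r -> (forall z, cmod z = r -> rcont u z) ->
  (forall z, cmod z = r -> rcont v z) ->
  rmean r (fun z => u z - v z) = rmean r u - rmean r v.
Proof.
move=> r0 hh hg; rewrite -[in RHS]mulN1r -(rmeanZ (-1) r0 hg) -rmeanD.
- by apply: eq_rmean => // z _; rewrite mulN1r.
- exact: r0.
- exact: hh.
- by move=> z zr; apply: rcontM; [exact: rcont_cst | exact: hg].
Qed.

Lemma rmean_cst r k : rmean r (fun=> k) = k.
Proof. by rewrite /rmean rint_cst// subr0 mulrCA mulVf ?mulr1// gt_eqF. Qed.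

Lemma rmean_le r u v : 0 <= r -> (forall z, cmod z = r -> rcont u z) ->
  (forall z, cmod z = r -> rcont v z) -> (forall z, cmod z = r -> u z <= v z) ->
  rmean r u <= rmean r v.
Proof.
move=> r0 hu hv uv; rewrite /rmean ler_pM2l ?invr_gt0//.
by apply: rint_le; [exact: cont_on_circ | exact: cont_on_circ |
  move=> t _; apply: uv; rewrite cmod_circ].
Qed.

Lemma circle_bounded r h : 0 <= r -> (forall z, cmod z = r -> ccont h z) ->
  exists2 M, 0 < M & forall t, 0 <= t <= 2 * pi -> cmod (h (circ r t)) <= M.
Proof.
move=> r0 hh.
have [c _ hc] := @EVT_max R (fun t => cmod (h (circ r t))) 0 (2 * pi) twopi_ge0
  (continuous_subspaceT (fun t => cont_comp (rcont_cmod _)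
   (pcont_on_circ r0 hh (a := t) (b := t) (x := t) (introT andP (conj (lexx t)
     (lexx t)))))).
exists (cmod (h (circ r c)) + 1); first by rewrite ltr_wpDl ?cmod_ge0.
by move=> t tI; rewrite ler_wpDr//; apply: hc; rewrite in_itv.
Qed.

Lemma circ_surj z : exists2 t, 0 <= t <= 2 * pi & circ (cmod z) t = z.
Proof.
have [->|z0] := eqVneq z 0.
  exists 0; first by rewrite lexx.
  by rewrite /circ cmod0 !mul0r.
have rz : 0 < cmod z by rewrite cmod_gt0.
pose c := complex.Re z / cmod z; pose s := complex.Im z / cmod z.
have cs : c ^+ 2 + s ^+ 2 = 1.
  by rewrite !exprMn -mulrDl -sqr_cmod -exprMn divff ?expr1n// gt_eqF.
have c1 : -1 <= c <= 1.
  by rewrite -ler_norml normrM (gtr0_norm (x := _^-1)) ?invr_gt0// ler_pdivrMr//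
    mul1r cmod_ge_Re.
have sE : `|s| = sin (acos c).
  rewrite sin_acos//; have -> : 1 - c ^+ 2 = s ^+ 2 by rewrite -cs; ring.
  by rewrite sqrtr_sqr.
have [a0 api] : 0 <= acos c /\ acos c <= pi by have [/andP[]] := acos_def c1.
have zE t : cos t = c -> sin t = s -> circ (cmod z) t = z.
  move=> ct st; rewrite [RHS]ReIm /circ ct st /c /s ![cmod z * _]mulrC !divfK//.
    by rewrite gt_eqF.
  by rewrite gt_eqF.
case: (leP 0 s) => s0.
  exists (acos c); first by apply/andP; split => //; have := pi_ge0 R; lra.
  by apply: zE; rewrite ?acosK ?itv_boundlr// -sE ger0_norm.
have p2 : 2 * pi = pi *+ 2 :> R by rewrite mulr_natl.
exists (2 * pi - acos c); first by apply/andP; split; have := pi_ge0 R; lra.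
rewrite addrC p2; apply: zE; first by rewrite cosD2pi cosN acosK// itv_boundlr.
by rewrite sinD2pi sinN -sE ltr0_norm// opprK.
Qed.

Lemma circle_boundedz r h : 0 <= r -> (forall z, cmod z = r -> ccont h z) ->
  exists2 M, 0 < M & forall z, cmod z = r -> cmod (h z) <= M.
Proof.
move=> r0 /(circle_bounded r0)[M M0 hM]; exists M => // z zr.
by have [t tI <-] := circ_surj z; rewrite zr; exact: hM.
Qed.

End CircleMeans.

Section MeanValue.
Variable R : realType.
Notation C := R[i].
Implicit Types (r s t : R) (z w : C) (h g : C -> C).

(** The exponential maps a rectangle onto the annulus. By periodicity the integrals over the two
    horizontal sides cancel in Goursat's lemma, and those over the vertical sides are the two
    circular means. *)
Lemma cmean_annulus r1 r2 h : 0 < r1 <= r2 ->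
  (forall z, r1 <= cmod z <= r2 -> holo h z) -> cmean r1 h = cmean r2 h.
Proof.
move=> /andP[r10 r12] hh; have r20 := lt_le_trans r10 r12.
have p2 : 2 * pi = 0 + pi *+ 2 :> R by rewrite mulr_natl add0r.
have : bdry (fun w => h (cexp w)) (ln r1) (ln r2) 0 (2 * pi) = 0.
  apply: goursat; first by rewrite ler_ln.
    by rewrite mulr_ge0 ?pi_ge0.
  move=> w [/andP[w1 w2] _]; apply: holo_comp (holo_cexp _).
  apply: hh; rewrite cmod_cexp -[r1]lnK// -[X in _ <= _ <= X]lnK//.
  by rewrite !ler_expR w1.
rewrite /bdry.
rewrite (@eq_cint _ _ _ (fun x => h (cexp (x +i* (2 * pi)))) (fun x => h (cexp (x
  +i* 0)))); last first.
  by move=> x _; rewrite /cexp /= p2 cosD2pi sinD2pi.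
have cancel (A B D : C) : A + B - A - D = B - D by ring.
rewrite cancel -mulrBr => /eqP.
have i0 : ('i : C) != 0 by rewrite eq_complex /= oner_eq0 andbF.
rewrite mulf_eq0 (negPf i0) orFb subr_eq0 => /eqP E; rewrite /cmean; congr (_ * _).
rewrite (@eq_cint _ _ _ _ (fun y => h (cexp (ln r1 +i* y)))); last first.
  by move=> t _; rewrite cexp_circ.
rewrite -E; apply: eq_cint => t _; rewrite cexp_circ//.
Qed.

Lemma cmean_close r s e h : 0 <= r -> 0 <= s ->
  (forall z, cmod z = r -> ccont h z) -> (forall z, cmod z = s -> ccont h z) ->
  (forall t, 0 <= t <= 2 * pi -> cmod (h (circ r t) - h (circ s t)) <= e) ->
  cmod (cmean r h - cmean s h) <= 2 * e.
Proof.
move=> r0 s0 hr hs he; have t0 : 0 < 2 * pi :> R by rewrite mulr_gt0 ?pi_gt0.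
rewrite /cmean -mulrBr -cintB; [|exact: pcont_on_circ|exact: pcont_on_circ].
rewrite cmodM cmod_real gtr0_norm ?invr_gt0// mulrC ler_pdivrMr//.
have := @cmod_cint_le R 0 (2 * pi) (fun t => h (circ r t) - h (circ s t)) e (ltW t0).
rewrite subr0; apply => // t tI.
under eq_fun do rewrite -mulN1r.
apply: pcontD; first exact: (pcont_on_circ r0 hr) tI.
by apply: pcontM; [exact: pcont_cst|exact: (pcont_on_circ s0 hs) tI].
Qed.

(** The radial oscillation is small near each angle, and compactness of the interval of angles makes
    this uniform. *)
Lemma circle_unif_cont r h : 0 <= r -> (forall z, cmod z = r -> ccont h z) ->
  forall e, 0 < e -> exists2 d, 0 < d & forall s t, `|s - r| < d ->
    0 <= t <= 2 * pi -> cmod (h (circ s t) - h (circ r t)) < e.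
Proof.
move=> r0 hh e e0.
have := (compact_near_coveringP _).1 (@segment_compact R 0 (2 * pi)).
move=> /(_ R (nbhs r) (fun s t => cmod (h (circ s t) - h (circ r t)) < e) _) H.
suff /H /nbhs_ballP[d /= d0 hd] : forall t, `[0, 2 * pi]%classic t ->
    \forall t' \near t & s \near nbhs r, cmod (h (circ s t') - h (circ r t')) < e.
  exists d => // s t sd tI.
  by apply: (hd s) => /=; rewrite ?in_itv//= -ball_normE /= distrC.
  move=> t _; have /ccontP := hh _ (cmod_circ t r0).
  have e2 : 0 < e / 2 by rewrite divr_gt0.
  move=> /(_ _ e2)[d d0 hd]; have d2 : 0 < d / 2 by rewrite divr_gt0.
  have [hc] := pcont_circ r t; have := (cvg_cmod (nbhs_filter t) _ _).1 hc _ d2.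
  move=> ht; near=> t' s.
  have t't : cmod (circ r t' - circ r t) < d / 2 by near: t'.
  have ss : cmod (circ s t' - circ r t') < d / 2.
    have -> : circ s t' - circ r t' = circ (s - r) t'.
      by rewrite /circ; cring.
    have -> : cmod (circ (s - r) t') = `|s - r|.
      have [sr|/ltW sr] := leP 0 (s - r); first by rewrite cmod_circ ?ger0_norm.
      have -> : circ (s - r) t' = - circ (- (s - r)) t' by rewrite /circ; cring.
      by rewrite cmodN cmod_circ ?oppr_ge0 ?ler0_norm.
    by rewrite distrC; near: s; apply/nbhs_ballP; exists (d / 2) => //= s'; rewrite
      -ball_normE.
  have h1 : cmod (h (circ s t') - h (circ r t)) < e / 2.
    apply: hd; have -> : circ s t' - circ r t = (circ s t' - circ r t') + (circ r
      t' - circ r t) by ring.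
    by apply: le_lt_trans (cmodD _ _) _; rewrite (splitr d) ltrD.
  have h2 : cmod (h (circ r t') - h (circ r t)) < e / 2.
    by apply: hd; apply: lt_trans t't _; rewrite ltr_pdivrMr// mulr_natr mulr2n ltrDl.
have -> : h (circ s t') - h (circ r t') = (h (circ s t') - h (circ r t)) - (h (circ
  r t') - h (circ r t)) by ring.
  by apply: le_lt_trans (cmodD _ _) _; rewrite cmodN (splitr e) ltrD.
Unshelve. all: by end_near. Qed.

End MeanValue.

Section Cauchy.
Variable R : realType.
Notation C := R[i].
Implicit Types (r s t : R) (z w : C) (h g k : C -> C).


Lemma cmean_at0 h : ccont h 0 -> forall e, 0 < e -> exists2 d, 0 < d &
  forall r, 0 <= r < d -> (forall z, cmod z = r -> ccont h z) ->
    cmod (cmean r h - h 0) < e.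
Proof.
move=> /ccontP h0 e e0; have e3 : 0 < e / 3 by rewrite divr_gt0.
have [d d0 hd] := h0 _ e3; exists d => // r /andP[r0 rd] hr.
apply: le_lt_trans (_ : 2 * (e / 3) < e); last lra.
rewrite -{1}[h 0](cmean_cst r) -cmeanB//; last by move=> *; exact: ccont_cst.
apply: cmod_cmean_le => //.
  by move=> z zr; apply: ccontB; [exact: hr | exact: ccont_cst].
by move=> z zr; apply: ltW; apply: hd; rewrite subr0 zr.
Qed.

Lemma eq0_small z : (forall e, 0 < e -> cmod z < e) -> z = 0.
Proof.
move=> H; apply/eqP; apply: contraT; rewrite -cmod_gt0 => /H; rewrite ltxx//.
Qed.

(** The mean is the same on all circles by [cmean_annulus], and on small ones it is close to [h 0]
    by continuity. *)
Lemma mean_value0 R0 h : 0 < R0 -> ccont h 0 ->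
  (forall z, 0 < cmod z <= R0 -> holo h z) -> cmean R0 h = h 0.
Proof.
move=> R0p h0 hh; apply/eqP; rewrite -subr_eq0; apply/eqP; apply: eq0_small => e e0.
have [d d0 hd] := cmean_at0 h0 e0.
pose r := Num.min (d / 2) R0.
have r0 : 0 < r by rewrite lt_min R0p divr_gt0.
have rR : r <= R0 by rewrite ge_min lexx orbT.
have rd : r < d by rewrite gt_min ltr_pdivrMr// mulr_natr mulr2n ltrDl d0.
rewrite -(@cmean_annulus _ r) ?r0//; last first.
  by move=> z /andP[rz zR]; apply: hh; rewrite zR (lt_le_trans r0).
apply: hd; first by rewrite ltW.
by move=> z zr; apply: holo_cont; apply: hh; rewrite zr r0.
Qed.

Lemma cmean_continuous r h : 0 < r -> (forall z, cmod z = r -> ccont h z) ->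
  forall e, 0 < e -> exists2 d, 0 < d & forall s, `|s - r| < d ->
    0 <= s -> (forall z, cmod z = s -> ccont h z) ->
    cmod (cmean s h - cmean r h) < e.
Proof.
move=> r0 hr e e0; have e3 : 0 < e / 3 by rewrite divr_gt0.
have [d d0 hd] := circle_unif_cont (ltW r0) hr e3.
exists d => // s sd s0 hs; apply: le_lt_trans (_ : 2 * (e / 3) < e); last lra.
by apply: cmean_close => // [|t tI]; [exact: ltW | apply: ltW; exact: hd].
Qed.

(* An exceptional point only affects the circle through it, and the circular
   means depend continuously on the radius. *)
Lemma mean_value R0 h z0 : 0 < R0 ->
  (forall z, cmod z <= R0 -> ccont h z) ->
  (forall z, cmod z <= R0 -> z != z0 -> holo h z) -> cmean R0 h = h 0.
Proof.
move=> R0p hc hh.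
have h0 : ccont h 0 by apply: hc; rewrite cmod0 ltW.
have below r : 0 < r -> r <= R0 -> (r < cmod z0 \/ z0 = 0 \/ R0 < cmod z0) -> cmean
  r h = h 0.
  move=> r0 rR H; apply: mean_value0 => // z /andP[z_gt0 zr]; apply: hh.
    exact: le_trans rR.
  apply/eqP => E; rewrite E in z_gt0 zr.
  case: H => [rz|[z00|Rz]].
  - by move: (le_lt_trans zr rz); rewrite ltxx.
  - by move: z_gt0; rewrite z00 cmod0 ltxx.
  - by move: (lt_le_trans Rz (le_trans zr rR)); rewrite ltxx.
have [z0E|z00] := eqVneq z0 0.
  by apply: below => //; right; left.
have rho0 : 0 < cmod z0 by rewrite cmod_gt0.
have [Rz|zR] := ltP R0 (cmod z0); first by apply: below => //; right; right.
have mid : cmean (cmod z0) h = h 0.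
  apply/eqP; rewrite -subr_eq0; apply/eqP; apply: eq0_small => e e0.
  have hcz z : cmod z = cmod z0 -> ccont h z by move=> E; apply: hc; rewrite E.
  have [d d0 hd] := cmean_continuous rho0 hcz e0.
  pose r := Num.max (cmod z0 - d / 2) (cmod z0 / 2).
  have r0 : 0 < r by rewrite lt_max; apply/orP; right; lra.
  have rz : r < cmod z0 by rewrite gt_max; apply/andP; split; lra.
  have rd : `|r - cmod z0| < d.
    rewrite ltr0_norm ?subr_lt0// opprB; suff : cmod z0 - d / 2 <= r by lra.
    by rewrite le_max lexx.
  have rR : r <= R0 by apply: le_trans (ltW rz) zR.
  rewrite cmodBC -(below r)//; last by left.
  by apply: hd => // [|z zr]; [exact: ltW | apply: hc; rewrite zr].
move: zR; rewrite le_eqVlt => /predU1P[<-//|zR].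
rewrite -mid; apply/eqP; rewrite -subr_eq0; apply/eqP; apply: eq0_small => e e0.
have hcz z : cmod z = cmod z0 -> ccont h z by move=> E; apply: hc; rewrite E ltW.
have [d d0 hd] := cmean_continuous rho0 hcz e0.
pose r := Num.min (cmod z0 + d / 2) R0.
have rz : cmod z0 < r by rewrite lt_min zR andbT; lra.
have rR : r <= R0 by rewrite ge_min lexx orbT.
have rd : `|r - cmod z0| < d.
  rewrite gtr0_norm ?subr_gt0//; suff : r <= cmod z0 + d / 2 by lra.
  by rewrite ge_min lexx.
have r0 := lt_trans rho0 rz.
rewrite -(@cmean_annulus _ r R0) ?r0//; last first.
  move=> z /andP[rz' zR']; apply: hh => //; apply: contraTneq rz' => ->.
  by rewrite -ltNge.
apply: hd => // [|z zr]; first exact: ltW.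
by apply: hc; rewrite zr.
Qed.

Lemma mean_value_holo R0 h : 0 < R0 ->
  (forall z, cmod z <= R0 -> holo h z) -> cmean R0 h = h 0.
Proof.
by move=> R0p hh; apply: mean_value0 => // [|z /andP[_ /hh]//]; apply: holo_cont;
  apply: hh; rewrite cmod0 ltW.
Qed.

(** Cauchy's integral of k(x) / (x - z) dx over 2 pi i: on the circle dx = i x dt, which supplies
    the factor [x]. *)
Definition cauchy_int r k z := cmean r (fun x => x * k x / (x - z)).

Lemma subr_neq0_cmod z w : cmod z < cmod w -> w - z != 0.
Proof. by move=> zw; rewrite subr_eq0; apply: contraTneq zw => ->; rewrite ltxx. Qed.

Lemma ccont_kernel h k x : ccont h x -> ccont k x -> k x != 0 ->
  ccont (fun w => h w / k w) x.
Proof. by move=> hh hk k0; apply: ccontM => //; exact: ccontV. Qed.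

Lemma holo_sub a z : holo (fun w => w - a) z.
Proof. by apply: holoB; [exact: holo_id | exact: holo_cst]. Qed.

Lemma ccont_sub a z : ccont (fun w => w - a) z.
Proof. exact: holo_cont (holo_sub _ _). Qed.

(** The kernels at [w] and [z] differ by [w - z] times x / ((x - z)(x - w)), so the difference
    quotient is the mean of [K w], and its continuity in [w] remains. *)
Lemma cauchy_int_holo r k z : (forall x, cmod x = r -> ccont k x) ->
  cmod z < r -> holo (cauchy_int r k) z.
Proof.
move=> hk zr; have r0 : 0 <= r by apply: le_trans (ltW zr); exact: cmod_ge0.
pose d := (r - cmod z) / 2; have d0 : 0 < d by rewrite divr_gt0// subr_gt0.
have zd w : cmod (w - z) < d -> cmod w < r - d.
  move=> wd; have := cmodD (w - z) z; rewrite subrK.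
  by rewrite /d in wd *; lra.
have xd w x : cmod (w - z) < d -> cmod x = r -> d <= cmod (x - w).
  by move=> /zd wd xr; have := cmodB_ge x w; rewrite xr; lra.
have x0 w x : cmod (w - z) < d -> cmod x = r -> x - w != 0.
  by move=> /xd h /h; rewrite -cmod_gt0; exact: lt_le_trans.
have zz : cmod (z - z) < d by rewrite subrr cmod0.
pose K w x := x * k x / ((x - z) * (x - w)).
have cK w x : cmod (w - z) < d -> cmod x = r -> ccont (K w) x.
  move=> wd xr; apply: (@ccont_kernel (fun x => x * k x) (fun x => (x - z) * (x -
    w))); last by rewrite mulf_neq0// x0.
    by apply: ccontM; [exact: ccont_id|exact: hk].
  by apply: ccontM; exact: ccont_sub.
have cL w x : cmod (w - z) < d -> cmod x = r -> ccont (fun x => x * k x / (x - w)) x.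
  move=> wd xr; apply: (@ccont_kernel (fun x => x * k x) (fun x => x - w));
    [|exact: ccont_sub|exact: x0].
  by apply: ccontM; [exact: ccont_id|exact: hk].
apply: (@holo_nearI _ _ _ (fun w => cmean r (K w)) d d0); last first.
  move=> w wd; rewrite /cauchy_int.
  transitivity (cmean r (fun x => x * k x / (x - z) + (w - z) * K w x)).
    apply: eq_cmean => // x xr; rewrite /K; field.
    by rewrite !x0.
  rewrite cmeanD; first 1 last.
  - exact: r0.
  - by move=> x; exact: cL.
  - by move=> x xr; apply: ccontM; [exact: ccont_cst|exact: cK].
  rewrite cmeanZ; [by rewrite mulrC|exact: r0|by move=> x; exact: cK].
have [M M0 hM] := circle_boundedz r0 hk.
apply/ccontP => e e0.
(* Points within [d] of [z] keep distance [d] from the circle, and three denominators occur. The 2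
   below is the loss in [cmod_cmean_le]. *)
pose B := r * M / d ^+ 3; have B0 : 0 <= B.
  by apply: divr_ge0; [apply: mulr_ge0 => //; exact: ltW | apply: exprn_ge0; exact: ltW].
have B1 : 0 < 2 * B + 1 by rewrite ltr_wpDl// mulr_ge0.
exists (Num.min d (e / (2 * B + 1))); first by rewrite lt_min d0 divr_gt0.
move=> w; rewrite lt_min => /andP[wd we].
rewrite -cmeanB//; [|by move=> x; exact: cK|by move=> x; exact: cK].
apply: le_lt_trans (_ : 2 * (cmod (w - z) * B) < e); last first.
  move: we; rewrite ltr_pdivlMr// mulrDr mulr1 => we; have := cmod_ge0 (w - z); lra.
apply: cmod_cmean_le => //.
  by move=> x xr; apply: ccontB; exact: cK.
move=> x xr.
have -> : K w x - K z x = (w - z) * (x * k x / ((x - z) ^+ 2 * (x - w))).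
  by rewrite /K; field; rewrite !x0.
rewrite cmodM ler_wpM2l ?cmod_ge0// !cmodM cmodV xr cmodM cmodX.
have dz := xd z x zz xr; have dw := xd w x wd xr.
have xw0 : 0 < cmod (x - w) by exact: lt_le_trans dw.
have xz0 : 0 < cmod (x - z) by exact: lt_le_trans dz.
rewrite /B; apply: ler_pM.
- by rewrite mulr_ge0// cmod_ge0.
- by rewrite invr_ge0 mulr_ge0 ?exprn_ge0// ltW.
- by rewrite ler_wpM2l// hM.
have d3 : d ^+ 3 = d ^+ 2 * d by ring.
suff H : d ^+ 3 <= cmod (x - z) ^+ 2 * cmod (x - w).
  by rewrite lef_pV2// posrE ?exprn_gt0// mulr_gt0// exprn_gt0.
rewrite d3.
by apply: ler_pM => //; [rewrite exprn_ge0// ltW|exact: ltW|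
  rewrite ler_pXn2r// nnegrE ltW].
Qed.

End Cauchy.

Section CauchyFormula.
Variable R : realType.
Notation C := R[i].
Implicit Types (r s t : R) (z w : C) (h g k : C -> C).

Lemma conjM_circle r x : cmod x = r -> x * x^* = (r ^+ 2)%:C.
Proof. by move=> <-; rewrite sqr_cmodC. Qed.

Lemma reflect_neq0 r z x : cmod z < r -> cmod x <= r ->
  (r ^+ 2)%:C - z^* * x != 0.
Proof.
move=> zr xr; have r0 : 0 < r by apply: le_lt_trans zr; exact: cmod_ge0.
rewrite subr_eq0; apply: contraTneq zr => E; rewrite -leNgt.
have : cmod ((r ^+ 2)%:C) = cmod (z^* * x) by rewrite E.
rewrite cmod_real cmodM cmodJ ger0_norm ?sqr_ge0// => E2.
by rewrite -(ler_pM2r r0) -expr2 E2 ler_wpM2l ?cmod_ge0.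
Qed.

(** The pole at [z] blocks the mean value property, but the conjugate of the integrand agrees on the
    circle with r^2 / (r^2 - z^* x), because x^* = r^2 / x there; this is holomorphic in the closed
    disc and equals 1 at 0. *)
Lemma cmean_kernel r z : cmod z < r -> cmean r (fun x => x / (x - z)) = 1.
Proof.
move=> zr; have r0 : 0 < r by apply: le_lt_trans zr; exact: cmod_ge0.
have xz x : cmod x = r -> x - z != 0.
  by move=> xr; apply: subr_neq0_cmod; rewrite xr.
have r2 : (r ^+ 2)%:C != 0 :> C.
  by rewrite -cmod_gt0 cmod_real normr_gt0 expf_neq0// gt_eqF.
pose g x : C := (r ^+ 2)%:C / ((r ^+ 2)%:C - z^* * x).
have gE x : cmod x = r -> (x / (x - z))^* = g x.
  move=> xr; have xx := conjM_circle xr; have x0 : x != 0.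
    by rewrite -cmod_gt0 xr.
  have jr : (r ^+ 2)%:C - z^* * x != 0 by apply: reflect_neq0 => //; rewrite xr.
  rewrite rmorphM /= conjc_inv rmorphB /= /g -xx.
  have x0' : x^* - z^* != 0 by rewrite -rmorphB /= conjc_eq0 xz.
  rewrite -xx in jr; field.
  by rewrite jr x0'.
have ch x : cmod x = r -> ccont (fun x => x / (x - z)) x.
  by move=> xr; apply: (@ccont_kernel _ id (fun x => x - z)); [exact:
    ccont_id|exact: ccont_sub|exact: xz].
apply: (can_inj (@conjcK R)); rewrite conjc1 -cmeanJ ?ltW//.
rewrite (eq_cmean (ltW r0) gE) mean_value_holo//.
  by rewrite /g mulr0 subr0 divff.
move=> x xr; apply: holoM; first exact: holo_cst.
apply: holoV; first exact: reflect_neq0.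
apply: holoB; first exact: holo_cst.
by apply: holoM; [exact: holo_cst | exact: holo_id].
Qed.

(** The divided difference [q] at [z] is continuous in the disc and holomorphic off [z], so the mean
    of [x * q x] is its value 0 at the origin; [cmean_kernel] evaluates the part with [h z]. *)
Lemma cauchy_formula r h z : cmod z < r ->
  (forall x, cmod x <= r -> holo h x) -> cauchy_int r h z = h z.
Proof.
move=> zr hh; have r0 : 0 < r by apply: le_lt_trans zr; exact: cmod_ge0.
have [phi cphi hphi] := hh z (ltW zr).
have xz x : cmod x = r -> x - z != 0.
  by move=> xr; apply: subr_neq0_cmod; rewrite xr.
pose q x := if x == z then phi z else (h x - h z) / (x - z).
have qz x : x != z -> holo (fun x => (h x - h z) / (x - z)) x -> holo q x.
  move=> nxz; apply: (@holo_near _ _ _ _ (cmod (x - z))).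
    by rewrite cmod_gt0 subr_eq0.
  move=> w wx; rewrite /q; case: eqP wx => // ->; by rewrite cmodBC ltxx.
have hq x : cmod x <= r -> x != z -> holo q x.
  move=> xr nxz; apply: qz => //; apply: holoM.
    by apply: holoB; [exact: hh | exact: holo_cst].
  by apply: holoV; [rewrite subr_eq0 | exact: holo_sub].
have cq : ccont q z.
  apply: (@ccont_near _ phi _ _ 1) => // w _; rewrite /q; case: eqP => [->//|/eqP wz].
  by rewrite (hphi w) addrAC subrr add0r mulfK// subr_eq0.
have M0 : cmean r (fun x => x * q x) = 0.
  rewrite (mean_value (z0 := z) r0) ?mul0r// => x xr.
    apply: ccontM; first exact: ccont_id.
    by have [->//|xz'] := eqVneq x z; apply: holo_cont; apply: hq.
  by move=> xz'; apply: holoM; [exact: holo_id|exact: hq].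
have ch x : cmod x = r -> ccont h x by move=> xr; apply: holo_cont; apply: hh; rewrite xr.
have ck x : cmod x = r -> ccont (fun x => x / (x - z)) x.
  by move=> xr; apply: (@ccont_kernel _ id (fun x => x - z)); [exact:
    ccont_id|exact: ccont_sub|exact: xz].
apply/eqP; rewrite -subr_eq0 -M0 -[h z]mulr1 -(cmean_kernel zr) -cmeanZ ?ltW//.
rewrite /cauchy_int -cmeanB ?ltW//.
- apply/eqP; apply: eq_cmean; first exact: ltW.
  move=> x xr; rewrite /q ifF; last by apply/negbTE; rewrite -subr_eq0 xz.
  by field; exact: xz.
- move=> x xr; apply: (@ccont_kernel _ (fun x => x * h x) (fun x => x - z));
  [|exact: ccont_sub|exact: xz].
  by apply: ccontM; [exact: ccont_id | exact: ch].
- by move=> x xr; apply: ccontM; [exact: ccont_cst | exact: ck].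
Qed.

Lemma ccont_uniq f g z : ccont f z -> ccont g z ->
  (forall w, w != z -> f w = g w) -> f z = g z.
Proof.
move=> /ccontP hf /ccontP hg fg; apply/eqP; rewrite -subr_eq0; apply/eqP.
apply: eq0_small => e e0; have e2 : 0 < e / 2 by rewrite divr_gt0.
have [d d0 hd] := hf _ e2; have [k k0 hk] := hg _ e2.
pose m := Num.min d k / 2.
have m0 : 0 < m by rewrite divr_gt0// lt_min d0.
have mlt : m < Num.min d k by rewrite ltr_pdivrMr// mulr_natr mulr2n ltrDl lt_min d0.
pose w : C := z + m%:C.
have wz : w - z = m%:C by rewrite /w addrC addKr.
have wzd : cmod (w - z) < Num.min d k by rewrite wz cmod_real gtr0_norm.
have wn : w != z by rewrite -subr_eq0 -cmod_gt0 wz cmod_real normr_gt0 gt_eqF.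
move: wzd; rewrite lt_min => /andP[/hd h1 /hk h2].
have -> : f z - g z = (g w - g z) - (f w - f z) by rewrite (fg w wn); ring.
by apply: le_lt_trans (cmodD _ _) _; rewrite cmodN (splitr e) ltrD.
Qed.

(** A removable singularity: inside a circle around 0 that encloses [a], and off [a], the quotient
    equals the Cauchy integral of its boundary values, and that integral is holomorphic at [a] as
    well. *)
Lemma entire_divided_difference h a : (forall z, holo h z) ->
  exists2 g, (forall z, holo g z) & forall z, h z = h a + (z - a) * g z.
Proof.
move=> hh; have [phi cphi hphi] := hh a.
pose q x := if x == a then phi a else (h x - h a) / (x - a).
have qE x : x != a -> q x = (h x - h a) / (x - a) by rewrite /q => /negbTE ->.
exists q; last first.
  move=> z; rewrite /q; case: eqP => [->|/eqP za]; first by rewrite subrr mul0r addr0.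
  by rewrite mulrC divfK ?subr_eq0// addrC subrK.
have hq x : x != a -> holo q x.
  move=> xa; apply: (@holo_near _ (fun x => (h x - h a) / (x - a)) _ _ (cmod (x - a))).
  - by rewrite cmod_gt0 subr_eq0.
  - move=> w wx; rewrite qE//; apply: contraTneq wx => ->; by rewrite cmodBC ltxx.
  - apply: holoM; first by apply: holoB; [exact: hh | exact: holo_cst].
    by apply: holoV; [rewrite subr_eq0 | exact: holo_sub].
have cq : ccont q a.
  apply: (@ccont_near _ phi _ _ 1) => // w _; rewrite /q; case: eqP => [->//|/eqP wz].
  by rewrite (hphi w) addrAC subrr add0r mulfK// subr_eq0.
move=> z; have [->{z}|/hq//] := eqVneq z a.
pose r := cmod a + 1; have r0 : 0 < r by rewrite ltr_wpDl ?cmod_ge0.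
have ar : cmod a < r by rewrite ltrDl.
have xa x : cmod x = r -> x - a != 0.
  by move=> xr; apply: subr_neq0_cmod; rewrite xr.
have ch x : ccont h x by exact: holo_cont.
pose k x := (h x - h a) / (x - a).
have ck x : cmod x = r -> ccont k x.
  move=> xr; apply: ccont_kernel; [|exact: ccont_sub|exact: xa].
  by apply: ccontB; [exact: ch | exact: ccont_cst].
pose G := cauchy_int r k.
have hG : holo G a by exact: cauchy_int_holo.
(* partial fractions in the Cauchy kernel *)
have GE w : cmod w < r -> w != a -> G w = q w.
  move=> wr wa; have xw x : cmod x = r -> x - w != 0.
    by move=> xr; apply: subr_neq0_cmod; rewrite xr.
  have wa0 : w - a != 0 by rewrite subr_eq0.
  pose l x := h x - h a.
  have hl x : holo l x by apply: holoB; [exact: hh|exact: holo_cst].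
  have cl v x : x - v != 0 -> ccont (fun x => x * l x / (x - v)) x.
    move=> h0; apply: (@ccont_kernel _ (fun x => x * l x) (fun x => x - v)) => //.
      by apply: ccontM; [exact: ccont_id|exact: holo_cont].
    exact: ccont_sub.
  have lw : cauchy_int r l w = l w by apply: cauchy_formula => //.
  have la : cauchy_int r l a = 0.
    by rewrite cauchy_formula// /l subrr.
  rewrite qE// -/(l w) -[l w]subr0 -[in RHS]la -lw mulrC /cauchy_int.
  rewrite -cmeanB ?ltW//; [|by move=> x /xw; exact: cl|by move=> x /xa; exact: cl].
  rewrite -cmeanZ ?ltW//; last first.
    by move=> x xr; apply: ccontB; apply: cl; [exact: xw|exact: xa].
  rewrite /G /cauchy_int; apply: eq_cmean; first exact: ltW.
  move=> x xr; rewrite /k -/(l x); field.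
  by rewrite xa// xw.
pose G' x := if cmod x < r then G x else q x.
have nearG x : cmod (x - a) < 1 -> G x = G' x.
  move=> xa1; rewrite /G' ifT//.
  by have := cmodD (x - a) a; rewrite subrK /r; lra.
apply: (@holo_near _ G _ _ 1) => // w wa1; rewrite nearG//.
have hG' : ccont G' a by apply: (ccont_near _ nearG) => //; exact: holo_cont.
have G'q w' : w' != a -> G' w' = q w'.
  by move=> wa; rewrite /G'; case: ifP => // wr; exact: GE.
have [->|/G'q//] := eqVneq w a; exact: ccont_uniq.
Qed.

(* Cauchy's formula for [h ^+ n] loses a factor that does not depend on [n]. *)
Lemma maximum_principle r h M z : cmod z < r ->
  (forall x, cmod x <= r -> holo h x) -> 0 <= M ->
  (forall x, cmod x = r -> cmod (h x) <= M) -> cmod (h z) <= M.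
Proof.
move=> zr hh M0 hM; have r0 : 0 < r by apply: le_lt_trans zr; exact: cmod_ge0.
have d0 : 0 < r - cmod z by rewrite subr_gt0.
pose K := 2 * (r / (r - cmod z)).
have xz x : cmod x = r -> x - z != 0.
  by move=> xr; apply: subr_neq0_cmod; rewrite xr.
have pow n : cmod (h z) ^+ n <= K * M ^+ n.
  rewrite -cmodX -(@cauchy_formula r (fun x => h x ^+ n) z zr); last first.
    by move=> x xr; apply: holoX; exact: hh.
  rewrite /K -mulrA; apply: cmod_cmean_le => [|x xr|x xr]; first exact: ltW.
    apply: (@ccont_kernel _ (fun x => x * h x ^+ n) (fun x => x - z)); [|exact:
      ccont_sub|exact: xz].
    apply: ccontM; first exact: ccont_id.
    by apply: ccontX; apply: holo_cont; apply: hh; rewrite xr.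
  rewrite !cmodM cmodV xr cmodX mulrAC; apply: ler_pM.
  - by rewrite divr_ge0 ?cmod_ge0// ltW.
  - by rewrite exprn_ge0 ?cmod_ge0.
  - apply: ler_wpM2l; first exact: ltW.
    rewrite lef_pV2 ?posrE ?cmod_gt0 ?xz//.
    by have := cmodB_ge x z; rewrite xr.
  - by apply: lerXn2r; rewrite ?nnegrE ?cmod_ge0// hM.
rewrite leNgt; apply/negP => Mh.
have h0 : 0 < cmod (h z) by apply: le_lt_trans Mh.
move: M0; rewrite le_eqVlt => /predU1P[E|M0].
  have := pow 1%N; rewrite -E !expr1 mulr0 => hz.
  by move: (le_lt_trans hz h0); rewrite ltxx.
have [q q0 qE] : exists2 q, 0 < q & cmod (h z) / M = 1 + q.
  exists (cmod (h z) / M - 1); first by rewrite subr_gt0 ltr_pdivlMr ?mul1r.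
  by rewrite addrC subrK.
have bern n : 1 + q *+ n <= (1 + q) ^+ n.
  elim: n => [|n IH]; first by rewrite mulr0n addr0 expr0.
  rewrite exprS mulrS; apply: le_trans (_ : (1 + q) * (1 + q *+ n) <= _); last first.
    by rewrite ler_wpM2l// addr_ge0// ltW.
  have : 0 <= q * (q *+ n) by rewrite mulr_ge0 ?mulrn_wge0// ltW.
  by rewrite mulrDl mul1r mulrDr mulr1; lra.
have [n Kn] : exists n : nat, K / q < n%:R.
  exists (Num.bound (K / q)); apply: archi_boundP.
  apply: divr_ge0; last exact: ltW.
  by apply: mulr_ge0 => //; apply: divr_ge0; exact: ltW.
have := pow n; rewrite -ler_pdivrMr ?exprn_gt0// -expr_div_n.
rewrite qE.
move=> /(le_trans (bern n)); apply/negP; rewrite -ltNge.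
move: Kn; rewrite ltr_pdivrMr// => Kn; apply: lt_trans Kn _.
by rewrite mulr_natl ltrDr.
Qed.

End CauchyFormula.

(** * Poisson majorants *)

Section Poisson.
Variable R : realType.
Notation C := R[i].
Implicit Types (r s t : R) (z w x : C) (h g k : C -> C) (u v : C -> R).

Definition pker z x : R := complex.Re ((x + z) / (x - z)).

Definition poisson r u z : R := rmean r (fun x => pker z x * u x).

(** The identity 2 x / (x - z) - 1 = (x + z) / (x - z) makes this the holomorphic function whose
    real part is the Poisson integral. *)
Definition schwarz r u z : C :=
  2 * cauchy_int r (fun x => (u x)%:C) z - cmean r (fun x => (u x)%:C).

Lemma ccont_real u x : rcont u x -> ccont (fun y => (u y)%:C) x.
Proof. by move=> hu; apply: ccont_complex => //; exact: rcont_cst. Qed.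

Lemma schwarz_holo r u z : (forall x, cmod x = r -> rcont u x) ->
  cmod z < r -> holo (schwarz r u) z.
Proof.
move=> hu zr; apply: holoB; last exact: holo_cst.
apply: holoM; first exact: holo_cst.
by apply: cauchy_int_holo => // x /hu; exact: ccont_real.
Qed.

Lemma rcont_pker r z x : cmod z < r -> cmod x = r -> rcont (pker z) x.
Proof.
move=> zr xr; have xz : x - z != 0 by apply: subr_neq0_cmod; rewrite xr.
have cD : ccont (fun x => x + z) x by apply: ccontD; [exact: ccont_id | exact: ccont_cst].
by have [] := ccont_ReIm (ccont_kernel cD (ccont_sub z x) xz).
Qed.

Lemma Re_schwarz r u z : (forall x, cmod x = r -> rcont u x) ->
  cmod z < r -> complex.Re (schwarz r u z) = poisson r u z.
Proof.
move=> hu zr; have r0 : 0 < r by apply: le_lt_trans zr; exact: cmod_ge0.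
have xz x : cmod x = r -> x - z != 0.
  by move=> xr; apply: subr_neq0_cmod; rewrite xr.
have cu x : cmod x = r -> ccont (fun x => (u x)%:C) x.
  by move=> /hu; exact: ccont_real.
have ck x : cmod x = r -> ccont (fun x => x * (u x)%:C / (x - z)) x.
  move=> xr; apply: (@ccont_kernel _ (fun x => x * (u x)%:C) (fun x => x - z));
    [|exact: ccont_sub|exact: xz].
  by apply: ccontM; [exact: ccont_id|exact: cu].
rewrite /schwarz /cauchy_int -cmeanZ ?ltW// -cmeanB ?ltW//; last first.
  by move=> x xr; apply: ccontM; [exact: ccont_cst|exact: ck].
rewrite Re_cmean; apply: eq_rmean; first exact: ltW.
move=> x xr; rewrite /pker.
have -> : 2 * (x * (u x)%:C / (x - z)) - (u x)%:C = (u x)%:C * ((x + z) / (x - z)).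
  by field; exact: xz.
by rewrite cReMr mulrC.
Qed.

Lemma pkerE r z x : cmod x = r -> cmod z < r ->
  pker z x = (r ^+ 2 - cmod z ^+ 2) / cmod (x - z) ^+ 2.
Proof.
move=> xr zr; have xz : x - z != 0 by apply: subr_neq0_cmod; rewrite xr.
have cz : cmod (x - z) ^+ 2 != 0 by rewrite expf_neq0// cmod_eq0.
apply: (mulIf cz); rewrite divfK// /pker -xr.
have -> : (x + z) / (x - z) = (x + z) * (x - z)^* * ((cmod (x - z) ^+ 2)^-1)%:C.
  have xz' : x^* - z^* != 0 by rewrite -rmorphB /= conjc_eq0.
  by rewrite fmorphV /= sqr_cmodC; field; rewrite xz andbT; exact: xz'.
rewrite mulrC [X in complex.Re X]mulrC cReMr mulVKf//.
by rewrite !sqr_cmod; case: x z {xr zr xz cz} => a b [c d] /=; ring.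
Qed.

Lemma pker_ge0 r z x : cmod x = r -> cmod z < r -> 0 <= pker z x.
Proof.
move=> xr zr; rewrite (pkerE xr zr) divr_ge0 ?exprn_ge0 ?cmod_ge0// subr_ge0.
by rewrite lerXn2r ?nnegrE ?cmod_ge0 ?(ltW zr)// (le_trans (cmod_ge0 z) (ltW zr)).
Qed.

Lemma pker_le r z x : cmod x = r -> cmod z < r ->
  pker z x <= (r + cmod z) / (r - cmod z).
Proof.
move=> xr zr; rewrite (pkerE xr zr); have d0 : 0 < r - cmod z by rewrite subr_gt0.
have xz : r - cmod z <= cmod (x - z) by have := cmodB_ge x z; rewrite xr.
have xz0 := lt_le_trans d0 xz.
have -> : r ^+ 2 - cmod z ^+ 2 = (r + cmod z) * (r - cmod z) by ring.
rewrite ler_pdivrMr ?exprn_gt0// -mulrA ler_wpM2l//.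
  by rewrite addr_ge0 ?cmod_ge0// -xr cmod_ge0.
by rewrite ler_pdivlMl// -expr2; apply: lerXn2r; rewrite ?nnegrE; [exact:
  ltW|exact: ltW|exact: xz].
Qed.

Lemma poisson_cst r c z : cmod z < r -> poisson r (fun=> c) z = c.
Proof.
move=> zr; have r0 : 0 < r by apply: le_lt_trans zr; exact: cmod_ge0.
have cc x : cmod x = r -> rcont (fun=> c) x by move=> _; exact: rcont_cst.
rewrite -Re_schwarz// /schwarz cmean_cst.
have -> : cauchy_int r (fun=> c%:C) z = c%:C.
  by rewrite (@cauchy_formula R r (fun=> c%:C))// => x _; exact: holo_cst.
by rewrite cReD cReN cReM /=; ring.
Qed.

Lemma rcont_pkerM r u z x : (forall x, cmod x = r -> rcont u x) ->
  cmod z < r -> cmod x = r -> rcont (fun x => pker z x * u x) x.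
Proof.
by move=> hu zr xr; apply: rcontM; [exact: rcont_pker zr xr | exact: hu].
Qed.

Lemma poisson_le r u v z : cmod z < r -> (forall x, cmod x = r -> rcont u x) ->
  (forall x, cmod x = r -> rcont v x) -> (forall x, cmod x = r -> u x <= v x) ->
  poisson r u z <= poisson r v z.
Proof.
move=> zr hu hv uv; have r0 : 0 < r by apply: le_lt_trans zr; exact: cmod_ge0.
apply: rmean_le; first exact: ltW.
- by move=> x; exact: rcont_pkerM.
- by move=> x; exact: rcont_pkerM.
- by move=> x xr; rewrite ler_wpM2l ?uv// (pker_ge0 xr zr).
Qed.

Lemma poissonB r u v z : cmod z < r -> (forall x, cmod x = r -> rcont u x) ->
  (forall x, cmod x = r -> rcont v x) ->
  poisson r (fun x => u x - v x) z = poisson r u z - poisson r v z.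
Proof.
move=> zr hu hv; have r0 : 0 < r by apply: le_lt_trans zr; exact: cmod_ge0.
rewrite /poisson -rmeanB; first 1 last.
- exact: ltW.
- by move=> x; exact: rcont_pkerM.
- by move=> x; exact: rcont_pkerM.
by apply: eq_rmean => [|x _]; [exact: ltW | rewrite mulrBr].
Qed.

Lemma poisson_at0 r u : 0 < r -> poisson r u 0 = rmean r u.
Proof.
move=> r0; apply: eq_rmean => [|x xr]; first exact: ltW.
by rewrite /pker addr0 subr0 divff ?mul1r// -cmod_gt0 xr.
Qed.

(** A Poisson integral is the real part of the holomorphic [schwarz r u], so its mean on an inner
    circle is its value at 0, which is the mean of the boundary data. *)
Lemma rmean_poisson r s u : 0 < s < r -> (forall x, cmod x = r -> rcont u x) ->
  rmean s (poisson r u) = rmean r u.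
Proof.
move=> /andP[s0 sr] hu; have r0 := lt_trans s0 sr.
transitivity (complex.Re (cmean s (schwarz r u))).
  rewrite Re_cmean; apply: eq_rmean => [|x xs]; first exact: ltW.
  by rewrite Re_schwarz// xs.
rewrite mean_value_holo//; last by move=> x xs; apply: schwarz_holo => //; exact:
  le_lt_trans sr.
by rewrite Re_schwarz ?cmod0// poisson_at0.
Qed.

Lemma rcont_poisson r u z : (forall x, cmod x = r -> rcont u x) ->
  cmod z < r -> rcont (poisson r u) z.
Proof.
move=> hu zr; have [h1 _] := ccont_ReIm (holo_cont (schwarz_holo hu zr)).
move/rcontP in h1; apply/rcontP => e /h1[d d0 hd].
exists (Num.min d (r - cmod z)); first by rewrite lt_min d0 subr_gt0.
move=> w; rewrite lt_min => /andP[wd wr].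
have wr' : cmod w < r by have := cmodD (w - z) z; rewrite subrK; lra.
by rewrite -!Re_schwarz//; exact: hd.
Qed.

Lemma circle_heine r u : 0 <= r -> (forall x, cmod x = r -> rcont u x) ->
  forall e, 0 < e -> exists2 d, 0 < d & forall x y, cmod x = r -> cmod y = r ->
    cmod (x - y) < d -> `|u x - u y| < e.
Proof.
move=> r0 hu e e0.
have := (compact_near_coveringP _).1 (@segment_compact R 0 (2 * pi)).
move=> /(_ R (0^'+) (fun d t => forall x, cmod x = r -> cmod (x - circ r t) < d ->
   `|u x - u (circ r t)| < e) _) H.
have K t : `[0, 2 * pi]%classic t -> \forall t' \near t & d \near 0^'+,
    (forall x, cmod x = r -> cmod (x - circ r t') < d -> `|u x - u (circ r t')| < e).
  move=> _; have /rcontP := hu _ (cmod_circ t r0).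
  have e2 : 0 < e / 2 by rewrite divr_gt0.
  move=> /(_ _ e2)[d d0 hd]; have d2 : 0 < d / 2 by rewrite divr_gt0.
  have [hc] := pcont_circ r t; have := (cvg_cmod (nbhs_filter t) _ _).1 hc _ d2.
  move=> ht; near=> t' s => x xr xt.
  have t't : cmod (circ r t' - circ r t) < d / 2 by near: t'.
  have sd : s < d / 2 by near: s; exact: nbhs_right_lt.
  have h1 : `|u x - u (circ r t)| < e / 2.
    apply: hd; have -> : x - circ r t = (x - circ r t') + (circ r t' - circ r t) by ring.
    by apply: le_lt_trans (cmodD _ _) _; rewrite (splitr d) ltrD// (lt_trans xt).
  have h2 : `|u (circ r t') - u (circ r t)| < e / 2.
    by apply: hd; apply: lt_trans t't _; rewrite ltr_pdivrMr// mulr_natr mulr2n ltrDl.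
  have -> : u x - u (circ r t') = (u x - u (circ r t)) - (u (circ r t') - u (circ r
    t)) by ring.
  by apply: le_lt_trans (ler_normB _ _) _; rewrite (splitr e) ltrD.
have := H K; rewrite /at_right /= => /nbhs_ballP[d /= d0 hd].
exists (d / 2); first by rewrite divr_gt0.
move=> x y xr yr xy; have [t tI yE] := circ_surj y; rewrite yr in yE; rewrite -yE.
apply: (hd (d / 2)) => //=; rewrite ?in_itv//= ?yE// ?divr_gt0//.
by rewrite -ball_normE /= sub0r normrN gtr0_norm ?divr_gt0// ltr_pdivrMr//
  mulr_natr mulr2n ltrDl.
Unshelve. all: by end_near. Qed.

End Poisson.

(** * Boundary behaviour of Poisson integrals and the majorant principle *)

Section PoissonMajorant.
Variable R : realType.
Notation C := R[i].
Implicit Types (r s t : R) (z w x : C) (h g k : C -> C) (u v : C -> R).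

Lemma circle_rbounded r u : 0 <= r -> (forall x, cmod x = r -> rcont u x) ->
  exists2 B, 0 < B & forall x, cmod x = r -> `|u x| <= B.
Proof.
move=> r0 hu; have cu x : cmod x = r -> ccont (fun x => (u x)%:C) x.
  by move=> /hu; exact: ccont_real.
have [B B0 hB] := circle_boundedz r0 cu; exists B => // x /hB.
by rewrite cmod_real.
Qed.

Lemma sqr_cmodD_le z w : cmod (z + w) ^+ 2 <= 2 * cmod z ^+ 2 + 2 * cmod w ^+ 2.
Proof.
have h := cmodD z w; apply: le_trans (_ : (cmod z + cmod w) ^+ 2 <= _).
  by rewrite lerXn2r ?nnegrE ?addr_ge0 ?cmod_ge0.
rewrite sqrrD; have := sqr_ge0 (cmod z - cmod w); rewrite sqrrB; lra.
Qed.

(* [pker w y * cmod (y - w) ^+ 2] is constant on the circle, so a modulus of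
   continuity of the form [e + K * cmod (x - y) ^+ 2] integrates exactly. *)
Lemma poisson_boundary r u : 0 < r -> (forall x, cmod x = r -> rcont u x) ->
  forall e, 0 < e -> exists2 d, 0 < d & forall s x, cmod x = r -> 0 <= s < r ->
    r - s < d -> u x - e <= poisson r u ((s / r)%:C * x).
Proof.
move=> r0 hu e e0; have e2 : 0 < e / 2 by rewrite divr_gt0.
have [B B0 hB] := circle_rbounded (ltW r0) hu.
have [de de0 hde] := circle_heine (ltW r0) hu e2.
have [K K0 KE] : exists2 K, 0 < K & forall q, de <= q -> 2 * B <= K * q ^+ 2.
  exists (2 * B / de ^+ 2); first by rewrite divr_gt0 ?mulr_gt0 ?exprn_gt0.
  move=> q dq; rewrite -mulrA ler_peMr ?mulr_ge0//; first exact: ltW.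
  rewrite mulrC ler_pdivlMr ?exprn_gt0// mul1r lerXn2r ?nnegrE//; first exact: ltW.
  exact: le_trans (ltW de0) dq.
have uK x y : cmod x = r -> cmod y = r -> u x - u y <= e / 2 + K * cmod (x - y) ^+ 2.
  move=> xr yr; have q0 : 0 <= K * cmod (x - y) ^+ 2.
    by rewrite mulr_ge0 ?exprn_ge0 ?cmod_ge0 ?ltW.
  have [xy|/KE xy] := ltP (cmod (x - y)) de.
    by have := hde _ _ xr yr xy; rewrite ltr_norml => /andP[_]; lra.
  by have := hB _ xr; have := hB _ yr; rewrite !ler_norml => /andP[? ?] /andP[? ?]; lra.
have Kr : 0 < 12 * K * r + 1 by rewrite ltr_wpDl// !mulr_ge0// ltW.
(* The deviation is at most e/2 + 2 K (r - s)^2 + 2 K (r^2 - s^2) <= e/2 + 6 K r (r - s), and this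
   bound on r - s makes the last term at most e/2. *)
exists (e / (12 * K * r + 1)); first by rewrite divr_gt0.
move=> s x xr /andP[s0 sr] sd; set w := _ * x.
have wr : cmod w = s.
  by rewrite /w cmodM cmod_real ger0_norm ?divr_ge0 ?(ltW r0)// xr divfK// gt_eqF.
have wlt : cmod w < r by rewrite wr.
have wx : cmod (w - x) = r - s.
  have -> : w - x = ((s / r) - 1)%:C * x by rewrite /w rmorphB /=; ring.
  rewrite cmodM cmod_real xr ler0_norm ?subr_le0 ?ler_pdivrMr ?mul1r ?(ltW sr)//.
  by rewrite opprB mulrBl mul1r divfK// gt_eqF.
pose c := e / 2 + 2 * K * (r - s) ^+ 2.
pose v y := c + 2 * K * cmod (y - w) ^+ 2.
have cq y : rcont (fun y => cmod (y - w) ^+ 2) y.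
  apply: (@rcont_compR R (fun q : R => q ^+ 2) (fun y => cmod (y - w))).
    exact: exprn_continuous.
  by apply: rcont_comp; [exact: rcont_cmod | exact: ccont_sub].
have cv y : rcont v y.
  apply: rcontD; first exact: rcont_cst.
  by apply: rcontM; [exact: rcont_cst | exact: cq].
have uv y : cmod y = r -> u x - u y <= v y.
  move=> yr; apply: le_trans (uK _ _ xr yr) _; rewrite /v /c.
  have : cmod (x - y) ^+ 2 <= 2 * (r - s) ^+ 2 + 2 * cmod (y - w) ^+ 2.
    have -> : x - y = - (w - x) + - (y - w) by ring.
    by apply: le_trans (sqr_cmodD_le _ _) _; rewrite !cmodN wx.
  by rewrite -(ler_pM2l K0); lra.
have cx y : cmod y = r -> rcont (fun=> u x) y by move=> _; exact: rcont_cst.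
have cxu y : cmod y = r -> rcont (fun y => u x - u y) y.
  by move=> yr; apply: rcontD; [exact: rcont_cst | apply: rcontN; exact: hu].
have H := @poisson_le R r (fun y => u x - u y) v w wlt cxu (fun y _ => cv y) uv.
rewrite poissonB// poisson_cst// in H.
have vE : poisson r v w = c + 2 * K * (r ^+ 2 - s ^+ 2).
  rewrite /poisson.
  transitivity (rmean r (fun y => pker w y * c + 2 * K * (r ^+ 2 - s ^+ 2))).
    apply: eq_rmean => [|y yr]; first exact: ltW.
    have yw : cmod (y - w) != 0 by rewrite cmod_eq0 subr_neq0_cmod// yr.
    by rewrite /v mulrDr (pkerE yr wlt) wr; field.
  rewrite rmeanD; first 1 last.
  - exact: ltW.
  - by move=> y yr; apply: (@rcont_pkerM R r (fun=> c)) => // x2 _; exact: rcont_cst.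
  - by move=> y yr; exact: rcont_cst.
  by rewrite rmean_cst -/(poisson r (fun=> c) w) poisson_cst.
rewrite vE /c in H.
move: sd; rewrite ltr_pdivlMr// => sd.
have h1 : (r - s) ^+ 2 <= r * (r - s) by rewrite expr2 ler_wpM2r ?subr_ge0 ?(ltW
  sr)// gerBl.
have h2 : r ^+ 2 - s ^+ 2 <= 2 * r * (r - s).
  have -> : r ^+ 2 - s ^+ 2 = (r + s) * (r - s) by ring.
  by rewrite ler_wpM2r ?subr_ge0 ?(ltW sr)//; lra.
rewrite -(ler_pM2l K0) in h1; rewrite -(ler_pM2l K0) in h2.
have rs : 0 < r - s by rewrite subr_gt0.
lra.
Qed.

(** Divided by the exponential of [schwarz r u], the function [f] is bounded by 1 up to an error,
    through the maximum principle. The holomorphy of [schwarz] is available only inside the circle,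
    so the bound is taken on a slightly smaller one, where [poisson_boundary] compares the Poisson
    integral with [u]. *)
Lemma poisson_majorant r u f z : cmod z < r ->
  (forall x, cmod x = r -> rcont u x) -> (forall x, cmod x <= r -> holo f x) ->
  (forall x, cmod x = r -> cmod (f x) <= expR (u x)) ->
  cmod (f z) <= expR (poisson r u z).
Proof.
move=> zr hu hf fu; have r0 : 0 < r by apply: le_lt_trans zr; exact: cmod_ge0.
have [B B0 hB] := circle_rbounded (ltW r0) hu.
have key e : 0 < e -> cmod (f z) <= expR (poisson r u z + 2 * e).
  move=> e0; have [d1 d10 hd1] := poisson_boundary r0 hu e0.
  have cf x : cmod x = r -> ccont f x.
    by move=> xr; apply: holo_cont; apply: hf; rewrite xr.
  (* The factor [expR (- B)] makes the additive error in [f] at most [e * expR (u x)], also where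
     [f] vanishes. *)
  have e'0 : 0 < e * expR (- B) by rewrite mulr_gt0 ?expR_gt0.
  have [d2 d20 hd2] := circle_unif_cont (ltW r0) cf e'0.
  pose m := Num.min (Num.min d1 d2) (r - cmod z).
  have m0 : 0 < m by rewrite !lt_min d10 d20 subr_gt0.
  pose s := r - m / 2.
  have rs : r - s = m / 2 by rewrite /s; ring.
  have [md1 [md2 mz]] : m <= d1 /\ m <= d2 /\ m <= r - cmod z.
    by rewrite !ge_min !lexx !orbT.
  have zs : cmod z < s by lra.
  have sr : s < r by lra.
  have s0 : 0 < s by apply: le_lt_trans zs; exact: cmod_ge0.
  pose h w := f w * cexp (- schwarz r u w).
  have hh w : cmod w <= s -> holo h w.
    move=> ws; have wr := le_lt_trans ws sr.
    apply: holoM; first by apply: hf; exact: ltW.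
    apply: (@holo_comp R (@cexp R) (fun w => - schwarz r u w)); first exact: holo_cexp.
    by apply: holoN; exact: schwarz_holo.
  have hE w : cmod w < r -> cmod (h w) = cmod (f w) * expR (- poisson r u w).
    by move=> wr; rewrite cmodM cmod_cexp cReN Re_schwarz.
  have hb w : cmod w = s -> cmod (h w) <= expR (2 * e).
    move=> ws; have wr : cmod w < r by rewrite ws.
    have [t tI wE] := circ_surj w; rewrite ws in wE.
    pose x := circ r t; have xr : cmod x = r by rewrite cmod_circ// ltW.
    have wxE : w = (s / r)%:C * x.
      rewrite -wE /x /circ; apply/eqP; rewrite eq_complex /=; apply/andP.
      by split; apply/eqP; field; rewrite gt_eqF.
    have sI : 0 <= s < r by rewrite sr ltW.
    have rd1 : r - s < d1 by lra.
    have h1 := hd1 s x xr sI rd1; rewrite -wxE in h1.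
    have sr2 : `|s - r| < d2 by rewrite distrC gtr0_norm ?subr_gt0//; lra.
    have h2 := hd2 s t sr2 tI; rewrite wE -/x in h2.
    have fx := fu x xr; have := hB x xr; rewrite ler_norml => /andP[uB _].
    have eB : expR (- B) <= expR (u x) by rewrite ler_expR.
    have fw : cmod (f w) <= (1 + e) * expR (u x).
      have := cmodD (f w - f x) (f x); rewrite subrK => h3.
      rewrite mulrDl mul1r; apply: le_trans h3 _; rewrite addrC; apply: lerD => //.
      by apply: le_trans (ltW h2) _; rewrite ler_wpM2l// ltW.
    rewrite hE//; apply: le_trans (_ : (1 + e) * expR (u x) * expR (- u x + e) <= _).
      apply: ler_pM; rewrite ?cmod_ge0 ?expR_ge0//.
      by rewrite ler_expR; lra.
    rewrite -mulrA -expRD addrA subrr add0r mulr_natl mulr2n expRD.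
    by rewrite ler_wpM2r ?expR_ge0// expR_ge1Dx.
  have := maximum_principle zs hh (expR_ge0 _) hb.
  rewrite hE// expRN -ler_pdivlMr ?invr_gt0 ?expR_gt0// invrK => H.
  by rewrite expRD mulrC.
have [->|fz] := eqVneq (f z) 0; first by rewrite cmod0 expR_ge0.
have fz0 : 0 < cmod (f z) by rewrite cmod_gt0.
rewrite -[cmod (f z)]lnK// ler_expR leNgt; apply/negP => lt.
pose e := (ln (cmod (f z)) - poisson r u z) / 4.
have e0 : 0 < e by rewrite divr_gt0// subr_gt0.
have := key e e0; rewrite -[cmod (f z)]lnK// ler_expR => H.
by rewrite /e in H; lra.
Qed.

End PoissonMajorant.

(** * Zeros and the Jensen formula *)

Section Jensen.
Variable R : realType.
Notation C := R[i].
Implicit Types (r : R) (z w a : C) (f g : C -> C) (s : seq C).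

Definition polyfactor s z : C := \prod_(a <- s) (z - a).

Definition circle_free f r := forall z, cmod z = r -> f z != 0.

Definition log_mean f r : R := rmean r (fun z => ln (cmod (f z))).

Lemma holo_polyfactor s z : holo (polyfactor s) z.
Proof. by apply: holo_prod => a; exact: holo_sub. Qed.

Lemma polyfactor_eq0 s z : (polyfactor s z == 0) = (z \in s).
Proof.
rewrite /polyfactor prodf_seq_eq0; apply/hasP/idP => [[a sa]|zs].
  by rewrite /= subr_eq0 => /eqP ->.
by exists z => //=; rewrite subrr.
Qed.

(* On a large circle each factor [z - a] is at least twice its value at [z1]. *)
Lemma size_factor_bound f z1 (rho : R) : (forall z, holo f z) -> f z1 != 0 ->
  0 < rho -> exists N : nat, forall s g, (forall z, holo g z) ->
    (forall a, a \in s -> cmod a <= rho) ->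
    (forall z, f z = polyfactor s z * g z) -> (size s <= N)%N.
Proof.
move=> hf f1 rho0; pose D := cmod z1 + rho.
have D0 : 0 < D by rewrite ltr_wpDl ?cmod_ge0.
pose r := 2 * D + D; have r0 : 0 < r by rewrite addr_gt0// mulr_gt0.
have [M M0 hM] := @circle_boundedz R r f (ltW r0) (fun z _ => holo_cont (hf z)).
have c1 : 0 < cmod (f z1) by rewrite cmod_gt0.
have [N hN] : exists N : nat, M / cmod (f z1) < N%:R.
  by exists (Num.bound (M / cmod (f z1))); apply: archi_boundP; rewrite divr_ge0 ?ltW.
exists N => s g hg sr fE; rewrite leqNgt; apply/negP => Ns.
have rD a : a \in s -> forall x, cmod x = r -> 2 * D <= cmod (x - a).
  move=> /sr ar x xr; have := cmodB_ge x a; have := cmod_ge0 z1.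
  by rewrite xr /r /D; lra.
have lower x : cmod x = r -> (2 * D) ^+ size s <= cmod (polyfactor s x).
  move=> xr; rewrite /polyfactor; elim: (s) rD => [|b t IH] h.
    by rewrite big_nil cmod1 expr0.
  rewrite big_cons cmodM exprS; apply: ler_pM.
  - by rewrite mulr_ge0// ltW.
  - by rewrite exprn_ge0// mulr_ge0// ltW.
  - by apply: h => //; rewrite mem_head.
  - by apply: IH => c ct; apply: h; rewrite in_cons ct orbT.
have upper : cmod (polyfactor s z1) <= D ^+ size s.
  rewrite /polyfactor; elim: (s) sr => [|b t IH] h.
    by rewrite big_nil cmod1 expr0.
  rewrite big_cons cmodM exprS; apply: ler_pM; rewrite ?cmod_ge0//.
    apply: le_trans (cmodD _ _) _; rewrite cmodN lerD2l.
    by apply: h; rewrite mem_head.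
  by apply: IH => c ct; apply: h; rewrite in_cons ct orbT.
have D2 : 0 < (2 * D) ^+ size s by rewrite exprn_gt0// mulr_gt0.
have gz1 : cmod (g z1) <= M / (2 * D) ^+ size s.
  apply: (@maximum_principle R r).
  - by have := cmod_ge0 z1; rewrite /r /D; lra.
  - by move=> x _; exact: hg.
  - by rewrite divr_ge0 ?ltW.
  - move=> x xr; rewrite ler_pdivlMr// mulrC.
    have := hM x xr; rewrite fE cmodM; apply: le_trans.
    by rewrite ler_wpM2r ?cmod_ge0// lower.
have : cmod (f z1) * 2 ^+ size s <= M.
  rewrite fE cmodM; apply: le_trans (_ : D ^+ size s * (M / (2 * D) ^+ size s) * 2
    ^+ size s <= _).
    rewrite ler_wpM2r ?exprn_ge0//; apply: ler_pM; rewrite ?cmod_ge0//.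
  rewrite le_eqVlt; apply/orP; left; apply/eqP; rewrite exprMn; field.
  by rewrite !expf_neq0// gt_eqF.
rewrite mulrC -ler_pdivlMr//; apply/negP; rewrite -ltNge.
apply: lt_le_trans hN _; rewrite -natrX ler_nat.
by apply: leq_trans (ltnW Ns) _; rewrite ltnW// ltn_expl.
Qed.

(** Zeros in the disc are divided off one at a time; [size_factor_bound] forbids doing this more
    than [N] times. *)
Lemma factorization f z1 rho : (forall z, holo f z) -> f z1 != 0 -> 0 < rho ->
  exists s g, [/\ forall z, holo g z, forall a, a \in s -> cmod a <= rho,
    forall z, cmod z <= rho -> g z != 0 &
    forall z, f z = polyfactor s z * g z].
Proof.
move=> hf f1 rho0; apply: contrapT => H.
have [N hN] := size_factor_bound hf f1 rho0.
have P n : exists s g, [/\ size s = n, forall z, holo g z,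
    forall a, a \in s -> cmod a <= rho & forall z, f z = polyfactor s z * g z].
  elim: n => [|n [s [g [sn hg sr fE]]]].
    by exists [::], f; split => // z; rewrite /polyfactor big_nil mul1r.
  have [a [ar ga]] : exists a, cmod a <= rho /\ g a = 0.
    apply: contrapT => H'; apply: H; exists s, g; split => // z zr.
    by apply/negP => /eqP gz; apply: H'; exists z.
  have [q hq gE] := entire_divided_difference a hg.
  exists (a :: s), q; split => //=; first by rewrite sn.
    by move=> b; rewrite in_cons => /predU1P[->|/sr].
  by move=> z; rewrite fE (gE z) ga add0r /polyfactor big_cons; ring.
have [s [g [sn hg sr fE]]] := P N.+1.
by have := hN s g hg sr fE; rewrite sn ltnn.
Qed.

Lemma rcont_ln (h : C -> R) z : 0 < h z -> rcont h z -> rcont (fun w => ln (h w)) z.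
Proof. by move=> h0 hh; apply: (@rcont_compR R (@ln R) h) => //; exact:
  continuous_ln. Qed.

Lemma rcont_logmod f z : f z != 0 -> ccont f z -> rcont (fun w => ln (cmod (f w))) z.
Proof.
move=> f0 hf; apply: rcont_ln; first by rewrite cmod_gt0.
by apply: rcont_comp => //; exact: rcont_cmod.
Qed.

(** The majorant principle at 0, applied to [g] and to its inverse, gives the two inequalities; this
    takes the place of a holomorphic logarithm of [g]. *)
Lemma log_mean_zero_free g r : 0 < r -> (forall z, cmod z <= r -> holo g z) ->
  (forall z, cmod z <= r -> g z != 0) -> log_mean g r = ln (cmod (g 0)).
Proof.
move=> r0 hg g0; have z0 : cmod 0 < r by rewrite cmod0.
have cu x : cmod x = r -> rcont (fun z => ln (cmod (g z))) x.
  by move=> xr; apply: rcont_logmod; [apply: g0|apply: holo_cont; apply: hg]; rewrite xr.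
have g00 : 0 < cmod (g 0) by rewrite cmod_gt0 g0// ltW.
apply: le_anti; apply/andP; split; last first.
  rewrite -ler_expR lnK// /log_mean -(poisson_at0 _ r0).
  apply: poisson_majorant => // x xr; rewrite lnK// posrE cmod_gt0 g0// xr//.
rewrite -lerN2 -ler_expR [expR (- ln _)]expRN lnK//.
rewrite -cmodV -mulN1r -(rmeanZ _ (ltW r0) cu) -(poisson_at0 _ r0).
apply: (@poisson_majorant R r _ (fun z => (g z)^-1)) => // x xr.
- by apply: rcontM; [exact: rcont_cst|exact: cu].
- by apply: holoV; [exact: g0|exact: hg].
- by rewrite mulN1r expRN lnK ?cmodV// posrE cmod_gt0 g0// xr.
Qed.

(* For [cmod a < r] the zero is reflected: [cmod (z - a)] and
   [cmod (r ^+ 2 - a^* * z) / r] agree on the circle. *)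
Lemma log_mean_sub r a : 0 < r -> cmod a != r ->
  log_mean (fun z => z - a) r = ln (Num.max r (cmod a)).
Proof.
move=> r0 ar; case: (ltP r (cmod a)) => [ra|].
  rewrite log_mean_zero_free ?sub0r ?cmodN//.
  - by move=> z _; exact: holo_sub.
  - move=> z zr; rewrite -oppr_eq0 opprB; apply: subr_neq0_cmod.
    exact: le_lt_trans ra.
rewrite le_eqVlt (negPf ar) /= => {}ar.
have r2 : cmod ((r ^+ 2)%:C : C) = r ^+ 2 by rewrite cmod_real ger0_norm ?sqr_ge0.
pose g z : C := ((r ^+ 2)%:C - a^* * z) * (r^-1)%:C.
have hg z : holo g z.
  apply: holoM; last exact: holo_cst.
  apply: holoB; first exact: holo_cst.
  by apply: holoM; [exact: holo_cst|exact: holo_id].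
have g0 z : cmod z <= r -> g z != 0.
  move=> zr; rewrite mulf_neq0 ?reflect_neq0//.
  by rewrite -cmod_gt0 cmod_real normr_gt0 invr_eq0 gt_eqF.
have gE z : cmod z = r -> cmod (z - a) = cmod (g z).
  move=> zr; rewrite /g -(conjM_circle zr) -(mulrC z) -mulrBr.
  rewrite !cmodM zr cmod_real gtr0_norm ?invr_gt0// mulrAC divff ?gt_eqF// mul1r.
  by rewrite -rmorphB /= cmodJ.
transitivity (log_mean g r).
  by apply: eq_rmean => [|z zr]; [exact: ltW | rewrite gE].
rewrite log_mean_zero_free// /g mulr0 subr0 cmodM r2 cmod_real gtr0_norm ?invr_gt0//.
by congr ln; field; rewrite gt_eqF.
Qed.

Lemma jensen s g r rho : 0 < r <= rho -> (forall z, holo g z) ->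
  (forall z, cmod z <= rho -> g z != 0) -> (forall a, a \in s -> cmod a != r) ->
  log_mean (fun z => polyfactor s z * g z) r
  = ln (cmod (g 0)) + \sum_(a <- s) ln (Num.max r (cmod a)).
Proof.
move=> /andP[r0 rr] hg g0; have rc : circle_free g r.
  by move=> z zr; apply: g0; rewrite zr.
elim: s => [_|b s IH sr].
  rewrite big_nil addr0 -(log_mean_zero_free r0); first 1 last.
  - by move=> z _; exact: hg.
  - by move=> z zr; apply: g0; exact: le_trans rr.
  by apply: eq_rmean => [|z zr]; [exact: ltW | rewrite /polyfactor big_nil mul1r].
have br : cmod b != r by apply: sr; rewrite mem_head.
have {}sr a : a \in s -> cmod a != r by move=> h; apply: sr; rewrite in_cons h orbT.
have zb z : cmod z = r -> z - b != 0.
  by move=> zr; rewrite subr_eq0; apply: contraNneq br => <-; rewrite zr.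
have zs z : cmod z = r -> polyfactor s z * g z != 0.
  move=> zr; rewrite mulf_neq0 ?rc// polyfactor_eq0; apply/negP => /sr.
  by rewrite zr eqxx.
rewrite big_cons addrCA -IH// -(log_mean_sub r0 br) /log_mean -rmeanD; first 1 last.
- exact: ltW.
- by move=> z zr; apply: rcont_logmod; [exact: zb | exact: ccont_sub].
- move=> z zr; apply: rcont_logmod; first exact: zs.
  by apply: ccontM; apply: holo_cont; [exact: holo_polyfactor | exact: hg].
apply: eq_rmean => [|z zr]; first exact: ltW.
by rewrite /polyfactor big_cons -mulrA cmodM lnM ?posrE ?cmod_gt0 ?zb ?zs.
Qed.

(** All dependence on [r] sits in the functions [ln (Num.max r (cmod a))], which are nondecreasing,
    and convex in [ln r]; monotonicity and convexity of the mean are read off from them. *)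
Lemma jensen_entire f z1 rho : (forall z, holo f z) -> f z1 != 0 -> 0 < rho ->
  exists s c, [/\ forall a, a \in s -> cmod a <= rho,
    forall a, cmod a <= rho -> (f a == 0) = (a \in s) &
    forall r, 0 < r <= rho -> circle_free f r ->
    log_mean f r = c + \sum_(a <- s) ln (Num.max r (cmod a))].
Proof.
move=> hf f1 rho0; have [s [g [hg sr g0 fE]]] := factorization hf f1 rho0.
exists s, (ln (cmod (g 0))); split => //.
  by move=> a ar; rewrite fE mulf_eq0 polyfactor_eq0 (negPf (g0 a ar)) orbF.
move=> r r0 fr; rewrite -(jensen r0 hg g0).
  by apply: eq_rmean => [|z _]; [case/andP: r0 => /ltW | rewrite fE].
move=> a sa; apply/negP => /eqP ar; have := fr a ar.
by rewrite fE mulf_eq0 polyfactor_eq0 sa.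
Qed.

Lemma log_mean_mono f z1 r1 r2 : (forall z, holo f z) -> f z1 != 0 ->
  0 < r1 <= r2 -> circle_free f r1 -> circle_free f r2 ->
  log_mean f r1 <= log_mean f r2.
Proof.
move=> hf f1 /andP[r10 r12] c1 c2; have r20 := lt_le_trans r10 r12.
have [s [c [sr _ sE]]] := jensen_entire hf f1 r20.
rewrite !sE ?r10 ?r20 ?lexx// lerD2l; apply: ler_sum => a _.
have m1 : 0 < Num.max r1 (cmod a) by rewrite lt_max r10.
have m2 : 0 < Num.max r2 (cmod a) by rewrite lt_max r20.
by rewrite ler_ln ?posrE// ge_max !le_max r12 lexx orbT.
Qed.

(** Slopes with respect to [ln r] are compared, with denominators cleared. Each term is constant up
    to the modulus of its zero and has slope 1 beyond. *)
Lemma log_mean_convex f z1 r1 r2 r3 : (forall z, holo f z) -> f z1 != 0 ->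
  0 < r1 -> r1 <= r2 -> r2 <= r3 ->
  circle_free f r1 -> circle_free f r2 -> circle_free f r3 ->
  (log_mean f r2 - log_mean f r1) * ln (r3 / r2)
  <= (log_mean f r3 - log_mean f r2) * ln (r2 / r1).
Proof.
move=> hf f1 r10 r12 r23 c1 c2 c3; have r20 := lt_le_trans r10 r12.
have r30 := lt_le_trans r20 r23.
have [s [c [sr _ sE]]] := jensen_entire hf f1 r30.
rewrite !sE ?r10 ?r20 ?r30 ?lexx ?r23 ?(le_trans r12)//.
rewrite !opprD ![_ + _ + (- c - _)]addrACA !subrr !add0r -!sumrB.
rewrite !mulr_suml; apply: ler_sum => a _.
have l32 : 0 <= ln (r3 / r2) by rewrite ln_ge0// ler_pdivlMr// mul1r.
have l21 : 0 <= ln (r2 / r1) by rewrite ln_ge0// ler_pdivlMr// mul1r.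
case: (leP r2 (cmod a)) => ra.
  rewrite (max_idPr (le_trans r12 ra)) subrr mul0r mulr_ge0// subr_ge0.
  by rewrite ler_ln ?posrE ?lt_max ?r30 ?(lt_le_trans r20 ra)// le_max lexx orbT.
rewrite (max_idPl (le_trans (ltW ra) r23)).
rewrite ln_div// in l32; rewrite ln_div// [X in _ <= X]mulrC ler_wpM2r//.
rewrite ln_div// lerD2l lerN2.
by rewrite ler_ln ?posrE ?lt_max ?r10// le_max lexx.
Qed.

Lemma avoid_seq (l : seq R) (x y : R) : x < y -> exists2 r, x < r < y & r \notin l.
Proof.
elim: l x y => [|b l IH] x y xy; first by exists ((x + y) / 2) => //; rewrite !midf_lt.
have [x1 y1] : x < (x + y) / 2 /\ (x + y) / 2 < y by rewrite !midf_lt.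
have [bl|lb] := leP b ((x + y) / 2).
  have [r /andP[r1 r2] rl] := IH _ _ y1; exists r; first by rewrite r2 (lt_trans x1).
  by rewrite in_cons negb_or rl andbT gt_eqF// (le_lt_trans bl).
have [r /andP[r1 r2] rl] := IH _ _ x1; exists r; first by rewrite r1 (lt_trans r2).
by rewrite in_cons negb_or rl andbT lt_eqF// (lt_trans r2).
Qed.

Lemma finite_bad_radii f z1 rho : (forall z, holo f z) -> f z1 != 0 ->
  exists l : seq R, forall r, r <= rho -> r \notin l -> circle_free f r.
Proof.
move=> hf f1; have r0 : 0 < `|rho| + 1 by rewrite ltr_wpDl.
have [s [c [sr sz _]]] := jensen_entire hf f1 r0.
exists (map (@cmod R) s) => r rr rs z zr; rewrite sz.
  by apply: contra rs => zs; rewrite -zr; exact: map_f.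
by rewrite zr (le_trans rr)// (le_trans (ler_norm _))// lerDl.
Qed.

Lemma circle_free_dense f z1 (x y : R) : (forall z, holo f z) -> f z1 != 0 ->
  x < y -> exists2 r, x < r < y & circle_free f r.
Proof.
move=> hf f1 xy; have [l hl] := @finite_bad_radii f z1 y hf f1.
have [r /andP[r1 r2] rl] := avoid_seq l xy; exists r; first by rewrite r1.
by apply: hl => //; exact: ltW.
Qed.

End Jensen.

(** * Pole orders and the counting function *)

Section Counting.
Variable R : realType.
Notation C := R[i].
Implicit Types (r t : R) (z w a : C) (f g h : C -> C) (s : seq C).

Lemma entire_holo f : entire f <-> forall z, holo f z.
Proof. by split => h z; apply/cderivable_holo. Qed.

Lemma ccont_uniq_near f g z d : 0 < d -> ccont f z -> ccont g z ->
  (forall w, w != z -> cmod (w - z) < d -> f w = g w) -> f z = g z.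
Proof.
move=> d0 hf hg fg; pose k w := if cmod (w - z) < d then g w else f w.
have kz : k z = g z by rewrite /k subrr cmod0 d0.
rewrite -kz; apply: ccont_uniq => //.
  apply: (ccont_near d0 _ hg) => w wd; by rewrite /k wd.
by move=> w wz; rewrite /k; case: ifP => // wd; rewrite fg.
Qed.

Lemma dnbhs_cmod z (P : C -> Prop) : (\forall w \near (z : C^o)^', P w) <->
  exists2 d : R, 0 < d & forall w, cmod (w - z) < d -> w != z -> P w.
Proof.
split.
  move=> H; have [d d0 hd] := (nbhs_cmod z _).1 H.
  by exists d => // w wd wz; exact: hd.
by move=> [d d0 hd]; apply: (nbhs_cmod z _).2; exists d => // w /hd.
Qed.

(** Otherwise [g w = h w * (w - a) ^+ n] off [a], and the right side tends to 0. *)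
Lemma pole_order0 h g a n : ccont h a -> ccont g a -> g a != 0 ->
  (exists2 d : R, 0 < d & forall w, cmod (w - a) < d -> w != a ->
    h w = g w / (w - a) ^+ n) -> n = 0%N.
Proof.
case: n => // n hh hg g0 [d d0 hd].
have : g a = h a * (a - a) ^+ n.+1.
  apply: (ccont_uniq_near d0 hg (g := fun w => h w * (w - a) ^+ n.+1)).
    by apply: ccontM => //; apply: ccontX; exact: ccont_sub.
  by move=> w wa wd; rewrite hd// divfK// expf_neq0// subr_eq0.
by rewrite subrr expr0n /= mulr0 => E; move: g0; rewrite E eqxx.
Qed.

Lemma has_pole_orderP h a n : has_pole_order h a n ->
  exists g, [/\ ccont g a, g a != 0 & exists2 d : R, 0 < d &
    forall w, cmod (w - a) < d -> w != a -> h w = g w / (w - a) ^+ n].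
Proof.
move=> [g [g1 g2 /dnbhs_cmod g3]]; exists g; split => //.
have [d d0 hd] := (nbhs_cmod _ _).1 g1; apply: holo_cont; apply/cderivable_holo.
by apply: hd; rewrite subrr cmod0.
Qed.

Lemma has_pole_order_uniq h a n m :
  has_pole_order h a n -> has_pole_order h a m -> n = m.
Proof.
wlog nm : n m / (n <= m)%N.
  move=> W hn hm; have [?|/ltnW ?] := leqP n m; first exact: W.
  by apply/esym; exact: W.
move=> /has_pole_orderP[g [cg g0 [d d0 hd]]] /has_pole_orderP[k [ck k0 [e e0 he]]].
suff /eqP : (m - n)%N = 0%N by rewrite subn_eq0 => mn; apply/eqP; rewrite eqn_leq nm.
apply: (pole_order0 cg ck k0); exists (Num.min d e); first by rewrite lt_min d0.
move=> w; rewrite lt_min => /andP[wd we] wa.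
have wa0 : w - a != 0 by rewrite subr_eq0.
have := he w we wa; rewrite hd//.
move/(congr1 (fun x => x * (w - a) ^+ n)); rewrite divfK ?expf_neq0// => ->.
rewrite -{1}(subnK nm) exprD; field.
by rewrite !expf_neq0.
Qed.

Lemma pole_mult_eq h a n : has_pole_order h a n -> pole_mult h a = n.
Proof.
move=> hn; rewrite /pole_mult; case: xgetP => [k -> hk|/(_ n)//].
exact: has_pole_order_uniq hk hn.
Qed.

Lemma pole_mult_holo h a : holo h a -> pole_mult h a = 0%N.
Proof.
move=> hh; rewrite /pole_mult; case: xgetP => [k -> /has_pole_orderP[g [cg g0 H]]|//].
exact: pole_order0 (holo_cont hh) cg g0 H.
Qed.

Lemma characteristic_entire f r : (forall z, holo f z) ->
  characteristic f r = rmean r (fun z => logp (cmod (f z))).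
Proof.
move=> hf; rewrite /characteristic -[RHS]addr0; congr (_ + _).
have p0 t : pole_count f t = 0.
  by apply: fsbig1 => a _; rewrite pole_mult_holo.
rewrite /counting_function p0 mul0r addr0.
under eq_Rintegral do rewrite p0 subr0 mul0r.
by rewrite Rintegral_cst// mul0r.
Qed.

Lemma pole_mult_inv s g a : holo g a -> (\forall w \near (a : C^o), holo g w) ->
  g a != 0 ->
  pole_mult (fun z => (polyfactor s z * g z)^-1) a = count_mem a s.
Proof.
move=> ga gnear g0; apply: pole_mult_eq.
(* The copies of [a] in the list form the power of [z - a]; what remains does not vanish at [a]. *)
set n := count_mem a s; pose s' := [seq b <- s | b != a].
have psE z : polyfactor s z = (z - a) ^+ n * polyfactor s' z.
  rewrite /polyfactor /n /s'; elim: (s) => [|b l IH].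
    by rewrite !big_nil mulr1.
  rewrite big_cons IH /=; case: eqP => [->|_] /=.
    by rewrite add1n exprS mulrA.
  by rewrite add0n big_cons mulrCA.
have s'a : polyfactor s' a != 0.
  by rewrite polyfactor_eq0 mem_filter /= eqxx.
pose k z := polyfactor s' z * g z.
have kc : ccont k a.
  by apply: ccontM; apply: holo_cont => //; exact: holo_polyfactor.
have k0 : k a != 0 by rewrite mulf_neq0.
exists (fun z => (k z)^-1); split; last first.
- apply/dnbhs_cmod; exists 1 => // w _ wa.
  by rewrite psE -mulrA invfM mulrC.
- by rewrite invr_eq0.
have knear : \forall w \near (a : C^o), k w != 0.
  have /ccontP := kc; have c0 : 0 < cmod (k a) by rewrite cmod_gt0.
  move=> /(_ _ c0)[d d0 hd]; apply/nbhs_cmod; exists d => // w /hd.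
  by apply: contraTneq => ->; rewrite sub0r cmodN ltxx.
have [d1 d10 h1] := (nbhs_cmod _ _).1 knear; have [d2 d20 h2] := (nbhs_cmod _ _).1 gnear.
apply/nbhs_cmod; exists (Num.min d1 d2); first by rewrite lt_min d10.
move=> w; rewrite lt_min => /andP[/h1 wk /h2 wg]; apply/cderivable_holo.
by apply: holoV => //; apply: holoM => //; exact: holo_polyfactor.
Qed.

Lemma pole_count_inv s g rho t : (forall z, holo g z) ->
  (forall z, cmod z <= rho -> g z != 0) -> t <= rho ->
  pole_count (fun z => (polyfactor s z * g z)^-1) t
  = \sum_(a <- s) (cmod a <= t)%R%:R.
Proof.
move=> hg g0 tr; rewrite /pole_count.
pose F a : R := (count_mem a s)%:R.
transitivity (\sum_(a \in [set` (fun a => cmod a <= t)]) F a).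
  apply: eq_fsbigr => a; rewrite inE /= => ta; rewrite /F pole_mult_inv//.
    by apply/nbhs_cmod; exists 1.
  by apply: g0; exact: le_trans tr.
(* Points are summed with multiplicity on the left, list entries with repetition on the right;
   [undup] mediates. *)
rewrite -(@bigfs _ _ _ _ (undup s)) ?undup_uniq//; last first.
  by move=> a _; rewrite mem_undup /F => /count_memPn ->.
transitivity (\sum_(a <- s | cmod a <= t) (1 : R)); last first.
  by rewrite big_mkcond; apply: eq_bigr => a _; case: ifP.
rewrite -[RHS]big_undup_iterop_count; apply: eq_bigr => a ta.
rewrite /F; elim: (count_mem a s) => [//|[//|n] IH].
by rewrite mulrS IH.
Qed.

End Counting.

(** * The counting function as a sum over zeros, and Jensen's formula for it *)

Section CountingFormula.
Variable R : realType.
Notation C := R[i].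
Implicit Types (r t c : R) (z w a : C) (f g h : C -> C) (s : seq C).
Notation mu := (@lebesgue_measure R).

Lemma rint_inv c r : 0 < c -> c <= r -> rint c r (fun t => t^-1) = ln r - ln c.
Proof.
move=> c0; rewrite le_eqVlt => /predU1P[->|cr].
  by rewrite /rint set_itv1 Rintegral_set1 subrr.
rewrite /rint /Rintegral (@continuous_FTC2 _ _ (@ln R))//=.
- apply/subspace_continuousP => x /=; rewrite in_itv /= => /andP[cx _].
  by apply: cvg_within_filter; apply: continuousV; [rewrite gt_eqF// (lt_le_trans
    c0)|exact: cvg_id].
- split=> [x||].
  + rewrite in_itv /= => /andP[cx _].
    by have [] := is_derive1_ln (lt_trans c0 cx).
  + by apply: cvg_at_right_filter; exact: continuous_ln.
  + by apply: cvg_at_left_filter; apply: continuous_ln; exact: lt_trans cr.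
- move=> x; rewrite in_itv /= => /andP[cx _].
  rewrite derive1E; exact: (@derive_val _ _ _ _ _ _ _ (is_derive1_ln (lt_trans c0 cx))).
Qed.

(* The share of a pole of modulus [c] in the integrand of [counting_function]. *)
Definition jump c t : R := ((c <= t)%R%:R - (c <= 0)%R%:R) / t.

Lemma jump_integral c r : 0 <= c -> 0 < r ->
  mu.-integrable `]0, r] (EFin \o jump c) /\
  \int[mu]_(t in `]0, r]) jump c t
  = if c == 0 then 0 else ln (Num.max r c) - ln c.
Proof.
move=> c0 r0.
have zero : (forall t, 0 < t <= r -> jump c t = 0) ->
  mu.-integrable `]0, r] (EFin \o jump c) /\ \int[mu]_(t in `]0, r]) jump c t = 0.
  move=> H; split.
    apply: (@eq_integrable _ _ _ mu `]0, r]%classic _ (cst 0%E)) => //.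
      by move=> t; rewrite inE /= in_itv /= => /H ->.
    exact: integrable0.
  rewrite (@eq_Rintegral _ _ _ _ _ (cst 0)) ?Rintegral_cst ?mul0r//.
  by move=> t; rewrite inE /= in_itv /= => /H ->.
case: eqP => [cE|/eqP cn0].
  by apply: zero => t /andP[t0 _]; rewrite /jump cE ltW// lexx subrr mul0r.
have {cn0}c0 : 0 < c by rewrite lt_def cn0.
have [rc|cr] := ltP r c.
  rewrite subrr; apply: zero => t /andP[t0 tr].
  by rewrite /jump !leNgt c0 (le_lt_trans tr rc) subrr mul0r.
have jE : {in `]0, r]%classic, jump c =1 ((fun t => t^-1) \_ `[c, +oo[%classic)}.
  move=> t _; rewrite /jump patchE [c <= 0]leNgt c0 subr0.
  have -> : (t \in `[c, +oo[%classic) = (c <= t) by rewrite mem_setE in_itv /= andbT.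
  by case: ifP => _; rewrite ?mul1r ?mul0r.
have DE : `]0, r]%classic `&` `[c, +oo[%classic = `[c, r]%classic :> set R.
  apply/seteqP; split => t /=; rewrite !in_itv /= ?andbT.
    by move=> [/andP[_ ->] ->].
  by move=> /andP[ct ->]; rewrite ct (lt_le_trans c0 ct).
have cI : cont_on c r (fun t : R => t^-1).
  move=> x /andP[cx _]; apply: continuousV; last exact: cvg_id.
  by rewrite gt_eqF// (lt_le_trans c0).
split.
  apply: (@eq_integrable _ _ _ mu `]0, r]%classic _ (EFin \o ((fun t => t^-1) \_
    `[c, +oo[%classic))) => //.
    by move=> t /jE /= ->.
  rewrite -restrict_EFin; apply/integrable_restrict => //; rewrite setIC in DE.
  by rewrite setIC DE; exact: rint_integrable.
by rewrite (@eq_Rintegral _ _ _ mu _ _ _ jE) -Rintegral_mkcondr DE -(rint_inv c0 cr).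
Qed.

Lemma counting_function_inv s g rho r : (forall z, holo g z) ->
  (forall z, cmod z <= rho -> g z != 0) -> 0 < r <= rho ->
  counting_function (fun z => (polyfactor s z * g z)^-1) r
  = \sum_(a <- s) (ln (Num.max r (cmod a)) - ln (cmod a)).
Proof.
move=> hg g0 /andP[r0 rr]; rewrite /counting_function.
have rho0 : 0 <= rho by apply: le_trans rr; exact: ltW.
have pE t : t <= rho -> pole_count (fun z => (polyfactor s z * g z)^-1) t
   = \sum_(a <- s) (cmod a <= t)%R%:R by exact: pole_count_inv.
rewrite (pE 0 rho0).
rewrite (@eq_Rintegral _ _ _ mu _ (fun t => \sum_(a <- s) jump (cmod a) t)); last first.
  move=> t; rewrite inE /= in_itv /= => /andP[t0 tr]; rewrite pE ?(le_trans tr)//.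
  by rewrite -sumrB mulr_suml.
have [_ ->] : mu.-integrable `]0, r] (EFin \o (fun t => \sum_(a <- s) jump (cmod a) t)) /\
  \int[mu]_(t in `]0, r]) (\sum_(a <- s) jump (cmod a) t)
  = \sum_(a <- s) (if cmod a == 0 then 0 else ln (Num.max r (cmod a)) - ln (cmod a)).
  elim: (s) => [|b l [IH1 IH2]].
    have -> : (fun t => \sum_(a <- [::]) jump (cmod a) t) = cst 0.
      by apply/funext => t; rewrite big_nil.
    rewrite big_nil; split; first exact: integrable0.
    by rewrite Rintegral_cst// mul0r.
  have [J1 J2] := jump_integral (cmod_ge0 b) r0.
  have -> : (fun t => \sum_(a <- b :: l) jump (cmod a) t)
      = (fun t => jump (cmod b) t + \sum_(a <- l) jump (cmod a) t).
    by apply/funext => t; rewrite big_cons.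
  rewrite big_cons -J2 -IH2.
  split; last exact: RintegralD.
  exact: (@integrableD _ _ _ mu _ _ (EFin \o jump (cmod b)) (EFin \o (fun t =>
    \sum_(a <- l) jump (cmod a) t))).
rewrite mulr_suml -big_split; apply: eq_bigr => a _ /=.
case: eqP => [->|/eqP a0].
  (* A zero at the origin: the separate term gives [ln r], and so does the sum because
     [ln 0 = 0]. *)
  rewrite lexx mul1r add0r (_ : ln 0 = 0) ?subr0; last by rewrite ln0.
  by congr ln; apply/esym/max_idPl; exact: ltW.
by rewrite [cmod a <= 0]leNgt lt_def a0 cmod_ge0 mul0r addr0.
Qed.

(** Both terms depend on [r] through the same sum of [ln (Num.max r (cmod a))], so their difference
    is a constant of the factorization. One factorization, on the disc of the larger radius, serves
    both radii. *)
Lemma log_mean_counting f z1 r1 r2 : (forall z, holo f z) -> f z1 != 0 ->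
  0 < r1 -> 0 < r2 -> circle_free f r1 -> circle_free f r2 ->
  log_mean f r1 - counting_function (fun z => (f z)^-1) r1
  = log_mean f r2 - counting_function (fun z => (f z)^-1) r2.
Proof.
move=> hf f1 r10 r20 c1 c2; pose rho := Num.max r1 r2.
have rho0 : 0 < rho by rewrite lt_max r10.
have [s [g [hg sr g0 fE]]] := factorization hf f1 rho0.
have fE' : (fun z => (f z)^-1) = (fun z => (polyfactor s z * g z)^-1).
  by apply/funext => z; rewrite fE.
suff H r : 0 < r <= rho -> circle_free f r ->
  log_mean f r - counting_function (fun z => (f z)^-1) r
  = ln (cmod (g 0)) + \sum_(a <- s) ln (cmod a).
  by rewrite !H// ?r10 ?r20 le_max lexx ?orbT.
move=> rI cr; rewrite fE' (counting_function_inv _ hg g0 rI) sumrB.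
have -> : log_mean f r = log_mean (fun z => polyfactor s z * g z) r.
  by apply: eq_rmean => [|z _]; [case/andP: rI => /ltW | rewrite fE].
rewrite (jensen rI hg g0); first ring.
move=> a sa; apply/negP => /eqP ar; have := cr a ar.
by rewrite fE mulf_eq0 polyfactor_eq0 sa.
Qed.

Lemma logpE (x : R) : logp x = ln (Num.max x 1).
Proof.
rewrite /logp; case: (leP x 1) => [x1|/ltW x1].
  by rewrite ln1; apply/max_idPr; exact: ln_le0.
by apply/max_idPl; exact: ln_ge0.
Qed.

Lemma logp_ge0 (x : R) : 0 <= logp x.
Proof. by rewrite /logp le_max lexx orbT. Qed.

Lemma ln_le_logp (x : R) : ln x <= logp x.
Proof. by rewrite /logp le_max lexx. Qed.

Lemma le_logp (x y : R) : x <= y -> logp x <= logp y.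
Proof.
move=> xy; rewrite !logpE ler_ln ?posrE ?lt_max ?ltr01 ?orbT//.
by rewrite ge_max !le_max xy lexx orbT.
Qed.

Lemma le_expR_logp (x : R) : x <= expR (logp x).
Proof. by rewrite logpE lnK ?posrE ?lt_max ?ltr01 ?orbT// le_max lexx. Qed.

Lemma rcont_logp f z : ccont f z -> rcont (fun w => logp (cmod (f w))) z.
Proof.
move=> hf; under eq_fun do rewrite logpE.
apply: rcont_ln; first by rewrite lt_max ltr01 orbT.
apply: rcont_max; last exact: rcont_cst.
by apply: rcont_comp => //; exact: rcont_cmod.
Qed.

End CountingFormula.

(** * Growth of the solutions *)

Section Growth.
Variable R : realType.
Notation C := R[i].
Implicit Types (r t c : R) (z w a : C) (f g h : C -> C).

Lemma characteristic_ge0 f r : (forall z, holo f z) -> 0 <= r ->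
  0 <= characteristic f r.
Proof.
move=> hf r0; rewrite characteristic_entire// -(rmean_cst r 0).
apply: rmean_le => // z zr; [exact: rcont_cst| |exact: logp_ge0].
by apply: rcont_logp; exact: holo_cont.
Qed.

Lemma characteristic_le f r x : (forall z, holo f z) -> 0 <= r -> 0 <= x ->
  (forall z, cmod z = r -> cmod (f z) <= expR x) -> characteristic f r <= x.
Proof.
move=> hf r0 x0 fx; rewrite characteristic_entire// -(rmean_cst r x).
apply: rmean_le => // z zr; [|exact: rcont_cst|].
  by apply: rcont_logp; exact: holo_cont.
apply: le_trans (le_logp (fx z zr)) _.
by rewrite /logp expRK ge_max lexx.
Qed.

(** For |z| <= r/2 the Poisson kernel is at most (r + |z|) / (r - |z|) <= 3. *)
Lemma cmod_le_characteristic f z r : (forall z, holo f z) -> 0 < r ->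
  2 * cmod z <= r -> cmod (f z) <= expR (3 * characteristic f r).
Proof.
move=> hf r0 zr; have zlt : cmod z < r by have := cmod_ge0 z; lra.
pose u w := logp (cmod (f w)).
have cu x : cmod x = r -> rcont u x by move=> _; apply: rcont_logp; exact: holo_cont.
apply: le_trans (_ : expR (poisson r u z) <= _).
  apply: poisson_majorant => // x _; exact: le_expR_logp.
rewrite ler_expR characteristic_entire// -(rmeanZ _ (ltW r0) cu).
apply: rmean_le; first exact: ltW.
- by move=> x xr; exact: (rcont_pkerM cu zlt xr).
- by move=> x xr; apply: rcontM; [exact: rcont_cst|exact: cu].
- move=> x xr; apply: ler_wpM2r; first exact: logp_ge0.
  apply: le_trans (pker_le xr zlt) _; rewrite ler_pdivrMr ?subr_gt0//.
  by have := cmod_ge0 z; lra.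
Qed.

Variables (m : nat) (b beta : 'I_m -> C).

(** The added 1 keeps the constant at least 1, also when [m = 0], so that it can serve as a
    divisor. *)
Definition cmod_sum1 (F : 'I_m -> C) : R := \sum_(j < m) cmod (F j) + 1.
Notation B := (cmod_sum1 b).
Notation be := (cmod_sum1 beta).

Lemma sum_cmod_ge0 (F : 'I_m -> C) : 0 <= \sum_(j < m) cmod (F j).
Proof. by apply: sumr_ge0 => j _; exact: cmod_ge0. Qed.

Lemma cmod_sum1_ge1 (F : 'I_m -> C) : 1 <= cmod_sum1 F.
Proof. by rewrite lerDr sum_cmod_ge0. Qed.

Lemma shift_le j : cmod (beta j) <= be.
Proof.
rewrite /cmod_sum1 (bigD1 j)//= -addrA lerDl addr_ge0// sumr_ge0// => i _.
exact: cmod_ge0.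
Qed.

Lemma linear_difference_le f z Y : 0 <= Y ->
  (forall j, cmod (f (z + beta j)) <= Y) ->
  cmod (linear_difference b beta f z) <= B * Y.
Proof.
move=> Y0 fY; apply: le_trans (_ : \sum_(j < m) cmod (b j) * Y <= _); last first.
  by rewrite -mulr_suml ler_wpM2r// lerDl.
rewrite /linear_difference.
elim/big_ind2 : _ => [|x x' y y' h1 h2|j _]; first by rewrite cmod0.
  by apply: le_trans (cmodD _ _) _; exact: lerD.
by rewrite cmodM ler_wpM2l ?cmod_ge0.
Qed.

(* If [expR x < cmod (f z)] with [x] large compared with [cmod z], then
   [expR (2 * x - D) < cmod (f (z + beta j))] for some [j].  Iterating, [log |f|]
   would double at each step of bounded length, against [sigma < 1]. *)
Lemma difference_exponential_type f (P : C -> C) (A sigma r0 : R) :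
  (forall z, holo f z) -> 0 <= A ->
  (forall z, f z ^+ 2 + linear_difference b beta f z = P z) ->
  (forall z, cmod (P z) <= expR (A * (cmod z + 1))) -> sigma < 1 ->
  (forall r, r0 <= r -> characteristic f r <= expR (expR (sigma * ln r))) ->
  exists2 K, 0 < K & forall z, cmod (f z) <= expR (K * (cmod z + 1)).
Proof.
move=> hf A0 fP hP s1 hT.
have B1 := cmod_sum1_ge1 b.
have be1 := cmod_sum1_ge1 beta.
have B0 : 0 < B by exact: lt_le_trans B1.
(* Of the size [expR (2 * x)] of [f z ^+ 2], the function [P] can cancel at most half; the other
   half is spread over terms whose coefficients have total modulus below [B], hence the loss [D]. *)
pose D := ln (2 * B); have ln20 : 0 < ln 2 :> R by rewrite ln_gt0// ltr1n.
have D2 : ln 2 <= D by rewrite /D ler_ln ?posrE ?mulr_gt0//; lra.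
have eD : expR D = 2 * B by rewrite /D lnK// posrE mulr_gt0.
have [K KA K1] : exists2 K, A <= K & 1 <= K by exists (A + 1); [rewrite lerDl |
  rewrite lerDr].
clearbody D.
have Kbe : 0 <= K * be by rewrite mulr_ge0//; lra.
exists (K + D + K * be); first by lra.
move=> z0; rewrite leNgt; apply/negP => big.
(* The lower bound on [x] keeps [P z] below half of [expR (2 * x)]. It survives a step: doubling [x]
   leaves room for the loss [D] and for the growth of [s] by [be]. *)
pose inv s x z := [/\ cmod z <= s, 0 <= s, expR x < cmod (f z) & K * (s + 1) + D +
  K * be <= x].
have step s x z : inv s x z -> exists z', inv (s + be) (2 * x - D) z'.
  move=> [zs s0 fx xK].
  have Ks : 0 <= K * s by rewrite mulr_ge0//; lra.
  have Pz : cmod (P z) <= expR (2 * x - ln 2).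
    apply: le_trans (hP z) _; rewrite ler_expR.
    apply: le_trans (_ : K * (s + 1) <= _); last lra.
    by apply: ler_pM => //; rewrite ?addr_ge0 ?cmod_ge0//; lra.
  have e2x : expR (2 * x - ln 2) = expR (2 * x) / 2 by rewrite expRD expRN lnK ?posrE.
  have fz2 : expR (2 * x) < cmod (f z ^+ 2).
    rewrite cmodX mulr_natl mulr2n expRD -expr2 ltrXn2r ?expR_ge0//.
  have Lz : expR (2 * x) / 2 < cmod (linear_difference b beta f z).
    have -> : linear_difference b beta f z = P z - f z ^+ 2 by rewrite -fP; ring.
    rewrite cmodBC; apply: lt_le_trans (cmodB_ge _ _); rewrite e2x in Pz; lra.
  have [j hj] : exists j, expR (2 * x - D) < cmod (f (z + beta j)).
    apply: contrapT => H; move: Lz; apply/negP; rewrite -leNgt.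
    apply: le_trans (_ : B * expR (2 * x - D) <= _).
      apply: linear_difference_le; first exact: expR_ge0.
      by move=> j; rewrite leNgt; apply/negP => hj; apply: H; exists j.
    rewrite expRD expRN eD.
    by rewrite le_eqVlt; apply/orP; left; apply/eqP; field; rewrite gt_eqF.
  exists (z + beta j); split => //.
  - by apply: le_trans (cmodD _ _) _; rewrite lerD// shift_le.
  - by lra.
  - by rewrite [s + be + 1]addrAC mulrDr; lra.
have Kz : 0 <= K * cmod z0 by rewrite mulr_ge0 ?cmod_ge0//; lra.
pose x0 := K * (cmod z0 + 1) + D + K * be.
have inv0 : inv (cmod z0) x0 z0.
  split => //; first exact: cmod_ge0.
  apply: le_lt_trans big; rewrite ler_expR /x0.
  have := mulr_ge0 (le_trans (ltW ln20) D2) (cmod_ge0 z0).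
  by have := mulr_ge0 Kbe (cmod_ge0 z0); lra.
have iter n : exists z x, inv (cmod z0 + n%:R * be) x z /\ x = 2 ^+ n * (x0 - D) + D.
  elim: n => [|n [z [x [hi xE]]]].
    by exists z0, x0; rewrite mul0r addr0 expr0 mul1r subrK.
  have [z' hz'] := step _ _ _ hi; exists z', (2 * x - D); split.
    by rewrite -natr1 mulrDl mul1r addrA.
  by rewrite xE exprS; ring.
have x01 : 1 <= x0 - D by rewrite /x0 mulrDr mulr1; lra.
pose r_ n := 2 * (cmod z0 + 1 + n%:R * be).
have main n : r0 <= r_ n -> n%:R * ln 2 <= ln 3 + expR (sigma * ln (r_ n)).
  move=> rn; have [z [x [[zs s0 fx _] xE]]] := iter n.
  have nb : 0 <= n%:R * be by rewrite mulr_ge0//; lra.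
  have rn0 : 0 < r_ n by rewrite /r_; have := cmod_ge0 z0; lra.
  have zr : 2 * cmod z <= r_ n by rewrite /r_; lra.
  have := lt_le_trans fx (cmod_le_characteristic hf rn0 zr).
  rewrite ltr_expR => xT.
  have h2 : 2 ^+ n <= 3 * expR (expR (sigma * ln (r_ n))).
    have := hT _ rn; suff : 2 ^+ n <= x by lra.
    rewrite xE; apply: le_trans (_ : 2 ^+ n * (x0 - D) <= _); last by lra.
    by rewrite ler_peMr ?exprn_ge0.
  rewrite mulrC mulr_natr -lnXn// -ler_expR expRD !lnK ?posrE ?exprn_gt0//.
(* [r ^ sigma <= c r] for large [r], while [n ln 2] grows linearly in [r_ n] *)
pose c := ln 2 / (4 * be); have c0 : 0 < c by rewrite divr_gt0//; lra.
pose rc := expR (- ln c / (1 - sigma)).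
have sub r : rc <= r -> 0 < r -> expR (sigma * ln r) <= c * r.
  move=> rcr r0'; rewrite -[c]lnK// -[X in _ <= _ * X]lnK// -expRD ler_expR.
  move: rcr; rewrite -[r]lnK// ler_expR expRK ler_pdivrMr ?subr_gt0//; lra.
(* Past both thresholds, and so large that half of N ln 2 exceeds the constant terms; the other half
   is the linear part of [c * r_ N]. *)
pose N := Num.bound (`|r0| + rc + (ln 3 + 2 * c * (cmod z0 + 1)) / (ln 2 / 2)).
have l3 : 0 <= ln 3 :> R by rewrite ln_ge0// ler1n.
have cz : 0 <= 2 * c * (cmod z0 + 1).
  apply: mulr_ge0; first by apply: mulr_ge0 => //; exact: ltW.
  by have := cmod_ge0 z0; lra.
have Q0 : 0 <= (ln 3 + 2 * c * (cmod z0 + 1)) / (ln 2 / 2) by apply: divr_ge0; lra.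
have rc0 : 0 <= rc by exact: expR_ge0.
have hN : `|r0| + rc + (ln 3 + 2 * c * (cmod z0 + 1)) / (ln 2 / 2) < N%:R.
  by apply: archi_boundP; have := normr_ge0 r0; lra.
have Nr : N%:R <= r_ N.
  have : N%:R <= N%:R * be by rewrite ler_peMr.
  by rewrite /r_; have := cmod_ge0 z0; have := ler0n R N; lra.
have r0N : r0 <= r_ N by have := ler_norm r0; lra.
have rcN : rc <= r_ N by have := normr_ge0 r0; lra.
have rN0 : 0 < r_ N by apply: lt_le_trans rcN; exact: expR_gt0.
have := main N r0N; have := sub _ rcN rN0.
have -> : c * r_ N = 2 * c * (cmod z0 + 1) + N%:R * (ln 2 / 2).
  by rewrite /c /r_; field; rewrite gt_eqF// (lt_le_trans ltr01 be1).
have : (ln 3 + 2 * c * (cmod z0 + 1)) < N%:R * (ln 2 / 2).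
  by rewrite -ltr_pdivrMr ?divr_gt0//; have := normr_ge0 r0; lra.
lra.
Qed.

(** At a point with |z| = r/4 where [P] is large, only values of [f] within r/2 occur, and these are
    at most exp(3 T). Hence k r/4 <= ln(1 + B) + 6 T, and [k / 48] remains once ln(1 + B) <= k
    r/8. *)
Lemma difference_growth_lower f (P : C -> C) (k r0 : R) :
  (forall z, holo f z) -> 0 < k ->
  (forall z, f z ^+ 2 + linear_difference b beta f z = P z) ->
  (forall r, r0 <= r -> exists2 z, cmod z = r & expR (k * r) <= cmod (P z)) ->
  exists c r1, [/\ 0 < c, 0 < r1 & forall r, r1 <= r -> c * r <= characteristic f r].
Proof.
move=> hf k0 fP hP.
have B1 := cmod_sum1_ge1 b.
have be1 := cmod_sum1_ge1 beta.
have lB : 0 <= ln (1 + B) by rewrite ln_ge0//; lra.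
have Q0 : 0 <= 8 * ln (1 + B) / k by rewrite divr_ge0 ?mulr_ge0// ltW.
exists (k / 48), (4 * `|r0| + 4 * be + 8 * ln (1 + B) / k); split.
- by rewrite divr_gt0.
- by have := normr_ge0 r0; lra.
move=> r hr; have r00 := normr_ge0 r0; have rr0 := ler_norm r0.
have rpos : 0 < r by lra.
have [|z zr Pz] := hP (r / 4); first by lra.
set T := characteristic f r; have T0 : 0 <= T by apply: characteristic_ge0 => //;
  exact: ltW.
have fz w : cmod w <= r / 4 + be -> cmod (f w) <= expR (3 * T).
  by move=> wr; apply: cmod_le_characteristic => //; lra.
have Y1 : 1 <= expR (3 * T) by rewrite -expR0 ler_expR mulr_ge0.
have : cmod (P z) <= (1 + B) * expR (6 * T).
  rewrite -fP; apply: le_trans (cmodD _ _) _.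
  have -> : 6 * T = 3 * T + 3 * T by ring.
  rewrite expRD mulrDl mul1r; apply: lerD.
    rewrite cmodX expr2; have f1 : cmod (f z) <= expR (3 * T) by apply: fz; lra.
    by apply: ler_pM; rewrite ?cmod_ge0.
  apply: le_trans (_ : B * expR (3 * T) <= _).
    apply: linear_difference_le; first exact: expR_ge0.
    move=> j; apply: fz; apply: le_trans (cmodD _ _) _.
    by rewrite zr lerD2l shift_le.
  rewrite ler_wpM2l//; first lra.
  by rewrite ler_peMr// expR_ge0.
move=> /(le_trans Pz); rewrite -{1}[1 + B]lnK ?posrE; last lra.
rewrite -expRD ler_expR.
have : ln (1 + B) <= k * r / 8.
  have h : 8 * ln (1 + B) / k <= r by have := normr_ge0 r0; lra.
  by move: h; rewrite ler_pdivrMr//; lra.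
lra.
Qed.

End Growth.

(** * Orders of growth, and the size of exponential sums *)

Section Orders.
Variable R : realType.
Notation C := R[i].
Implicit Types (r t c : R) (z w a : C) (f g h : C -> C).

Lemma hyper_order_lt1 f : (hyper_order f < 1%:E)%E ->
  exists sigma r0, sigma < 1 /\
    forall r, r0 <= r -> characteristic f r <= expR (expR (sigma * ln r)).
Proof.
rewrite /hyper_order /limf_esup => /ereal_inf_lt[y [V [M [_ hM]] <-]].
set S := _ @` V => S1.
have V1 : V (Num.max M 1 + 1) by apply: hM; rewrite ltr_pwDr// le_max lexx.
have up r : V r -> ((logp (logp (characteristic f r)) / ln r)%:E <= ereal_sup S)%E.
  by move=> Vr; apply: ereal_sup_ubound; exists r.
(* The upper bound 1 excludes +oo, and the value at a point of [V] excludes -oo. *)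
case E : (ereal_sup S) => [s| |]; first 1 last.
- by rewrite E in S1.
- by have := up _ V1; rewrite E.
exists s, (Num.max M 1 + 1); split; first by rewrite E lte_fin in S1.
move=> r hr; have r1 : 1 < r by apply: lt_le_trans hr; rewrite ltr_pwDr// le_max
  lexx orbT.
have Vr : V r by apply: hM; apply: lt_le_trans hr; rewrite ltr_pwDr// le_max lexx.
have lr : 0 < ln r by rewrite ln_gt0.
have := up r Vr; rewrite E lee_fin ler_pdivrMr// => h.
apply: le_trans (le_expR_logp _) _; rewrite ler_expR.
by apply: le_trans (le_expR_logp _) _; rewrite ler_expR.
Qed.

(** Constant factors move [logp] of the characteristic by a constant, which [ln r] outgrows. *)
Lemma growth_order_eq1 f (c K r0 : R) : 0 < c -> 0 < K ->
  (forall r, r0 <= r -> c * r <= characteristic f r <= K * (r + 1)) ->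
  growth_order f = 1%:E.
Proof.
move=> c0 K0 hT; apply/eqP; rewrite eq_le; apply/andP; split.
  apply/lee_addgt0Pr => e e0; rewrite -EFinD /growth_order /limf_esup.
  pose M := Num.max (Num.max r0 1) (expR (ln (2 * K) / e)).
  apply: le_trans (ereal_inf_lbound _) _.
    exists [set r | M < r]; last reflexivity.
    by exists M; rewrite num_real.
  apply: ge_ereal_sup => _ [r /= Mr <-]; rewrite lee_fin.
  move: Mr; rewrite /M !gt_max => /andP[/andP[rr0 r1] re].
  have rp : 0 < r by apply: lt_trans r1.
  have lr : 0 < ln r by rewrite ln_gt0.
  rewrite ler_pdivrMr// /logp ge_max; apply/andP; split; last first.
    by rewrite mulr_ge0 ?addr_ge0// ltW.
  have /andP[h1 h2] := hT _ (ltW rr0).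
  have Tp : 0 < characteristic f r by apply: lt_le_trans h1; rewrite mulr_gt0.
  apply: le_trans (_ : ln (2 * K * r) <= _).
    rewrite ler_ln ?posrE ?mulr_gt0//; apply: le_trans h2 _.
    by rewrite [2 * K]mulrC -mulrA ler_pM2l//; lra.
  rewrite lnM ?posrE ?mulr_gt0//.
  rewrite [(1 + e) * _]mulrDl mul1r [leRHS]addrC lerD2r.
  have : ln (2 * K) / e < ln r by rewrite -ltr_expR [expR (ln r)]lnK.
  by rewrite ltr_pdivrMr// [ln r * e]mulrC => /ltW.
apply: le_ereal_inf_tmp => _ [V [M [_ hM]] <-].
apply/lee_subgt0Pr => e e0; rewrite -EFinB; apply: le_ereal_sup_tmp.
pose r := Num.max (Num.max M r0) (Num.max 1 (expR (- ln c / e))) + 1.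
have [Mr rr0 r1 re] : [/\ M < r, r0 < r, 1 < r & expR (- ln c / e) < r].
  by rewrite /r; split; rewrite ltr_pwDr// !le_max lexx ?orbT.
exists ((logp (characteristic f r) / ln r)%:E).
  by exists r => //; exact: hM.
have rp : 0 < r by apply: lt_trans r1.
have lr : 0 < ln r by rewrite ln_gt0.
rewrite lee_fin ler_pdivlMr//; apply: le_trans (ln_le_logp _).
have /andP[h1 _] := hT _ (ltW rr0).
apply: le_trans (_ : ln (c * r) <= _); last first.
  by rewrite ler_ln ?posrE ?mulr_gt0// (lt_le_trans _ h1)// mulr_gt0.
rewrite lnM ?posrE// mulrBl mul1r [leRHS]addrC lerD2l.
have : - ln c / e < ln r by rewrite -ltr_expR [expR (ln r)]lnK.
by rewrite ltr_pdivrMr//; lra.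
Qed.

Definition exp_sum (p1 p2 a1 a2 : C) z : C := p1 * cexp (a1 * z) + p2 * cexp (a2 * z).

Lemma expR_ge_id (x : R) : x <= expR x.
Proof. by apply: le_trans (expR_ge1Dx x); rewrite lerDr. Qed.

Lemma exp_sum_upper p1 p2 a1 a2 : exists2 A, 0 <= A &
  forall z, cmod (exp_sum p1 p2 a1 a2 z) <= expR (A * (cmod z + 1)).
Proof.
have n1 := cmod_ge0 a1; have n2 := cmod_ge0 a2.
have m1 := cmod_ge0 p1; have m2 := cmod_ge0 p2.
exists (cmod a1 + cmod a2 + (cmod p1 + cmod p2)); first by rewrite !addr_ge0.
move=> z; have cz := cmod_ge0 z; apply: le_trans (cmodD _ _) _; rewrite !cmodM !cmod_cexp.
have E a : cmod a <= cmod a1 + cmod a2 ->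
    expR (complex.Re (a * z)) <= expR ((cmod a1 + cmod a2) * cmod z).
  move=> ha; rewrite ler_expR; apply: le_trans (ler_norm _) _.
  by apply: le_trans (cmod_ge_Re _) _; rewrite cmodM ler_wpM2r.
apply: le_trans (_ : (cmod p1 + cmod p2) * expR ((cmod a1 + cmod a2) * cmod z) <= _).
  by rewrite mulrDl; apply: lerD; apply: ler_wpM2l => //; apply: E; lra.
apply: le_trans (_ : expR (cmod p1 + cmod p2) * expR ((cmod a1 + cmod a2) * cmod z) <= _).
  by rewrite ler_wpM2r ?expR_ge0// expR_ge_id.
rewrite -expRD ler_expR; have h1 := mulr_ge0 m1 cz; have h2 := mulr_ge0 m2 cz; lra.
Qed.

(** After an exchange |a2| <= |a1|. On the ray through the conjugate of [a1], the real part of a1 z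
    is |a1| r, while that of a2 z is a strictly smaller multiple of r because |a1 - a2| > 0. *)
Lemma exp_sum_lower p1 p2 a1 a2 : p1 != 0 -> p2 != 0 -> a1 != 0 -> a2 != 0 ->
  a1 != a2 -> exists k r0, 0 < k /\ forall r, r0 <= r ->
    exists2 z, cmod z = r & expR (k * r) <= cmod (exp_sum p1 p2 a1 a2 z).
Proof.
move=> p10 p20 a10 a20 a12.
wlog a21 : p1 p2 a1 a2 p10 p20 a10 a20 a12 / cmod a2 <= cmod a1.
  move=> W; have [/W|/ltW /W] := leP (cmod a2) (cmod a1); first exact.
  move=> /(_ p2 p1 p20 p10 a20 a10); rewrite eq_sym => /(_ a12)[k [r0 [k0 H]]].
  exists k, r0; split => // r /H[z zr hz]; exists z => //.
  by rewrite /exp_sum addrC.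
have A0 : 0 < cmod a1 by rewrite cmod_gt0.
have P1 : 0 < cmod p1 by rewrite cmod_gt0.
have P2 : 0 < cmod p2 by rewrite cmod_gt0.
set A := cmod a1 in A0 a21 *.
pose mu := complex.Re (a2 * a1^*) / A.
have mA : mu < A.
  rewrite /mu ltr_pdivrMr// -expr2.
  have : 0 < cmod (a1 - a2) ^+ 2 by rewrite exprn_gt0// cmod_gt0 subr_eq0.
  have : cmod a2 ^+ 2 <= A ^+ 2 by rewrite lerXn2r ?nnegrE ?cmod_ge0.
  rewrite /A !sqr_cmod; case: (a1) (a2) => x1 y1 [x2 y2] /=; lra.
(* Beyond the first bound the second term is at most half of the first; beyond the other one,
   [expR (A / 2 * r)] absorbs the factor [2 / cmod p1]. *)
pose r0 := Num.max (ln (2 * cmod p2 / cmod p1) / (A - mu)) (2 * ln (2 / cmod p1) / A).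
exists (A / 2), (Num.max r0 0); split; first by rewrite divr_gt0.
move=> r; rewrite !ge_max => /andP[/andP[h1 h2] r00].
have dA : 0 < A - mu by rewrite subr_gt0.
exists ((r / A)%:C * a1^*).
  have rA : 0 <= r / A by apply: divr_ge0 => //; exact: ltW.
  by rewrite cmodM cmod_real cmodJ ger0_norm// -/A divfK// gt_eqF.
have re1 : complex.Re (a1 * ((r / A)%:C * a1^*)) = r * A.
  by rewrite mulrCA -sqr_cmodC cReMr /= -/A; field; rewrite gt_eqF.
have re2 : complex.Re (a2 * ((r / A)%:C * a1^*)) = r * mu.
  by rewrite mulrCA cReMr /mu; field; rewrite gt_eqF.
have : cmod p1 * expR (r * A) - cmod p2 * expR (r * mu) <=
    cmod (exp_sum p1 p2 a1 a2 ((r / A)%:C * a1^*)).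
  rewrite /exp_sum -[p2 * _]opprK.
  apply: le_trans (cmodB_ge _ _); rewrite cmodN !cmodM !cmod_cexp re1 re2//.
apply: le_trans.
have s1 : cmod p2 * expR (r * mu) <= cmod p1 * expR (r * A) / 2.
  rewrite -[r * A](subrK (r * mu)) expRD -mulrBr.
  have : 2 * cmod p2 / cmod p1 <= expR (r * (A - mu)).
    rewrite -[leLHS]lnK ?posrE ?divr_gt0 ?mulr_gt0// ler_expR.
    by rewrite -ler_pdivrMr.
  rewrite ler_pdivrMr// => h; rewrite mulrA mulrAC ler_wpM2r ?expR_ge0//; lra.
have s2 : 2 / cmod p1 * expR (A / 2 * r) <= expR (r * A).
  have -> : r * A = r * A / 2 + A / 2 * r by field.
  rewrite expRD ler_wpM2r ?expR_ge0// -[leLHS]lnK ?posrE ?divr_gt0// ler_expR.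
  by move: h2; rewrite ler_pdivrMr//; lra.
move: s2; rewrite mulrAC ler_pdivrMr// mulrC => s2; lra.
Qed.

End Orders.

(** * Exponential sums and their annihilators *)

Section ExponentialSums.
Variable R : realType.
Notation C := R[i].
Implicit Types (z w a c p h k : C) (f g F G : C -> C).

(* [(E_h - e^(a1 h)) (E_k - e^(a2 k)) F] where [E_h] is the shift by [h];
   it annihilates the span of [e^(a1 z)] and [e^(a2 z)]. *)
Definition annihilator a1 a2 h k F z : C :=
  F (z + h + k) - cexp (a1 * h) * F (z + k) - cexp (a2 * k) * F (z + h)
  + cexp (a1 * h) * cexp (a2 * k) * F z.

Lemma annihilator_exp_sum p1 p2 a1 a2 h k z :
  annihilator a1 a2 h k (exp_sum p1 p2 a1 a2) z = 0.
Proof. by rewrite /annihilator /exp_sum !mulrDr !cexpD; ring. Qed.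

Lemma annihilatorD a1 a2 h k F G z :
  annihilator a1 a2 h k (fun z => F z + G z) z
  = annihilator a1 a2 h k F z + annihilator a1 a2 h k G z.
Proof. by rewrite /annihilator; ring. Qed.

Lemma holo_shift F a : (forall z, holo F z) -> forall z, holo (fun z => F (z + a)) z.
Proof.
move=> hF z; apply: holo_comp; first exact: hF.
by apply: holoD; [exact: holo_id | exact: holo_cst].
Qed.

Lemma holo_annihilator a1 a2 h k F : (forall z, holo F z) ->
  forall z, holo (annihilator a1 a2 h k F) z.
Proof.
move=> hF z; have hs a : holo (fun z => F (z + a)) z by exact: holo_shift.
have hs2 : holo (fun z => F (z + h + k)) z.
  by under eq_fun do rewrite -addrA; exact: hs.
by apply: holoD; first (apply: holoB; first apply: holoB => //);
  apply: holoM => //; exact: holo_cst.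
Qed.

Lemma cexp1_neq1 : cexp (1 : C) != 1.
Proof.
apply/eqP => /(congr1 (@cmod R)); rewrite cmod_cexp cmod1 => /eqP.
by rewrite gt_eqF// expR_gt1.
Qed.

(** For [k = (a1 - a2)^-1] the two exponents differ by 1, and [cexp 1] is not 1. *)
Lemma cexp_separate a1 a2 : a1 != a2 -> exists k, cexp (a1 * k) != cexp (a2 * k).
Proof.
move=> a12; exists ((a1 - a2)^-1); have d : a1 - a2 != 0 by rewrite subr_eq0.
have -> : a1 / (a1 - a2) = 1 + a2 / (a1 - a2) by field.
rewrite cexpD -subr_eq0 -{2}[cexp (a2 / _)]mul1r -mulrBl mulf_neq0 ?cexp_neq0//.
by rewrite subr_eq0 cexp1_neq1.
Qed.

(** Annihilation at the point 0 expresses [F (z + w)] through [F z] and [F w]. Exchanging the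
    arguments gives, for a fixed [w = k], a linear equation for [F z] with the nonzero coefficient
    [d]. *)
Lemma annihilated_exp_sum a1 a2 F : a1 != a2 ->
  (forall h k z, annihilator a1 a2 h k F z = 0) ->
  exists c1 c2, forall z, F z = exp_sum c1 c2 a1 a2 z.
Proof.
move=> a12 H; have [k kne] := cexp_separate a12.
have E z w : F (z + w) = cexp (a2 * w) * F z
    + cexp (a1 * z) * (F w - cexp (a2 * w) * F 0).
  have := H z w 0; rewrite /annihilator !add0r => H0.
  by apply/eqP; rewrite -subr_eq0; apply/eqP; rewrite -[RHS]H0; ring.
pose d := cexp (a2 * k) - cexp (a1 * k).
have d0 : d != 0 by rewrite subr_eq0 eq_sym.
exists ((cexp (a2 * k) * F 0 - F k) / d), ((F k - cexp (a1 * k) * F 0) / d) => z.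
rewrite /exp_sum; apply: (mulIf d0).
have := E z k; rewrite addrC E => S.
transitivity ((cexp (a2 * k) * F 0 - F k) * cexp (a1 * z)
    + (F k - cexp (a1 * k) * F 0) * cexp (a2 * z)); last by field.
rewrite /d.
have {}S : cexp (a2 * z) * F k + cexp (a1 * k) * (F z - cexp (a2 * z) * F 0)
  - (cexp (a2 * k) * F z + cexp (a1 * z) * (F k - cexp (a2 * k) * F 0)) = 0.
  by rewrite S subrr.
by apply/eqP; rewrite -subr_eq0; apply/eqP; rewrite -[RHS]oppr0 -[in RHS]S; ring.
Qed.

(* Otherwise [exp_sum c1 c2 a1 a2] has a simple zero. *)
Lemma square_exp_sum f c1 c2 a1 a2 : (forall z, holo f z) -> a1 != a2 ->
  (forall z, f z ^+ 2 = exp_sum c1 c2 a1 a2 z) -> c1 = 0 \/ c2 = 0.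
Proof.
move=> hf a12 fE; have [->|c10] := eqVneq c1 0; first by left.
have [->|c20] := eqVneq c2 0; first by right.
exfalso; pose d := a2 - a1; have d0 : d != 0 by rewrite subr_eq0 eq_sym.
have [w wE] : exists w, cexp w = - c1 / c2.
  by apply: cexp_surj; rewrite mulf_neq0 ?oppr_eq0 ?invr_eq0.
pose z0 := w / d.
have SE z : exp_sum c1 c2 a1 a2 z = c1 * cexp (a1 * z) * (1 - cexp (d * (z - z0))).
  rewrite /exp_sum.
  have -> : cexp (a2 * z) = cexp (a1 * z) * (cexp (d * (z - z0)) * cexp w).
    by rewrite -!cexpD; congr cexp; rewrite /z0 /d; field.
  by rewrite wE; field.
have fz0 : f z0 = 0.
  apply/eqP; rewrite -sqrf_eq0 fE SE subrr mulr0 cexp0 subrr mulr0//.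
have [phi cphi hphi] := hf z0.
have [psi [cpsi psi1 hpsi]] := @cexp_caratheodory0 R.
(* Off [z0] both sides are [f z ^+ 2] divided by [z - z0]. At [z0] the left side vanishes, while the
   right side is a nonzero multiple of an exponential. *)
have : phi z0 ^+ 2 * (z0 - z0) = - (c1 * cexp (a1 * z0) * psi (d * (z0 - z0)) * d).
  apply: (@ccont_uniq _ (fun z => phi z ^+ 2 * (z - z0))
     (fun z => - (c1 * cexp (a1 * z) * psi (d * (z - z0)) * d))).
  - by apply: ccontM; [exact: ccontX | exact: ccont_sub].
  - apply: ccontN; apply: ccontM; last exact: ccont_cst.
    apply: ccontM.
      apply: ccontM; first exact: ccont_cst.
      apply: ccont_comp; first exact: ccont_cexp.
      by apply: ccontM; [exact: ccont_cst | exact: ccont_id].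
    apply: (@ccont_comp _ psi (fun z => d * (z - z0))).
      by rewrite subrr mulr0.
    by apply: ccontM; [exact: ccont_cst | exact: ccont_sub].
  - move=> z zz0; have zz : z - z0 != 0 by rewrite subr_eq0.
    apply: (mulIf zz); have := fE z; rewrite SE (hphi z) fz0 add0r (hpsi (d * (z -
      z0))) => H.
    transitivity ((phi z * (z - z0)) ^+ 2); first ring.
    by rewrite H; ring.
rewrite subrr !mulr0 psi1 mulr1 => /esym /eqP; rewrite oppr_eq0.
by rewrite !mulf_eq0 (negPf c10) (negPf d0) (negPf (cexp_neq0 _)).
Qed.

(** Divided by e^(a z / 2), the function [f] has a constant square, hence at most two opposite
    values; a change of sign along the segment from 0 to [z] would contradict the intermediate value
    theorem. *)
Lemma sqrt_exp f a c : (forall z, holo f z) -> c != 0 ->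
  (forall z, f z ^+ 2 = c * cexp (a * z)) ->
  exists2 c1, c1 ^+ 2 = c & forall z, f z = c1 * cexp (a * z / 2).
Proof.
move=> hf c0 fE; pose g z := f z * cexp (- (a / 2) * z).
have hg z : ccont g z.
  apply: ccontM; first exact: holo_cont.
  apply: ccont_comp; first exact: ccont_cexp.
  by apply: ccontM; [exact: ccont_cst | exact: ccont_id].
have g2 z : g z ^+ 2 = c.
  rewrite exprMn fE -cexpMn -mulrA -cexpD (_ : _ + _ = 0) ?cexp0 ?mulr1//.
  by rewrite mulr2n; field.
have g00 : g 0 != 0 by rewrite -sqrf_eq0 g2.
have gC z : g z = g 0.
  have gpm w : g w / g 0 = 1 \/ g w / g 0 = -1.
    have : (g w / g 0) ^+ 2 = 1 by rewrite exprMn exprVn !g2 divff.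
    by move=> /eqP; rewrite sqrf_eq1 => /orP[/eqP|/eqP]; [left|right].
  have [|gz] := gpm z; first by move=> E; rewrite -[g z](divfK g00) E mul1r.
  exfalso; pose q (t : R) := complex.Re (g (t%:C * z) / g 0).
  have cq t : {for t, continuous q}.
    apply: (@cont_comp R (fun w => complex.Re (g w / g 0)) (fun t => t%:C * z)).
      apply: rcont_comp; first exact: rcont_Re.
      by apply: ccontM => //; exact: ccont_cst.
    apply: pcontM; last exact: pcont_cst.
    exact: pcont_hor.
  have [|t _ qt] := @IVT R q 0 1 0 ler01 (continuous_subspaceT cq).
    rewrite /q mul0r divff// mul1r gz /= ge_min le_max.
    by rewrite lerN10 ler01 orbT.
  by move: qt; rewrite /q; have [->|->] /= := gpm (t%:C * z); lra.
exists (g 0); first exact: g2.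
move=> z; rewrite -(gC z) /g -mulrA -cexpD (_ : _ + _ = 0) ?cexp0 ?mulr1//.
by field.
Qed.

Lemma linear_difference_exp (m : nat) (b beta : 'I_m -> C) c a :
  exists K, forall z, linear_difference b beta (fun z => c * cexp (a * z)) z
    = K * cexp (a * z).
Proof.
exists (\sum_(j < m) b j * c * cexp (a * beta j)) => z.
rewrite /linear_difference mulr_suml; apply: eq_bigr => j _.
by rewrite mulrDr cexpD; ring.
Qed.

(** Here the linear part is a multiple of e^(a1 z / 2). The annihilator for the exponents [a2] and
    [a1 / 2] removes everything except e^(a1 z), also when these two exponents coincide, so the
    coefficient [p1 - c1 ^+ 2] is zero. *)
Lemma exponential_solution (m : nat) (b beta : 'I_m -> C) f p1 p2 a1 a2 c1 :
  (forall z, f z ^+ 2 + linear_difference b beta f z = exp_sum p1 p2 a1 a2 z) ->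
  a1 != 0 -> a1 != a2 -> (forall z, f z = c1 * cexp (a1 * z / 2)) -> c1 ^+ 2 = p1.
Proof.
move=> fP a10 a12 fE; have [K LE] := linear_difference_exp b beta c1 (a1 / 2).
have ffE : f = (fun z => c1 * cexp (a1 / 2 * z)).
  by apply/funext => z; rewrite fE mulrAC.
have G0 z : exp_sum (p1 - c1 ^+ 2) p2 a1 a2 z - K * cexp (a1 / 2 * z) = 0.
  have := fP z; rewrite ffE LE /exp_sum exprMn -cexpMn => H.
  have e2 : a1 / 2 * z *+ 2 = a1 * z by rewrite mulr2n; field.
  rewrite e2 in H.
  transitivity ((p1 * cexp (a1 * z) + p2 * cexp (a2 * z))
    - (c1 ^+ 2 * cexp (a1 * z) + K * cexp (a1 / 2 * z))); first ring.
  by rewrite H subrr.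
have [h hne] := cexp_separate a12.
have a12' : a1 != a1 / 2.
  rewrite -subr_eq0 (_ : a1 - a1 / 2 = a1 / 2); last by field.
  by rewrite mulf_neq0// invr_eq0 pnatr_eq0.
have [k kne] := cexp_separate a12'.
have : (p1 - c1 ^+ 2) * ((cexp (a1 * h) - cexp (a2 * h)) * (cexp (a1 * k) - cexp
  (a1 / 2 * k))) = 0.
  transitivity (annihilator a2 (a1 / 2) h k
    (fun z => exp_sum (p1 - c1 ^+ 2) p2 a1 a2 z - K * cexp (a1 / 2 * z)) 0).
    by rewrite /annihilator /exp_sum !add0r !mulr0 !mulrDr !cexpD cexp0; ring.
  by rewrite /annihilator !G0 !mulr0 !subr0 addr0.
move/eqP; rewrite !mulf_eq0 !subr_eq0 (negPf hne) (negPf kne) !orbF => /eqP ->//.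
Qed.

Lemma annihilator_le a1 a2 h k : exists2 K, 1 <= K & forall F z (Y : R), 0 <= Y ->
  (forall w, cmod w <= cmod h + cmod k -> cmod (F (z + w)) <= Y) ->
  cmod (annihilator a1 a2 h k F z) <= K * Y.
Proof.
set e1 := cmod (cexp (a1 * h)); set e2 := cmod (cexp (a2 * k)).
have e10 : 0 <= e1 by exact: cmod_ge0.
have e20 : 0 <= e2 by exact: cmod_ge0.
have ch := cmod_ge0 h; have ck := cmod_ge0 k.
exists (1 + e1 + e2 + e1 * e2); first by have := mulr_ge0 e10 e20; lra.
move=> F z Y Y0 FY; rewrite /annihilator.
have f1 : cmod (F (z + h + k)) <= Y by rewrite -addrA; apply: FY; exact: cmodD.
have f2 : cmod (cexp (a1 * h) * F (z + k)) <= e1 * Y.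
  by rewrite cmodM ler_wpM2l// FY//; lra.
have f3 : cmod (cexp (a2 * k) * F (z + h)) <= e2 * Y.
  by rewrite cmodM ler_wpM2l// FY//; lra.
have f4 : cmod (cexp (a1 * h) * cexp (a2 * k) * F z) <= e1 * e2 * Y.
  rewrite !cmodM ler_wpM2l ?mulr_ge0// -[z]addr0 FY// cmod0; lra.
set x1 := F _ in f1 *; set x2 := _ * F _ in f2 *; set x3 := _ * F _ in f3 *.
set x4 := _ * F z in f4 *.
have := cmodD (x1 - x2 - x3) x4; have := cmodD (x1 - x2) (- x3).
have := cmodD x1 (- x2); rewrite !cmodN; lra.
Qed.

End ExponentialSums.

(** * The estimate of the characteristic by the zeros *)

Section Harnack.
Variable R : realType.
Notation C := R[i].
Implicit Types (r s t e : R) (z w x : C) (f g : C -> C) (u v : C -> R).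

(** With [d = e / 8] the gap between the circles gives [B <= d * (s - r)]. The shift by [w] then
    changes |x - z|, s - |z| and s + |z| by a relative amount of at most [d], and the ratio of (1 +
    d)^2 to (1 - d)^2 is at most 1 + e, its inverse at least 1 - e. *)
Lemma pker_harnack e (B r s : R) z w x : 0 < e <= 1 -> 0 < B ->
  r + 8 / e * B <= s -> cmod z = r -> cmod w <= B -> cmod x = s ->
  (1 - e) * pker z x <= pker (z + w) x <= (1 + e) * pker z x.
Proof.
move=> /andP[e0 e1] B0 rs zr wB xs.
have [d [d0 d8 dE]] : exists d, [/\ 0 < d, d <= 1 / 8 & e = 8 * d].
  by exists (e / 8); split; [rewrite divr_gt0 | lra | field].
have Bd : B <= d * (s - r).
  move: rs; rewrite dE -lerBrDl => h.
  have : d * (8 / (8 * d) * B) <= d * (s - r) by rewrite ler_pM2l.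
  by have -> : d * (8 / (8 * d) * B) = B by field; rewrite gt_eqF.
have r0 : 0 <= r by rewrite -zr cmod_ge0.
have sr : 0 < s - r by rewrite -(pmulr_rgt0 _ d0); exact: lt_le_trans Bd.
have zs : cmod z < s by rewrite zr; lra.
have dsr : d * (s - r) <= (s - r) / 8 by rewrite mulrC ler_wpM2l//; lra.
set q := cmod (z + w); have [q1 q2] : r - B <= q /\ q <= r + B.
  have := cmodD z w; have := cmodB_ge z (- w); rewrite opprK cmodN zr -/q; lra.
have q0 : 0 <= q by exact: cmod_ge0.
have zws : cmod (z + w) < s by rewrite -/q; lra.
rewrite (pkerE xs zs) (pkerE xs zws) -/q zr.
set D := cmod (x - z); set D' := cmod (x - (z + w)).
have Ds : s - r <= D by have := cmodB_ge x z; rewrite xs zr.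
have D0 : 0 < D by exact: lt_le_trans Ds.
have dD : d * (s - r) <= d * D by rewrite ler_pM2l.
have [D1 D2] : (1 - d) * D <= D' /\ D' <= (1 + d) * D.
  have := cmodD (x - (z + w)) w; have := cmodD (x - z) (- w).
  rewrite cmodN -[x - (z + w) + w]/_ (_ : x - (z + w) + w = x - z); last ring.
  by rewrite (_ : x - z - w = x - (z + w)); [rewrite -/D -/D'; lra | ring].
have dd0 : 0 < 1 - d by lra.
have D'0 : 0 < D' by apply: lt_le_trans D1; rewrite mulr_gt0.
have DD1 : ((1 - d) * D) ^+ 2 <= D' ^+ 2 by rewrite lerXn2r ?nnegrE// ltW// mulr_gt0.
have DD2 : D' ^+ 2 <= ((1 + d) * D) ^+ 2 by rewrite lerXn2r ?nnegrE// ltW//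
  mulr_gt0//; lra.
have fac t : s ^+ 2 - t ^+ 2 = (s - t) * (s + t) by ring.
have dsr2 : d * (s - r) <= d * (s + r) by rewrite ler_pM2l//; lra.
have N1 : (1 - d) ^+ 2 * (s ^+ 2 - r ^+ 2) <= s ^+ 2 - q ^+ 2.
  rewrite !fac (_ : _ * (_ * _) = ((1 - d) * (s - r)) * ((1 - d) * (s + r))); last ring.
  clear -dd0 sr r0 q1 q2 Bd dsr2.
  by apply: ler_pM; [rewrite mulr_ge0//; lra|rewrite mulr_ge0//; lra|lra|lra].
have N2 : s ^+ 2 - q ^+ 2 <= (1 + d) ^+ 2 * (s ^+ 2 - r ^+ 2).
  rewrite !fac [leRHS](_ : _ = ((1 + d) * (s - r)) * ((1 + d) * (s + r))); last ring.
  clear -sr r0 q0 q1 q2 dsr Bd dsr2.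
  by apply: ler_pM; lra.
have N0 : 0 < s ^+ 2 - r ^+ 2 by rewrite fac mulr_gt0//; lra.
have d2 : d * d <= d * (1 / 8) by rewrite ler_pM2l.
have k1 : (1 - e) * (1 + d) ^+ 2 <= (1 - d) ^+ 2.
  have : 0 <= d * d by rewrite mulr_ge0 ?ltW.
  have : 0 <= d * (d * d) by rewrite !mulr_ge0 ?ltW.
  rewrite dE !expr2; lra.
have k2 : (1 + d) ^+ 2 <= (1 + e) * (1 - d) ^+ 2.
  have : 0 <= d * (d * d) by rewrite !mulr_ge0 ?ltW.
  have : 0 <= d * d by rewrite mulr_ge0 ?ltW.
  rewrite dE !expr2; lra.
have D2p : 0 < D ^+ 2 by rewrite exprn_gt0.
have D'2p : 0 < D' ^+ 2 by rewrite exprn_gt0.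
set N := s ^+ 2 - r ^+ 2 in N0 N1 N2 *.
apply/andP; split; rewrite mulrA.
  rewrite ler_pdivrMr// mulrAC ler_pdivlMr//.
  apply: le_trans (_ : (1 - e) * N * ((1 + d) * D) ^+ 2 <= _).
    by apply: ler_wpM2l => //; apply: mulr_ge0; [rewrite subr_ge0 | exact: ltW].
  rewrite exprMn (_ : _ * _ * (_ * _) = ((1 - e) * (1 + d) ^+ 2) * N * D ^+ 2); last ring.
  rewrite ler_wpM2r ?(ltW D2p)//; apply: le_trans N1; rewrite ler_wpM2r// ltW//.
rewrite ler_pdivrMr// mulrAC ler_pdivlMr//.
apply: le_trans (_ : (1 + e) * N * ((1 - d) * D) ^+ 2 <= _); last first.
  by apply: ler_wpM2l => //; apply: mulr_ge0; [rewrite addr_ge0// ltW | exact: ltW].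
rewrite exprMn [leRHS](_ : _ = ((1 + e) * (1 - d) ^+ 2) * N * D ^+ 2); last ring.
rewrite ler_wpM2r ?(ltW D2p)//; apply: le_trans N2 _; rewrite ler_wpM2r// ltW//.
Qed.

Lemma poisson_harnack e (B r s : R) u z w : 0 < e <= 1 -> 0 < B ->
  r + 8 / e * B <= s -> cmod z = r -> cmod w <= B ->
  (forall x, cmod x = s -> rcont u x) -> (forall x, cmod x = s -> 0 <= u x) ->
  (1 - e) * poisson s u z <= poisson s u (z + w) <= (1 + e) * poisson s u z.
Proof.
move=> e01 B0 rs zr wB hu u0; have [e0 e1] := andP e01.
have Be : B < 8 / e * B by rewrite ltr_pMl// ltr_pdivlMr// mul1r; lra.
have zs : cmod z < s by rewrite zr; lra.
have zws : cmod (z + w) < s by apply: le_lt_trans (cmodD _ _) _; rewrite zr; lra.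
have s0 : 0 <= s by apply: le_trans (ltW zs); exact: cmod_ge0.
have cz x : cmod x = s -> rcont (fun x => pker z x * u x) x by move=> xs; exact:
  (rcont_pkerM hu zs xs).
have czw x : cmod x = s -> rcont (fun x => pker (z + w) x * u x) x by move=> xs;
  exact: (rcont_pkerM hu zws xs).
have cZ k x : cmod x = s -> rcont (fun x => k * (pker z x * u x)) x.
  by move=> xs; apply: rcontM; [exact: rcont_cst | exact: cz].
rewrite /poisson -!(rmeanZ _ s0 cz); apply/andP; split.
  apply: rmean_le; [exact: s0|exact: cZ|exact: czw|].
  move=> x xs; have /andP[h _] := pker_harnack e01 B0 rs zr wB xs.
  by rewrite mulrA ler_wpM2r// u0.
apply: rmean_le; [exact: s0|exact: czw|exact: cZ|].
move=> x xs; have /andP[_ h] := pker_harnack e01 B0 rs zr wB xs.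
by rewrite mulrA ler_wpM2r// u0.
Qed.

Lemma log_mean_le_characteristic f r : (forall z, holo f z) -> 0 <= r ->
  circle_free f r -> log_mean f r <= characteristic f r.
Proof.
move=> hf r0 fr; rewrite characteristic_entire//; apply: rmean_le => // z zr.
- by apply: rcont_logmod; [exact: fr | exact: holo_cont].
- by apply: rcont_logp; exact: holo_cont.
- exact: ln_le_logp.
Qed.

Lemma ln_logp_inv (x : R) : 0 < x -> ln x = logp x - logp x^-1.
Proof.
move=> x0; rewrite /logp lnV ?posrE//.
by case: (leP (ln x) 0) => h; case: (leP (- ln x) 0) => h'; lra.
Qed.

(* [log|Phi|] is controlled by both [U] and [2 U], where [U] is a harmonic
   majorant of [log|f|] on a bounded neighbourhood of the circle. *)
Lemma circle_estimate f Phi (B K e r s : R) : (forall z, holo f z) ->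
  (forall z, holo Phi z) -> 0 < B -> 1 <= K ->
  (forall z Y, 0 <= Y -> (forall w, cmod w <= B -> cmod (f (z + w)) <= Y) ->
     cmod (Phi z) <= K * Y /\ cmod (Phi z) <= K * Y ^+ 2) ->
  0 < e <= 1 -> 0 < r -> r + 8 / e * B <= s ->
  circle_free f r -> circle_free Phi r -> circle_free f s ->
  characteristic f r + log_mean f r + log_mean Phi r
  <= 3 * (log_mean f s + e * (2 * characteristic f s - log_mean f s)) + 2 * ln K.
Proof.
move=> hf hPhi B0 K1 hB e01 r0 rs fr Pr fs; have [e0 e1] := andP e01.
have Be : B < 8 / e * B by rewrite ltr_pMl// ltr_pdivlMr// mul1r; lra.
have rls : r < s by lra.
have s0 : 0 < s by lra.
pose u1 x := logp (cmod (f x)); pose u2 x := logp (cmod (f x)^-1).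
have cu1 x : cmod x = s -> rcont u1 x by move=> _; apply: rcont_logp; exact: holo_cont.
have cu2 x : cmod x = s -> rcont u2 x.
  move=> xs; apply: (@rcont_logp R (fun x => (f x)^-1)).
  by apply: ccontV; [exact: fs | exact: holo_cont].
have u10 x : cmod x = s -> 0 <= u1 x by move=> _; exact: logp_ge0.
have u20 x : cmod x = s -> 0 <= u2 x by move=> _; exact: logp_ge0.
have uE x : cmod x = s -> ln (cmod (f x)) = u1 x - u2 x.
  by move=> xs; rewrite /u2 cmodV ln_logp_inv// cmod_gt0 fs.
have cu x : cmod x = s -> rcont (fun x => u1 x - u2 x) x.
  by move=> xs; apply: rcontD; [exact: cu1 | apply: rcontN; exact: cu2].
pose U z := (1 + e) * poisson s u1 z - (1 - e) * poisson s u2 z.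
have maj z w : cmod z = r -> cmod w <= B -> cmod (f (z + w)) <= expR (U z).
  move=> zr wB.
  have zws : cmod (z + w) < s by apply: le_lt_trans (cmodD _ _) _; rewrite zr; lra.
  apply: le_trans (_ : expR (poisson s (fun x => u1 x - u2 x) (z + w)) <= _).
    apply: poisson_majorant => // x xs.
    by rewrite -uE// lnK// posrE cmod_gt0 fs.
  rewrite ler_expR poissonB// /U.
  have /andP[_ h1] := poisson_harnack e01 B0 rs zr wB cu1 u10.
  have /andP[h2 _] := poisson_harnack e01 B0 rs zr wB cu2 u20.
  lra.
have cp i z : cmod z = r -> (i = u1 \/ i = u2) -> rcont (poisson s i) z.
  move=> zr hi; apply: rcont_poisson; last by rewrite zr.
  by case: hi => ->.
have cU z : cmod z = r -> rcont U z.
  move=> zr; apply: rcontD; last apply: rcontN.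
    by apply: rcontM; [exact: rcont_cst | apply: cp => //; left].
  by apply: rcontM; [exact: rcont_cst | apply: cp => //; right].
have rI : 0 < r < s by rewrite r0.
(* The boundary data are u1 - u2 plus e times u1 + u2 = 2 u1 - (u1 - u2); the means of u1 and u1 -
   u2 are the characteristic and [log_mean]. *)
have UE : rmean r U = log_mean f s + e * (2 * characteristic f s - log_mean f s).
  have Z k i : (i = u1 \/ i = u2) -> rmean r (fun z => k * poisson s i z) = k * rmean s i.
    move=> hi; rewrite (rmeanZ _ (ltW r0)); last by move=> z zr; exact: cp.
    by rewrite (rmean_poisson rI)//; case: hi => ->.
  rewrite /U rmeanB; first 1 last.
  - exact: ltW.
  - by move=> z zr; apply: rcontM; [exact: rcont_cst | apply: cp => //; left].
  - by move=> z zr; apply: rcontM; [exact: rcont_cst | apply: cp => //; right].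
  rewrite !Z; [|by right|by left].
  have TE : characteristic f s = rmean s u1 by rewrite characteristic_entire.
  have JE : log_mean f s = rmean s u1 - rmean s u2.
    by rewrite -(rmeanB (ltW s0) cu1 cu2); apply: eq_rmean => // ; exact: ltW.
  rewrite JE TE; ring.
rewrite -UE -(rmean_cst r (2 * ln K)).
have cT z : cmod z = r -> rcont (fun z => logp (cmod (f z))) z.
  by move=> _; apply: rcont_logp; exact: holo_cont.
have cf z : cmod z = r -> rcont (fun z => ln (cmod (f z))) z.
  by move=> zr; apply: rcont_logmod; [exact: fr | exact: holo_cont].
have cPhi z : cmod z = r -> rcont (fun z => ln (cmod (Phi z))) z.
  by move=> zr; apply: rcont_logmod; [exact: Pr | exact: holo_cont].
have cTf z : cmod z = r -> rcont (fun z => logp (cmod (f z)) + ln (cmod (f z))) z.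
  by move=> zr; apply: rcontD; [exact: cT | exact: cf].
have c3U z : cmod z = r -> rcont (fun z => 3 * U z) z.
  by move=> zr; apply: rcontM; [exact: rcont_cst | exact: cU].
have ck z : cmod z = r -> rcont (fun=> 2 * ln K) z by move=> _; exact: rcont_cst.
rewrite (characteristic_entire _ hf) /log_mean.
rewrite -(rmeanD (ltW r0) cT cf) -(rmeanD (ltW r0) cTf cPhi).
rewrite -(rmeanZ _ (ltW r0) cU) -(rmeanD (ltW r0) c3U ck).
apply: rmean_le; first exact: ltW.
- by move=> z zr; apply: rcontD; [exact: cTf | exact: cPhi].
- by move=> z zr; apply: rcontD; [exact: c3U | exact: ck].
move=> z zr; have K0 : 0 < K by exact: lt_le_trans K1.
have fz0 : 0 < cmod (f z) by rewrite cmod_gt0 fr.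
have Pz0 : 0 < cmod (Phi z) by rewrite cmod_gt0 Pr.
have [P1 P2] := hB z (expR (U z)) (expR_ge0 _) (fun w => maj z w zr).
have lnf : ln (cmod (f z)) <= U z.
  rewrite -ler_expR lnK// -[z in f z]addr0; apply: maj => //.
  by rewrite cmod0 ltW.
have lK : 0 <= ln K by exact: ln_ge0.
have lP1 : ln (cmod (Phi z)) <= ln K + U z.
  by rewrite -ler_expR lnK// expRD [expR (ln K)]lnK.
have lP2 : ln (cmod (Phi z)) <= ln K + 2 * U z.
  by rewrite -ler_expR lnK// mulr_natl expRD [expR (ln K)]lnK// mulr2n expRD -expr2.
clear -lnf lK lP1 lP2; clearbody U.
(* Where |f| >= 1, log|f| counts twice and the linear bound adds one [U]; where |f| < 1 it counts
   once and the quadratic bound adds two. *)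
by rewrite /logp; case: (leP (ln (cmod (f z))) 0) => h; lra.
Qed.

End Harnack.

(** * Comparison of the characteristic with the counting function of zeros *)

Section ZeroCounting.
Variable R : realType.
Notation C := R[i].
Implicit Types (r s t e : R) (z w x : C) (f g : C -> C).

Lemma countable_bad_radii f z1 : (forall z, holo f z) -> f z1 != 0 ->
  countable [set r | ~ circle_free f r].
Proof.
move=> hf f1.
apply: (@sub_countable _ _ _ (\bigcup_(n : nat) [set r | r <= n%:R /\ ~ circle_free
  f r])).
  apply: subset_card_le => r /= hr.
  by exists (Num.bound `|r|) => //=; split => //;
     apply: le_trans (ler_norm r) _; apply: ltW; exact: archi_boundP.
apply: bigcup_countable => // n _; apply: finite_set_countable.
have [l hl] := @finite_bad_radii R f z1 n%:R hf f1.
apply: (sub_finite_set _ (finite_seq l)) => r /= [rn hr].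
by apply/negPn/negP => rl; apply: hr; exact: hl.
Qed.

Lemma characteristic_le_counting f Phi z1 z2 (B K L c r1 : R) :
  (forall z, holo f z) -> (forall z, holo Phi z) -> f z1 != 0 -> Phi z2 != 0 ->
  0 < B -> 1 <= K ->
  (forall z Y, 0 <= Y -> (forall w, cmod w <= B -> cmod (f (z + w)) <= Y) ->
     cmod (Phi z) <= K * Y /\ cmod (Phi z) <= K * Y ^+ 2) ->
  0 < L -> (forall r, 0 <= r -> characteristic f r <= L * (r + 1)) ->
  0 < c -> (forall r, r1 <= r -> c * r <= characteristic f r) ->
  forall eps, 0 < eps -> exists r2, forall r, r2 <= r ->
    circle_free f r -> circle_free Phi r ->
    characteristic f r - 2 * counting_function (fun z => (f z)^-1) r
    <= eps * characteristic f r.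
Proof.
move=> hf hPhi f1 P2 B0 K1 hB L0 hT c0 hc eps eps0.
(* Harnack's inequality costs [18 * e * L * r] in the end; as [c * r] lies below the characteristic,
   this choice keeps the cost within eps/2 times the characteristic. *)
pose e := Num.min 1 (eps * c / (36 * L)).
have e0 : 0 < e by rewrite lt_min ltr01 divr_gt0 ?mulr_gt0.
have e01 : 0 < e <= 1 by rewrite e0 ge_min lexx.
have eL : 18 * e * L <= eps * c / 2.
  have : e <= eps * c / (36 * L) by rewrite ge_min lexx orbT.
  by rewrite ler_pdivlMr ?mulr_gt0//; lra.
have [rb /andP[rb0 _] frb] := circle_free_dense hf f1 (@ltr01 R).
have [rp /andP[rp0 _] frp] := circle_free_dense hPhi P2 (@ltr01 R).
pose j0 := log_mean f rb; pose phi0 := log_mean Phi rp.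
pose n0 := j0 - counting_function (fun z => (f z)^-1) rb.
pose A := 8 / e * B; have A0 : 0 < A by rewrite mulr_gt0// divr_gt0.
have ln20 : 0 < ln 2 :> R by rewrite ln_gt0// ltr1n.
(* A bound for the increment of [log_mean f] from [r] to [s]. By convexity it is at most ln(s/r) /
   ln(t/s) times the increment from [s] to [t], hence at most (A + 1) / (r ln 2) times (7 L + |j0|)
   r, and the radius cancels. *)
pose Q1 := (7 * L + `|j0|) * (A + 1) / ln 2.
pose Q := 2 * n0 + 3 * Q1 + 3 * `|j0| + 2 * ln K - phi0.
exists (Num.max (Num.max (Num.max 1 (A + 1)) (Num.max rb rp)) (Num.max r1 (2 * Q /
  (eps * c)))).
move=> r; rewrite !ge_max => /andP[/andP[/andP[r_1 rA] /andP[rrb rrp]] /andP[rr1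
  rQ]] fr Pr.
have rpos : 0 < r by lra.
have As : r + A < r + A + 1 by rewrite ltrDl.
(* The outer radius [s] leaves the gap [A] for Harnack's inequality, and [t] lies beyond [2 * s] for
   the convexity; each is picked in an interval so as to avoid zeros. *)
have [s /andP[s1 s2] fs] := circle_free_dense hf f1 As.
have s0 : 0 < s by lra.
have s23 : 2 * s < 3 * s by lra.
have [t /andP[t1 t2] ft] := circle_free_dense hf f1 s23.
have t0 : 0 < t by lra.
have rs : r <= s by lra.
have st : s <= t by lra.
have rI : 0 < rb <= r by rewrite rb0.
have jr : j0 <= log_mean f r by apply: log_mean_mono hf f1 rI frb fr.
have js : j0 <= log_mean f s.
  by apply: (log_mean_mono hf f1 _ frb fs); rewrite rb0 (le_trans rrb).
have pr : phi0 <= log_mean Phi r.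
  by apply: (log_mean_mono hPhi P2 _ frp Pr); rewrite rp0.
have Nr : log_mean f r - counting_function (fun z => (f z)^-1) r = n0.
  exact: log_mean_counting hf f1 rpos rb0 fr frb.
have jt : log_mean f t <= L * (t + 1).
  by apply: le_trans (hT _ (ltW t0)); apply: log_mean_le_characteristic => //; exact: ltW.
have Ts := hT _ (ltW s0).
have conv := log_mean_convex hf f1 rpos rs st fr fs ft.
have j0n := ler_norm j0; have j0n' : - j0 <= `|j0| by rewrite -normrN ler_norm.
have jrs : log_mean f r <= log_mean f s.
  by apply: (log_mean_mono hf f1 _ fr fs); rewrite rpos.
have est := circle_estimate hf hPhi B0 K1 hB e01 rpos (ltW s1) fr Pr fs.
have diff : log_mean f s - log_mean f r <= Q1.
  have l2 : ln 2 <= ln (t / s).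
    by rewrite ler_ln ?posrE ?divr_gt0// ler_pdivlMr// ltW.
  have lr : ln (s / r) <= (A + 1) / r.
    apply: le_trans (_ : s / r - 1 <= _).
      have srp : 0 < s / r by rewrite divr_gt0.
      by have := expR_ge1Dx (ln (s / r)); rewrite lnK//; clear -s r; lra.
    rewrite (_ : s / r - 1 = (s - r) / r); last by field; rewrite gt_eqF.
    by rewrite ler_pM2r ?invr_gt0//; clear -s2; lra.
  have lr0 : 0 <= ln (s / r) by rewrite ln_ge0// ler_pdivlMr// mul1r.
  have num : log_mean f t - log_mean f s <= (7 * L + `|j0|) * r.
    have : L * (t + 1) <= 7 * L * r 
      by rewrite [7 * L]mulrC -mulrA ler_pM2l//; clear -t2 s2 rA r_1; lra.
    have : `|j0| <= `|j0| * r by rewrite ler_peMr.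
    by clear -jt js j0n'; lra.
  have nn : 0 <= (7 * L + `|j0|) * r by rewrite mulr_ge0 ?addr_ge0 ?mulr_ge0// ltW.
  rewrite /Q1 ler_pdivlMr//.
  apply: le_trans (_ : (log_mean f s - log_mean f r) * ln (t / s) <= _).
    by rewrite ler_wpM2l// subr_ge0.
  apply: le_trans conv _.
  apply: le_trans (_ : (7 * L + `|j0|) * r * ((A + 1) / r) <= _).
    apply: le_trans (_ : (7 * L + `|j0|) * r * ln (s / r) <= _).
      exact: ler_wpM2r.
    exact: ler_wpM2l.
  by rewrite le_eqVlt; apply/orP; left; apply/eqP; field; rewrite gt_eqF.
have Tlow := hc _ rr1.
have eT : e * (2 * characteristic f s - log_mean f s) <= e * (6 * L * r) + `|j0|.
  apply: le_trans (_ : e * (6 * L * r + `|j0|) <= _).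
    rewrite ler_pM2l//.
    have : L * (s + 1) <= L * (3 * r).
      by rewrite ler_pM2l//; clear -s2 rA r_1; lra.
    by clear -Ts js j0n'; lra.
  by rewrite mulrDr lerD2l ler_piMl//; case/andP: e01.
have er : 18 * e * L * r <= eps * c / 2 * r by rewrite ler_pM2r.
have Qr : Q <= eps * c / 2 * r.
  by move: rQ; rewrite ler_pdivrMr ?mulr_gt0//; clear -Q; lra.
have ecT : eps * (c * r) <= eps * characteristic f r by rewrite ler_pM2l.
by clear -est diff eT er Qr ecT Tlow pr Nr jr js; rewrite /Q in Qr; lra.
Qed.

End ZeroCounting.

(** * The two bounds for the annihilated square, and the theorem *)

Section Main.
Variable R : realType.
Notation C := R[i].

(** Since the exponential sum is annihilated, the operator applied to [f ^+ 2] is minus the operator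
    applied to the linear part: this gives the linear bound, and [f ^+ 2] itself the quadratic one.
    [B] covers the shifts of the operator and of the equation together. *)
Lemma annihilator_solution_le (m : nat) (b beta : 'I_m -> C) f p1 p2 a1 a2 h k :
  (forall z, f z ^+ 2 + linear_difference b beta f z = exp_sum p1 p2 a1 a2 z) ->
  exists B K : R, [/\ 0 < B, 1 <= K & forall z Y, 0 <= Y ->
    (forall w, cmod w <= B -> cmod (f (z + w)) <= Y) ->
    cmod (annihilator a1 a2 h k (fun z => f z ^+ 2) z) <= K * Y /\
    cmod (annihilator a1 a2 h k (fun z => f z ^+ 2) z) <= K * Y ^+ 2].
Proof.
move=> fP; have [K K1 hK] := annihilator_le a1 a2 h k; have K0 := le_trans ler01 K1.
have B1 := cmod_sum1_ge1 b; have be1 := cmod_sum1_ge1 beta.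
have ch := cmod_ge0 h; have ck := cmod_ge0 k.
exists (cmod h + cmod k + cmod_sum1 beta), (K * cmod_sum1 b); split.
- by lra.
- by apply: le_trans K1 _; rewrite ler_peMr.
move=> z Y Y0 fY; split.
  have -> : annihilator a1 a2 h k (fun z => f z ^+ 2) z
      = - annihilator a1 a2 h k (linear_difference b beta f) z.
    apply/eqP; rewrite -subr_eq0 opprK -annihilatorD; apply/eqP.
    rewrite -[RHS](annihilator_exp_sum p1 p2 a1 a2 h k z).
    by congr annihilator; apply/funext => x; exact: fP.
  rewrite cmodN -mulrA; apply: hK.
    by apply: mulr_ge0 => //; exact: le_trans ler01 B1.
  move=> w hw; apply: linear_difference_le => // j; rewrite -addrA; apply: fY.
  by apply: le_trans (cmodD _ _) _; apply: lerD => //; exact: shift_le.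
apply: le_trans (_ : K * Y ^+ 2 <= _); last first.
  by rewrite ler_wpM2r ?sqr_ge0// ler_peMr.
apply: hK; first exact: sqr_ge0.
move=> w hw; rewrite cmodX lerXn2r ?nnegrE ?cmod_ge0//; apply: fY; lra.
Qed.

End Main.

Theorem theorem7 (R : realType) (p1 p2 alpha1 alpha2 : R[i])
    (hp1 : p1 != 0) (hp2 : p2 != 0)
    (halpha1 : alpha1 != 0) (halpha2 : alpha2 != 0)
    (halpha : alpha1 != alpha2)
    (m : nat) (b beta : 'I_m -> R[i])
    (f : R[i] -> R[i])
    (hf : transcendental_entire f)
    (hf2 : (hyper_order f < 1%:E)%E)
    (hsol : forall z : R[i],
       f z ^+ 2 + linear_difference b beta f z
       = p1 * cexp (alpha1 * z) + p2 * cexp (alpha2 * z)) :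
  growth_order f = 1%:E /\
  [\/ (exists S : R -> R, small_quantity f S /\
         forall r : R, 0 < r ->
           characteristic f r
           <= 2 * counting_function (fun z => (f z)^-1) r + S r),
      (exists c1 : R[i], c1 ^+ 2 = p1 /\
         forall z : R[i], f z = c1 * cexp (alpha1 * z / 2)) |
      (exists c2 : R[i], c2 ^+ 2 = p2 /\
         forall z : R[i], f z = c2 * cexp (alpha2 * z / 2)) ].
Proof.
have [/entire_holo fh ntr] := hf.
have fP z : f z ^+ 2 + linear_difference b beta f z = exp_sum p1 p2 alpha1 alpha2 z.
  exact: hsol.
have [z1 fz1] : exists z1, f z1 != 0.
  apply: contrapT => H; apply: ntr; exists 0 => z; rewrite horner0.
  by apply/eqP/negPn/negP => fz; apply: H; exists z.
have [sigma [r0 [sigma1 hT]]] := hyper_order_lt1 hf2.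
have [A A0 hA] := exp_sum_upper p1 p2 alpha1 alpha2.
have [L L0 hL] := difference_exponential_type fh A0 fP hA sigma1 hT.
have [k [k0 [kpos hk]]] := exp_sum_lower hp1 hp2 halpha1 halpha2 halpha.
have [c [r1 [c0 r10 hc]]] := difference_growth_lower fh kpos fP hk.
have TL r : 0 <= r -> characteristic f r <= L * (r + 1).
  move=> rpos; apply: characteristic_le => //; first by rewrite mulr_ge0 ?addr_ge0// ltW.
  by move=> z zr; rewrite -zr.
split.
  apply: (@growth_order_eq1 R f c L r1) => // r rr1.
  by rewrite hc// TL// (le_trans (ltW r10)).
(* As [f] is not identically zero, the exponential whose root is extracted has a nonzero
   coefficient. *)
have nz c1 a : (forall z, f z ^+ 2 = c1 * cexp (a * z)) -> c1 != 0.
  by move=> fE; apply: contraNneq fz1 => cE; rewrite -sqrf_eq0 fE cE mul0r.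
have [van|nvan] := pselect (forall h k z,
    annihilator alpha1 alpha2 h k (fun z => f z ^+ 2) z = 0).
  have [c1 [c2 fE]] := annihilated_exp_sum halpha van.
  have [cE|cE] := square_exp_sum fh halpha fE.
    have fE2 z : f z ^+ 2 = c2 * cexp (alpha2 * z).
      by rewrite fE cE /exp_sum mul0r add0r.
    have [d dE fd] := sqrt_exp fh (nz _ _ fE2) fE2.
    apply: Or33; exists d; split => //.
    have fP' z : f z ^+ 2 + linear_difference b beta f z = exp_sum p2 p1 alpha2 alpha1 z.
      by rewrite fP /exp_sum addrC.
    by apply: (exponential_solution fP' halpha2 _ fd); rewrite eq_sym.
  have fE1 z : f z ^+ 2 = c1 * cexp (alpha1 * z).
    by rewrite fE cE /exp_sum mul0r addr0.
  have [d dE fd] := sqrt_exp fh (nz _ _ fE1) fE1.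
  by apply: Or32; exists d; split => //; exact: (exponential_solution fP halpha1
    halpha fd).
apply: Or31.
have [h [l [z2 Pz2]]] : exists h l z2,
    annihilator alpha1 alpha2 h l (fun z => f z ^+ 2) z2 != 0.
  apply: contrapT => H; apply: nvan => h l z; apply/eqP/negPn/negP => Hz.
  by apply: H; exists h, l, z.
set Phi := annihilator alpha1 alpha2 h l (fun z => f z ^+ 2) in Pz2.
have hPhi z : holo Phi z by apply: holo_annihilator => w; exact: holoX.
have [B [K [B0 K1 hB]]] := annihilator_solution_le h l fP.
(* With [S] the positive part of the excess the inequality holds by construction; the content is
   that [S] is small. *)
pose S r := Num.max (characteristic f r - 2 * counting_function (fun z => (f z)^-1) r) 0.
exists S; split; last by move=> r _; rewrite addrC -lerBlDr /S le_max lexx.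
(* Radii of circles through a zero of [f] or of [Phi]: a countable, hence null set. *)
pose E := \bigcup_(i : bool) [set r | ~ circle_free (if i then f else Phi) r].
have cE : countable E.
  apply: bigcup_countable => // -[_|_]; first exact: countable_bad_radii fh fz1.
  exact: countable_bad_radii hPhi Pz2.
exists E; split.
- exact: countable_measurable.
- by rewrite countable_lebesgue_measure0.
move=> eps eps0.
have [r2 hr2] := characteristic_le_counting fh hPhi fz1 Pz2 B0 K1 hB L0 TL c0 hc eps0.
near=> r => nE.
have r2r : r2 <= r by near: r; apply: nbhs_pinfty_ge; exact: num_real.
have rpos : 0 <= r by near: r; apply: nbhs_pinfty_ge; exact: num_real.
have [fr Pr] : circle_free f r /\ circle_free Phi r.
  by split; apply: contrapT => H; apply: nE; [exists true | exists false].
have T0 := characteristic_ge0 fh rpos.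
rewrite (ger0_norm T0) ger0_norm ?le_max ?lexx ?orbT// /S ge_max.
by rewrite hr2//= mulr_ge0// ltW.
Unshelve. all: by end_near. Qed.
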